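(* Let $(g,J,\omega,A)$ be given on $W$ by the normal form described in the context ($A$ is c-compatible with the Kähler structure $(g,J)$), where $A$ is semi-simple and all constant eigenvalues of $A$ are real. Let $\varrho_1,\dots,\varrho_r$ be the non-constant and $\varrho_{r+1},\dots,\varrho_{r+R}$ the constant eigenvalues of $A$, with algebraic multiplicities $m(\varrho_i)$; put $E=\{\varrho_1,\dots,\varrho_{r+R}\}$ and $E^{c}=\{\varrho_{r+1},\dots,\varrho_{r+R}\}$. For $t\in\mathbb R$ let $$\hat Q_t=-\nabla_j\circ K_t^{jk}\circ\nabla_k+\hat U_t,\qquad K_t^{ij}=\sqrt{\det(t\,\mathrm{Id}-A)}\,\big((t\,\mathrm{Id}-A)^{-1}\big)^i_lg^{lj},$$ $$\hat L_t=\tfrac i2\big(\nabla_j\circ V_t^j+V_t^j\circ\nabla_j\big),\qquad V_t^j=J^j_kg^{ki}\nabla_i\sqrt{\det(t\,\mathrm{Id}-A)},$$ where $\hat U_t$ is multiplication by $$U_t=\sum_{i=1}^{r+R}\ \prod_{\varrho_l\in E\setminus\{\varrho_i\}}\frac{(t-\varrho_l)^{m(\varrho_l)/2}}{(\varrho_i-\varrho_l)^{m(\varrho_l)/2}}\,(t-\varrho_i)^{m(\varrho_i)/2-1}f_i$$ with functions $f_i$ satisfying $\mathrm df_i\circ A=\varrho_i\,\mathrm df_i$. Then a (not identically zero) function $\psi$ is a simultaneous eigenfunction of $\hat Q_t$ and $\hat L_t$ for all $t\in\mathbb R$ (with eigenvalues depending on $t$) if and only if there exist constants $\tilde\lambda_0,\dots,\tilde\lambda_{r+R-1},\omega_1,\dots,\omega_r$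 such that, with $\lambda_0,\dots,\lambda_{n-1}$ defined by $$\sum_{j=0}^{n-1}\lambda_js^j=\prod_{\varrho_\gamma\in E^{c}}(s-\varrho_\gamma)^{m(\varrho_\gamma)/2-1}\sum_{j=0}^{r+R-1}\tilde\lambda_js^j,$$ the following equations hold. (1) For $q=1,\dots,r$: $\ \partial_{t_q}\psi=i\,\omega_q\psi$. (2) For $k=1,\dots,r$, with $\varrho_k'=\partial\varrho_k/\partial\chi_k$: $$-\frac{1}{\varepsilon_k\varrho_k'}\,\partial_{\chi_k}\Big(\varrho_k'\prod_{\varrho_\gamma\in E^{c}}(\varrho_k-\varrho_\gamma)^{m(\varrho_\gamma)/2}\,\partial_{\chi_k}\psi\Big)+\sum_{a,b=1}^r\frac{\varepsilon_k(-\varrho_k)^{2r-a-b}}{(\varrho_k')^2}\prod_{\varrho_\gamma\in E^{c}}(\varrho_k-\varrho_\gamma)^{m(\varrho_\gamma)/2}\,\omega_a\omega_b\,\psi+f_k\psi=\sum_{j=0}^{n-1}\lambda_j\varrho_k^j\,\psi .$$ (3) For $\gamma=r+1,\dots,r+R$, with $y=(y_1,y_2,\dots)$ the coordinates on $S_\gamma$, $D=|\det g_\gamma|^{1/2}$ and summation over the repeated indices $a,b$: $$\begin{aligned}\sum_{j=0}^{r+R-1}\tilde\lambda_j\varrho_\gamma^j\,\psi={}&-\prod_{\varrho_c\in E^{c}\setminus\{\varrho_\gamma\}}(\varrho_\gamma-\varrho_c)\Big[\frac1D\partial_{y_a}\big(g_\gamma^{ab}D\,\partial_{y_b}\psi\big)-i\sum_{q=1}^r\frac1D\partial_{y_a}\big(g_\gamma^{ab}D\,\alpha^{\gamma}_{qb}\,\omega_q\psi\big)\\&-i\sum_{q=1}^rg_\gamma^{ab}\alpha^\gamma_{qa}\omega_q\,\partial_{y_b}\psi-\sum_{p,q=1}^rg_\gamma^{ab}\alpha^\gamma_{qa}\alpha^\gamma_{pb}\,\omega_q\omega_p\,\psi\Big]+\frac{1}{\prod_{\varrho_c\in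 E^{c}\setminus\{\varrho_\gamma\}}(\varrho_\gamma-\varrho_c)^{m(\varrho_c)/2-1}}\,f_\gamma\psi .\end{aligned}$$
   Context: c-compatible: on a Kähler manifold $(\mathcal M^{2n},g,J)$ of arbitrary signature ($J^2=-\mathrm{Id}$, $g(JX,Y)=-g(X,JY)$, $\nabla J=0$ for the Levi-Civita connection $\nabla$ of $g$, $\Omega(X,Y)=g(JX,Y)$), a $(1,1)$-tensor $A$ is c-compatible if it is $g$-self-adjoint, commutes with $J$ and satisfies $\nabla_kA_{ij}=\lambda_ig_{jk}+\lambda_jg_{ik}+\bar\lambda_i\Omega_{jk}+\bar\lambda_j\Omega_{ik}$ with $\lambda=\frac14\operatorname{tr}A$, $\lambda_i=\nabla_i\lambda$, $\bar\lambda_i=J^j_i\lambda_j$. All eigenvalues of $A$ then have even algebraic multiplicity, and $\sqrt{\det(t\,\mathrm{Id}-A)}$ is the monic degree-$n$ polynomial in $t$ obtained by halving the powers of the eigenvalue factors of $\det(t\,\mathrm{Id}-A)$; $K_t$ is then polynomial of degree $n-1$ in $t$. Operators act on complex-valued functions: $\hat Q_tf=-\nabla_j(K_t^{jk}\nabla_kf)+U_tf$, $\hat L_tf=\frac i2(\nabla_j(V_t^jf)+V_t^j\nabla_jf)$. The symbol $i$ as a factor is the imaginary unit. $\mathrm df\circ A$ is the one-form $X\mapsto\mathrm df(AX)$. Normal form (written for the case that all constant eigenvalues are real). Let $2n\ge4$, $r=2l+q$, and let $W=U\times V\times S_{r+1}\times\dots\times S_{r+R}\subseteq\mathbb R^{2n}$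 with $U,V\subseteq\mathbb R^r$ and $S_\gamma\subseteq\mathbb R^{m(\varrho_\gamma)}$ open. - On $U$ the coordinates are $l$ complex coordinates $z_1,\dots,z_l$ and $q$ real coordinates $x_{l+1},\dots,x_{l+q}$; write $(\chi_1,\dots,\chi_r)=(z_1,\bar z_1,\dots,z_l,\bar z_l,x_{l+1},\dots,x_{l+q})$. On $V$ the coordinates are $t_1,\dots,t_r$ (not to be confused with the parameter $t$). On $S_\gamma$ the coordinates are $y=(y_1,y_2,\dots)$. - Given are: holomorphic functions $\sigma_j(z_j)$, $1\le j\le l$, and smooth real functions $\sigma_j(x_j)$, $l+1\le j\le l+q$; on each $S_\gamma$ a Kähler structure $(g_\gamma,J_\gamma,\omega_\gamma)$, with $\omega_\gamma=g_\gamma(J_\gamma\cdot,\cdot)$, and a parallel Hermitian endomorphism $A_\gamma$ of $TS_\gamma$ having a single real constant eigenvalue $\varrho_\gamma$ (so $A_\gamma=\varrho_\gamma\mathrm{Id}$ when $A$ is semi-simple); the $\varrho_\gamma$ are pairwise distinct, of (even) multiplicity $m(\varrho_\gamma)=\dim S_\gamma$. - Put $(\varrho_1,\dots,\varrho_r)=(\sigma_1,\bar\sigma_1,\dots,\sigma_l,\bar\sigma_l,\sigma_{l+1},\dots,\sigma_{l+q})$, with $m(\varrho_k)=2$ for $k\le r$. Assume that at every point of $W$ the values $\varrho_1,\dots,\varrho_r$ are mutually different, different from all constants $\varrho_\gamma$, and have non-zero differentials. - One-forms $\alpha_1,\dots,\alpha_r$ on $S_{r+1}\times\dots\times S_{r+R}$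 are chosen with $\mathrm d\alpha_i=(-1)^i\sum_\gamma\omega_\gamma(A_\gamma^{r-i}\cdot,\cdot)$; write $\alpha_i=\sum_{\gamma,b}\alpha^\gamma_{ib}\,\mathrm dy_b$ (where for each $\gamma$ the $y_b$ are the coordinates on $S_\gamma$), and $\vartheta_i=\mathrm dt_i+\alpha_i$. - $\Delta_k=\prod_{j\le r,\,j\ne k}(\varrho_k-\varrho_j)$; $\mu_i$ is the elementary symmetric polynomial of degree $i$ in $\varrho_1,\dots,\varrho_r$; $\mu_i(\hat\varrho_s)$ is the one of degree $i$ in $\varrho_1,\dots,\varrho_r$ with $\varrho_s$ omitted; $(\varepsilon_1,\dots,\varepsilon_r)=(-\frac14,\dots,-\frac14,\pm1,\dots,\pm1)$, with $2l$ entries $-\frac14$ followed by $q$ signs. Then $$g=\sum_{i=1}^r\varepsilon_i\Delta_i\,\mathrm d\chi_i^2+\sum_{i=0}^r(-1)^i\mu_i\sum_\gamma g_\gamma(A_\gamma^{r-i}\cdot,\cdot)+\sum_{i,j=1}^r\Big[\sum_{s=1}^r\frac{\mu_{i-1}(\hat\varrho_s)\mu_{j-1}(\hat\varrho_s)}{\varepsilon_s\Delta_s}\Big(\frac{\partial\varrho_s}{\partial\chi_s}\Big)^2\Big]\vartheta_i\vartheta_j,$$ $$\omega=\sum_{i=1}^r\mathrm d\mu_i\wedge\vartheta_i+\sum_{i=0}^r(-1)^i\mu_i\sum_\gamma\omega_\gamma(A_\gamma^{r-i}\cdot,\cdot),$$ $J$ is determined by $\omega=g(J\cdot,\cdot)$,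 and in particular $$\mathrm d\chi_i\circ J=-\frac{1}{\varepsilon_i\Delta_i}\frac{\partial\varrho_i}{\partial\chi_i}\sum_{j=1}^r\mu_{j-1}(\hat\varrho_i)\,\vartheta_j,\qquad \vartheta_i\circ J=(-1)^{i-1}\sum_{j=1}^r\varepsilon_j\varrho_j^{r-i}\Big(\frac{\partial\varrho_j}{\partial\chi_j}\Big)^{-1}\mathrm d\chi_j,$$ and $$A=\sum_{s=1}^r\varrho_s\,\mathrm d\chi_s\otimes\partial_{\chi_s}+\sum_{i,j=1}^r(\mu_i\delta_{1j}-\delta_{i,j-1})\,\vartheta_i\otimes\partial_{t_j}+\sum_\gamma\sum_{a,b}(A_\gamma)^b_a\,\mathrm dy_a\otimes\Big(\partial_{y_b}-\sum_{i=1}^r\alpha^\gamma_{ib}\,\partial_{t_i}\Big).$$ It is known that $(g,J)$ is Kähler and $A$ is c-compatible with it. $\partial_{z},\partial_{\bar z}$ are the usual Wirtinger derivatives. *)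

(* Defs.v *)
From HB Require Import structures.
From mathcomp Require Import all_boot all_order all_algebra.
From mathcomp Require Import boolp classical_sets reals topology normedtype derive.
From mathcomp.real_closed Require Import complex.

Set Implicit Arguments.
Unset Strict Implicit.
Unset Printing Implicit Defensive.

Import numFieldNormedType.Exports.
Import Order.TTheory GRing.Theory Num.Theory.
Local Open Scope classical_set_scope.
Local Open Scope complex_scope.
Local Open Scope ring_scope.

(* Tensor fields are given by their components in the standard real coordinates
   of R^k, with values in R[i]; real tensors are embedded entrywise (cplx).
   Conventions, with e_a the coordinate vector fields:
     one-form a : row vector,  a_b = a(e_b);   vector X : column vector;
     bilinear form B : B a b = B(e_a, e_b);
     (1,1)-tensor T : T a b = T^a_b, i.e. (T X)^a = \sum_b T a b X^b,
   so that B(T _, _) is T^T *m B and the one-form a o T is a *m T. *)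

Section Calculus.
Variables (R : realType) (k : nat).
Local Notation C := R[i].
Local Notation pt := 'rV[R]_k.

Definition cplx m n (T : 'M[R]_(m, n)) : 'M[C]_(m, n) := map_mx (real_complex R) T.

Definition pd (a : 'I_k) (F : pt -> C) (x : pt) : C :=
  ('D_(delta_mx 0 a) (fun y => complex.Re (F y)) x)
  +i* ('D_(delta_mx 0 a) (fun y => complex.Im (F y)) x).

Definition pds (s : seq 'I_k) (F : pt -> C) : pt -> C := foldr pd F s.

Definition smooth (D : set pt) (F : pt -> C) : Prop :=
  forall (s : seq 'I_k) (x : pt), D x ->
    differentiable (fun y => complex.Re (pds s F y)) x /\
    differentiable (fun y => complex.Im (pds s F y)) x.

Definition smooth_mx m n (D : set pt) (T : pt -> 'M[C]_(m, n)) : Prop :=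
  forall i j, smooth D (fun x => T x i j).

Definition dfun (F : pt -> C) (x : pt) : 'rV[C]_k := \row_a pd a F x.

Definition tensor (a b : 'rV[C]_k) : 'M[C]_k := a^T *m b.

Definition wedge (a b : 'rV[C]_k) : 'M[C]_k := tensor a b - tensor b a.

(* Gamma^i_{jl} *)
Definition christoffel (g : pt -> 'M[C]_k) (x : pt) (i j l : 'I_k) : C :=
  2^-1 * \sum_p invmx (g x) i p *
    (pd j (fun y => g y p l) x + pd l (fun y => g y p j) x
     - pd p (fun y => g y j l) x).

(* nabla_j X^j *)
Definition divergence (g : pt -> 'M[C]_k) (X : pt -> 'cV[C]_k) (x : pt) : C :=
  \sum_j (pd j (fun y => X y j 0) x
          + \sum_l christoffel g x j j l * X x l 0).

(* nabla_l T^i_j *)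
Definition cov_deriv (g T : pt -> 'M[C]_k) (x : pt) (l i j : 'I_k) : C :=
  pd l (fun y => T y i j) x
  + \sum_p (christoffel g x i l p * T x p j - christoffel g x p l j * T x i p).

Definition parallel (D : set pt) (g T : pt -> 'M[C]_k) : Prop :=
  forall x, D x -> forall l i j, cov_deriv g T x l i j = 0.

Record kahler (D : set pt) (g J : pt -> 'M[C]_k) : Prop := Kahler {
  kahler_g_smooth : smooth_mx D g;
  kahler_J_smooth : smooth_mx D J;
  kahler_g_sym : forall x, D x -> (g x)^T = g x;
  kahler_g_nondeg : forall x, D x -> g x \in unitmx;
  kahler_J2 : forall x, D x -> J x *m J x = - 1%:M;
  kahler_gJ : forall x, D x -> (J x)^T *m g x = - (g x *m J x);
  kahler_J_parallel : parallel D g J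
}.

Record hermitian_endo (D : set pt) (g J A : pt -> 'M[C]_k) : Prop := HermitianEndo {
  herm_smooth : smooth_mx D A;
  herm_selfadj : forall x, D x -> (A x)^T *m g x = g x *m A x;
  herm_commJ : forall x, D x -> A x *m J x = J x *m A x
}.

End Calculus.

Section Holomorphic.
Variable R : realType.
Local Notation C := R[i].

Definition plane (p : 'rV[R]_2) : C := p 0 0 +i* p 0 1.

(* smooth and dF/d(bar z) = 0 *)
Definition holomorphic (D : set C) (F : C -> C) : Prop :=
  smooth (plane @^-1` D) (F \o plane) /\
  forall p, D (plane p) ->
    pd 0 (F \o plane) p + 'i%C * pd 1 (F \o plane) p = 0.

Definition smooth1 (D : set R) (F : R -> R) : Prop :=
  smooth [set p : 'rV[R]_1 | D (p 0 0)] (fun p => (F (p 0 0))%:C).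

End Holomorphic.

Section SpectralPolynomials.
Variables (R : realType) (k : nat).
Local Notation C := R[i].

(* sqrt (det (t Id - A)) as a polynomial in t *)
Definition sqrt_char (A : 'M[C]_k) : {poly C} :=
  \prod_(a <- undup (sval (closed_field_poly_normal (char_poly A))))
    ('X - a%:P) ^+ (mup a (char_poly A))./2.

(* The value at t of the polynomial sqrt(det(t Id - A)) (t Id - A)^-1; the
   inverse is adjugate over determinant and the quotient is taken in C[t], so
   that the value is also meaningful when t is an eigenvalue, see K_mxP. *)
Definition K_poly (A : 'M[C]_k) (i j : 'I_k) : {poly C} :=
  (sqrt_char A * \adj (char_poly_mx A) i j) %/ char_poly A.

Definition K_mx (A : 'M[C]_k) (t : C) : 'M[C]_k :=
  \matrix_(i, j) (K_poly A i j).[t].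

Lemma K_mxP (A : 'M[C]_k) (P : 'I_k -> 'I_k -> {poly C}) :
  (forall t, \det (t%:M - A) != 0 ->
     \matrix_(i, j) (P i j).[t] = (sqrt_char A).[t] *: invmx (t%:M - A)) ->
  forall t, K_mx A t = \matrix_(i, j) (P i j).[t].
Proof.
move=> HP t; apply/matrixP => i j; rewrite !mxE /K_poly.
have c0 : char_poly A != 0 by rewrite monic_neq0 // char_poly_monic.
suff -> : sqrt_char A * \adj (char_poly_mx A) i j = P i j * char_poly A.
  by rewrite mulpK.
have hm s : map_mx (horner_eval s) (char_poly_mx A) = s%:M - A.
  apply/matrixP => a b; rewrite !mxE /horner_eval hornerD hornerN hornerC.
  by rewrite hornerMn hornerX.
have hc s : (char_poly A).[s] = \det (s%:M - A).
  by rewrite -hm det_map_mx.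
have ha s : (\adj (char_poly_mx A) i j).[s] = \adj (s%:M - A) i j.
  by rewrite -hm -map_mx_adj [RHS]mxE.
pose p := (sqrt_char A * \adj (char_poly_mx A) i j - P i j * char_poly A) * char_poly A.
have p0 s : p.[s] = 0.
  rewrite /p hornerM; have [->|] := eqVneq (char_poly A).[s] 0; first by rewrite mulr0.
  rewrite hornerD hornerN !hornerM ha hc => ne.
  have /matrixP/(_ i j) := HP s ne; rewrite /invmx unitmxE unitfE ne.
  set a := \adj _; rewrite [LHS]mxE [RHS]mxE [X in _ * X]mxE => ->.
  by rewrite [_^-1 * _]mulrC mulrA divfK // subrr mul0r.
apply/eqP; rewrite -subr_eq0; apply/negPn/negP => n0.
have pn0 : p != 0 by rewrite mulf_neq0.
have := @max_poly_roots _ p [seq n%:R | n <- iota 0 (size p)] pn0 _ _.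
rewrite size_map size_iota ltnn => F.
suff: false by [].
apply: F; first by apply/allP => s _; rewrite rootE p0.
rewrite map_inj_in_uniq ?iota_uniq // => a b _ _ /eqP.
by rewrite eqr_nat => /eqP.
Qed.

End SpectralPolynomials.

Definition esym (R : realType) (I : finType) (A : {set I}) (v : I -> R[i]) (i : nat) : R[i] :=
  \sum_(B : {set I} | (B \subset A) && (#|B| == i)) \prod_(s in B) v s.

(* l, q: numbers of complex and real coordinates on U (r = 2l + q);
   nb: number R of constant eigenvalues; h c: half the multiplicity of the c-th
   constant eigenvalue.  Families indexed by k = 1..r in the literature are
   indexed by 'I_(l + l + q), i.e. from 0.  The real coordinates of a point of U
   are ordered (Re z_1 .. Re z_l, Im z_1 .. Im z_l, x_{l+1} .. x_{l+q}), and the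
   functions chi as (z_1 .. z_l, bar z_1 .. bar z_l, x_{l+1} .. x_{l+q}): nothing
   depends on the order of the chi's. *)
Notation nf_point R l q h :=
  'rV[R]_(l + l + q + (l + l + q) + \sum_c (h c).*2).

Section NormalForm.
Variables (R : realType) (l q nb : nat) (h : 'I_nb -> nat).
Local Notation C := R[i].
Local Notation r := (l + l + q)%N.
Local Notation m c := ((h c).*2).
Local Notation dimS := (\sum_(c < nb) m c)%N.
Local Notation N := (r + r + dimS)%N.
Local Notation pt := 'rV[R]_N.

Record nf_data := NFData {
  nf_U : set 'rV[R]_r;
  nf_V : set 'rV[R]_r;
  nf_S : forall c, set 'rV[R]_(m c);
  nf_sigmac : 'I_l -> C -> C;
  nf_sigmar : 'I_q -> R -> R;
  nf_sign : 'I_q -> bool;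
  nf_rhoc : 'I_nb -> R;
  nf_gS : forall c, 'rV[R]_(m c) -> 'M[R]_(m c);
  nf_JS : forall c, 'rV[R]_(m c) -> 'M[R]_(m c);
  nf_AS : forall c, 'rV[R]_(m c) -> 'M[R]_(m c);
  nf_alpha : 'I_r -> 'rV[R]_dimS -> 'rV[R]_dimS
}.

Definition cdim : nat := (r + \sum_(c < nb) h c)%N.

Definition by_chi (T : Type) (fz fzb : 'I_l -> T) (fx : 'I_q -> T) (k : 'I_r) : T :=
  match split k with
  | inl k' => match split k' with inl j => fz j | inr j => fzb j end
  | inr j => fx j
  end.

Definition ire (j : 'I_l) : 'I_r := lshift q (lshift l j).
Definition iim (j : 'I_l) : 'I_r := lshift q (rshift l j).
Definition ixr (j : 'I_q) : 'I_r := rshift (l + l) j.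

Definition iu (k : 'I_r) : 'I_N := lshift dimS (lshift r k).
Definition it (k : 'I_r) : 'I_N := lshift dimS (rshift r k).
Definition iy (c : 'I_nb) (b : 'I_(m c)) : 'I_N := rshift (r + r) (tagnat.Rank c b).

Definition u_part (x : pt) : 'rV[R]_r := lsubmx (lsubmx x).
Definition t_part (x : pt) : 'rV[R]_r := rsubmx (lsubmx x).
Definition s_part (x : pt) : 'rV[R]_dimS := rsubmx x.
Definition y_part (c : 'I_nb) (y : 'rV[R]_dimS) : 'rV[R]_(m c) :=
  \row_b y 0 (tagnat.Rank c b).

Definition zcoord (j : 'I_l) (u : 'rV[R]_r) : C := u 0 (ire j) +i* u 0 (iim j).

Definition du (k : 'I_r) : 'rV[C]_N := delta_mx 0 (iu k).
Definition dt (k : 'I_r) : 'rV[C]_N := delta_mx 0 (it k).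
Definition dy (c : 'I_nb) (b : 'I_(m c)) : 'rV[C]_N := delta_mx 0 (iy b).
Definition Du (k : 'I_r) : 'cV[C]_N := delta_mx (iu k) 0.
Definition Dt (k : 'I_r) : 'cV[C]_N := delta_mx (it k) 0.
Definition Dy (c : 'I_nb) (b : 'I_(m c)) : 'cV[C]_N := delta_mx (iy b) 0.

Definition dchi : 'I_r -> 'rV[C]_N :=
  by_chi (fun j => du (ire j) + 'i%C *: du (iim j))
         (fun j => du (ire j) - 'i%C *: du (iim j))
         (fun j => du (ixr j)).

Definition Dchi : 'I_r -> 'cV[C]_N :=
  by_chi (fun j => 2^-1 *: (Du (ire j) - 'i%C *: Du (iim j)))
         (fun j => 2^-1 *: (Du (ire j) + 'i%C *: Du (iim j)))
         (fun j => Du (ixr j)).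

Definition pchi (k : 'I_r) (F : pt -> C) (x : pt) : C := \sum_a Dchi k a 0 * pd a F x.

Section Fields.
Variable d : nf_data.

Definition nf_SS : set 'rV[R]_dimS := [set y | forall c, @nf_S d c (y_part c y)].
Definition nf_W : set pt :=
  [set x | [/\ nf_U d (u_part x), nf_V d (t_part x) & nf_SS (s_part x)]].

Definition rho (k : 'I_r) (x : pt) : C :=
  by_chi (fun j => nf_sigmac d j (zcoord j (u_part x)))
         (fun j => (nf_sigmac d j (zcoord j (u_part x)))^*%C)
         (fun j => (nf_sigmar d j (u_part x 0 (ixr j)))%:C) k.

Definition rho' (k : 'I_r) (x : pt) : C := pchi k (rho k) x.

Definition eps : 'I_r -> C :=
  by_chi (fun=> - 4^-1) (fun=> - 4^-1) (fun j => (-1) ^+ nf_sign d j).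

Definition Delta (k : 'I_r) (x : pt) : C := \prod_(j | j != k) (rho k x - rho j x).

Definition mu (i : nat) (x : pt) : C := esym [set: 'I_r] (fun k => rho k x) i.
Definition muhat (s : 'I_r) (i : nat) (x : pt) : C :=
  esym [set~ s] (fun k => rho k x) i.

Definition gS (c : 'I_nb) (y : 'rV[R]_(m c)) : 'M[C]_(m c) := cplx (nf_gS d y).
Definition JS (c : 'I_nb) (y : 'rV[R]_(m c)) : 'M[C]_(m c) := cplx (nf_JS d y).
Definition AS (c : 'I_nb) (y : 'rV[R]_(m c)) : 'M[C]_(m c) := cplx (nf_AS d y).
Definition omegaS (c : 'I_nb) (y : 'rV[R]_(m c)) : 'M[C]_(m c) := (JS y)^T *m gS y.

Definition yc (c : 'I_nb) (x : pt) : 'rV[R]_(m c) := y_part c (s_part x).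

(* alpha^c_{ib} *)
Definition alpha (c : 'I_nb) (i : 'I_r) (b : 'I_(m c)) (x : pt) : C :=
  (nf_alpha d i (s_part x) 0 (tagnat.Rank c b))%:C.

Definition theta (i : 'I_r) (x : pt) : 'rV[C]_N :=
  dt i + \sum_(c < nb) \sum_b alpha i b x *: dy (c := c) b.

Definition pullback (c : 'I_nb) (B : 'M[C]_(m c)) : 'M[C]_N :=
  \sum_a \sum_b B a b *: tensor (dy a) (dy b).

Definition nf_g (x : pt) : 'M[C]_N :=
  \sum_i (eps i * Delta i x) *: tensor (dchi i) (dchi i)
  + \sum_(i < r.+1) ((-1) ^+ i * mu i x) *:
      \sum_(c < nb) pullback ((AS (yc c x) ^+ (r - i))^T *m gS (yc c x))
  + \sum_(i < r) \sum_(j < r)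
      (\sum_s muhat s i x * muhat s j x / (eps s * Delta s x) * rho' s x ^+ 2)
        *: tensor (theta i x) (theta j x).

Definition nf_omega (x : pt) : 'M[C]_N :=
  \sum_(i < r) wedge (dfun (mu i.+1) x) (theta i x)
  + \sum_(i < r.+1) ((-1) ^+ i * mu i x) *:
      \sum_(c < nb) pullback ((AS (yc c x) ^+ (r - i))^T *m omegaS (yc c x)).

(* the solution J of omega = g(J _, _), that is omega = J^T *m g *)
Definition nf_J (x : pt) : 'M[C]_N := (nf_omega x *m invmx (nf_g x))^T.

Definition nf_A (x : pt) : 'M[C]_N :=
  \sum_s rho s x *: (Dchi s *m dchi s)
  + \sum_(i < r) \sum_(j < r)
      (mu i.+1 x * (j == 0%N :> nat)%:R - (i.+1 == j :> nat)%:R)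
        *: (Dt j *m theta i x)
  + \sum_(c < nb) \sum_a \sum_b
      AS (yc c x) b a *: ((Dy b - \sum_i alpha i b x *: Dt i) *m dy a).

Record normal_form : Prop := NormalForm {
  nf_U_open : open (nf_U d);
  nf_V_open : open (nf_V d);
  nf_S_open : forall c, open (@nf_S d c);
  nf_h_gt0 : forall c, (0 < h c)%N;
  nf_sigmac_hol : forall j, holomorphic (zcoord j @` nf_U d) (nf_sigmac d j);
  nf_sigmar_smooth : forall j,
    smooth1 ((fun u : 'rV[R]_r => u 0 (ixr j)) @` nf_U d) (nf_sigmar d j);
  nf_S_kahler : forall c, kahler (@nf_S d c) (@gS c) (@JS c);
  nf_S_herm : forall c, hermitian_endo (@nf_S d c) (@gS c) (@JS c) (@AS c);
  nf_S_par : forall c, parallel (@nf_S d c) (@gS c) (@AS c);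
  nf_S_char : forall c y, @nf_S d c y ->
    char_poly (nf_AS d y) = ('X - (nf_rhoc d c)%:P) ^+ m c;
  nf_rhoc_inj : injective (nf_rhoc d);
  nf_rho_inj : forall x, nf_W x -> injective (fun k => rho k x);
  nf_rho_rhoc : forall x, nf_W x -> forall k c, rho k x <> (nf_rhoc d c)%:C;
  nf_drho : forall x, nf_W x -> forall k, dfun (rho k) x <> 0;
  nf_alpha_smooth : forall i, smooth_mx nf_SS (fun y => cplx (nf_alpha d i y));
  nf_dalpha : forall (i : 'I_r) y, nf_SS y -> forall a b : 'I_dimS,
    pd a (fun y' => (nf_alpha d i y' 0 b)%:C) y
    - pd b (fun y' => (nf_alpha d i y' 0 a)%:C) y
    = (-1) ^+ i.+1 *
      (\mxdiag_(c < nb) ((AS (y_part c y) ^+ (r - i.+1))^T *m omegaS (y_part c y))) a b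
}.

Definition semisimple : Prop := forall x, nf_W x -> diagonalizable (nf_A x).

(* the set E of all eigenvalues, with half their multiplicities *)
Definition ev (e : 'I_r + 'I_nb) (x : pt) : C :=
  match e with inl k => rho k x | inr c => (nf_rhoc d c)%:C end.
Definition hmult (e : 'I_r + 'I_nb) : nat :=
  match e with inl _ => 1%N | inr c => h c end.

Variable f : 'I_r + 'I_nb -> pt -> C.

Definition U_fun (t : R) (x : pt) : C :=
  \sum_e (\prod_(e' | e' != e)
            ((t%:C - ev e' x) ^+ hmult e' / (ev e x - ev e' x) ^+ hmult e'))
         * (t%:C - ev e x) ^+ (hmult e - 1) * f e x.

Definition K_up (t : R) (x : pt) : 'M[C]_N := K_mx (nf_A x) t%:C *m invmx (nf_g x).

Definition V_vec (t : R) (x : pt) : 'cV[C]_N :=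
  nf_J x *m invmx (nf_g x) *m (dfun (fun y => (sqrt_char (nf_A y)).[t%:C]) x)^T.

Definition Q_op (t : R) (F : pt -> C) (x : pt) : C :=
  - divergence nf_g (fun y => K_up t y *m (dfun F y)^T) x + U_fun t x * F x.

Definition L_op (t : R) (F : pt -> C) (x : pt) : C :=
  'i%C / 2 * (divergence nf_g (fun y => F y *: V_vec t y) x
              + (dfun F x *m V_vec t x) 0 0).

Definition simultaneous_eigenfunction (psi : pt -> C) : Prop :=
  exists evQ evL : R -> C, forall t x, nf_W x ->
    Q_op t psi x = evQ t * psi x /\ L_op t psi x = evL t * psi x.

(* g_c^{ab} and D = |det g_c|^(1/2), as functions on W *)
Definition ginvS (c : 'I_nb) (a b : 'I_(m c)) (x : pt) : C := invmx (gS (yc c x)) a b.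
Definition densS (c : 'I_nb) (x : pt) : C := (Num.sqrt `|\det (nf_gS d (yc c x))|)%:C.

End Fields.
End NormalForm.

Arguments nf_data : clear implicits.

(* Main.v *)
(* Put eta_s = \sum_j muhat_{s,j-1} theta_j.  In the coframe (dchi_s, eta_s, dy)
   the metric is block diagonal with blocks eps_s Delta_s,
   (rho_s')^2 / (eps_s Delta_s) and \prod_k (rho_c - rho_k) g_c, and since A is
   semisimple, A and K_t are diagonal.  The columns of the dual frame have
   coordinate divergence zero, so the divergence of a field is computed from the
   derivatives of its frame components and the logarithmic derivatives of the
   volume density.  This gives
     L_t psi = - i \prod_c (t - rho_c)^{h_c}
                 \sum_j (-1)^j t^{r-j-1} d psi / d t_{j+1}   (j = 0, ..., r-1),
   so psi is an eigenfunction of all L_t iff each d psi / d t_j is a constant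
   multiple of psi, and in that case
     Q_t psi = \prod_c (t - rho_c)^{h_c - 1} \sum_e N_e(t) B_e,
     N_e(t) = \prod_{e' != e} (t - rho_{e'}),
   where B_e contains only derivatives along chi_e or S_e.  Hence psi is an
   eigenfunction of all Q_t iff \sum_e N_e(t) B_e = Lambda(t) psi for a polynomial
   Lambda of degree < r + R with constant coefficients, and by Lagrange
   interpolation this is N_e(rho_e) B_e = Lambda(rho_e) psi for all e. *)
Require Import Defs.
From HB Require Import structures.
From mathcomp Require Import all_boot all_order all_algebra perm.
From mathcomp Require Import boolp classical_sets functions reals topology normedtype landau derive realfun.
From mathcomp.real_closed Require Import complex.
From mathcomp Require Import ring.

Set Implicit Arguments.
Unset Strict Implicit.
Unset Printing Implicit Defensive.

Import numFieldNormedType.Exports.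
Import Order.TTheory GRing.Theory Num.Theory.
Local Open Scope classical_set_scope.
Local Open Scope complex_scope.
Local Open Scope ring_scope.

(** * Symmetry of second derivatives *)

(** The separation rests on a cancellation. In the coframe the volume density is, up to a constant,
    [det muhat_mx] times the product of the [rho'_s], of the [Pc^(h c)] and of the densities of the
    [g_c]: the two blocks of index [s] multiply to [rho'_s ^ 2], without [Delta_s], but passing from
    [theta] to [eta] brings back a Vandermonde determinant. Along [chi_s] its logarithmic derivative
    equals that of [Delta_s], which removes the factor [1 / Delta_s] of the inverse metric, while
    the eigenvalue of [K_t] in that direction does not contain [rho_s]. Semisimplicity enters as
    [A_c = rho_c Id], which makes the metric on each [S_c] a multiple of [g_c] by a function on U.
    Symmetry of second derivatives is used twice: [rho'_k] depends on [chi_k] alone, and the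
    equation along [t_k] passes to the derivatives of [psi]. The eigenvalue equations hold for real
    [t] only and [psi] may have zeros. They are therefore read as polynomial identities, and the
    unknown eigenvalues are eliminated by comparison with one point where [psi] does not vanish. *)

Section RealCalculus.
Variables (R : realType).

Lemma near_eq_differentiable (V W : normedModType R) (f g : V -> W) (x : V) :
  {near x, f =1 g} -> differentiable f x -> differentiable g x.
Proof.
move=> fg df.
have fgx : f x = g x by exact: nbhs_singleton fg.
have gE : g \o shift x = cst (g x) + 'd f x +o_ 0 id.
  apply/eqaddoP => e e0.
  have /eqaddoP/(_ _ e0) fe := diff_locally df.
  have fgs : \forall h \near 0, f (shift x h) = g (shift x h).
    by move: fg; rewrite (near_shift 0) /= subr0; apply: filterS.
  apply: filterS2 fgs fe => h fgh; rewrite -![(_ - _ : _ -> _) _]/(_ - _) /= fgx.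
  by rewrite -[f (h + x)]/(f (shift x h)) fgh.
apply/diff_locallyP; rewrite (diff_unique (diff_continuous df) gE).
by split=> //; exact: diff_continuous.
Qed.

Lemma mulmxl_differentiable m n (B : 'M[R]_(m, n)) (x : 'rV[R]_m) :
  differentiable (fun y : 'rV[R]_m => y *m B) x.
Proof.
rewrite (_ : (fun _ => _) = \sum_(i < m) (fun y : 'rV[R]_m => y 0 i *: row i B)).
  apply: differentiable_sum => i; apply: differentiableZl.
  exact: differentiable_coord.
by apply/funext => y; rewrite mulmx_sum_row fct_sumE.
Qed.

Lemma derive_line (V W : normedModType R) (f : V -> W) (p u : V) (s : R) :
  'D_1 (fun t : R => f (p + t *: u)) s = 'D_u f (p + s *: u).
Proof.
rewrite /derive.
rewrite [X in lim (X @ _)](_ : _ = fun h : R =>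
  h^-1 *: ((f \o shift (p + s *: u)) (h *: u) - f (p + s *: u))) //.
by apply/funext => h /=; rewrite scalerDl addrCA -[h *: 1]/(h * 1) mulr1.
Qed.

Lemma derivable_line (V W : normedModType R) (f : V -> W) (p u : V) (s : R) :
  derivable f (p + s *: u) u -> derivable (fun t : R => f (p + t *: u)) s 1.
Proof.
rewrite /derivable => df; rewrite [X in cvg (X @ _)](_ : _ = fun h : R =>
  h^-1 *: ((f \o shift (p + s *: u)) (h *: u) - f (p + s *: u))) //.
by apply/funext => h /=; rewrite scalerDl addrCA -[h *: 1]/(h * 1) mulr1.
Qed.

(* The mean value theorem, applied in each of the two variables to the second
   difference of f. *)
Lemma second_difference (V : normedModType R) (f : V -> R) (x u v : V) (e : R) :
  0 < e ->
  (forall s t : R, 0 <= s <= e -> 0 <= t <= e ->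
     derivable f (x + t *: v + s *: u) u /\
     derivable ('D_u f) (x + s *: u + t *: v) v) ->
  exists s t : R, [/\ 0 <= s <= e, 0 <= t <= e &
    f (x + e *: v + e *: u) - f (x + e *: u) - f (x + e *: v) + f x
    = e ^+ 2 * 'D_v ('D_u f) (x + s *: u + t *: v)].
Proof.
move=> e0 df.
pose phi := (fun s : R => f (x + e *: v + s *: u)) - (fun s : R => f (x + s *: u)).
have dphi (s : R) : 0 <= s <= e -> is_derive s 1 phi
    ('D_u f (x + e *: v + s *: u) - 'D_u f (x + s *: u)).
  move=> sb; rewrite -!derive_line; apply: is_deriveB; apply: derivableP.
    by apply/derivable_line/(df s e _ _).1; rewrite // lexx ltW.
  apply/derivable_line; have /= := (df s 0 sb _).1.
  by rewrite scale0r addr0; apply; rewrite lexx ltW.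
have [] := @MVT _ phi (fun s : R => 'D_u f (x + e *: v + s *: u) - 'D_u f (x + s *: u)) 0 e e0.
- by move=> s; rewrite in_itv /= => /andP[s0 s1]; apply: dphi; rewrite !ltW.
- apply: derivable_within_continuous => s; rewrite in_itv /= => sb.
  by have := dphi s sb; case.
move=> s; rewrite in_itv /= => /andP[s0 s1] phiE.
have sb : 0 <= s <= e by rewrite !ltW.
pose G (t : R) := 'D_u f (x + s *: u + t *: v).
have dG (t : R) : 0 <= t <= e -> is_derive t 1 G ('D_v ('D_u f) (x + s *: u + t *: v)).
  move=> tb; rewrite -(derive_line ('D_u f)); apply: derivableP.
  exact: derivable_line (df s t sb tb).2.
have [] := @MVT _ G (fun t : R => 'D_v ('D_u f) (x + s *: u + t *: v)) 0 e e0.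
- by move=> t; rewrite in_itv /= => /andP[t0 t1]; apply: dG; rewrite !ltW.
- apply: derivable_within_continuous => t; rewrite in_itv /= => tb.
  by have := dG t tb; case.
move=> t; rewrite in_itv /= => /andP[t0 t1]; rewrite /G scale0r addr0 subr0 => GE.
exists s, t; split=> //; first by rewrite !ltW.
move: phiE; rewrite /phi subr0.
rewrite -![(_ - _ : _ -> _) _]/(_ - _) /= !scale0r !addr0.
have -> : x + e *: v + s *: u = x + s *: u + e *: v by rewrite addrAC.
by rewrite GE => E; rewrite expr2 mulrC mulrA -E; ring.
Qed.

(** The second difference is symmetric in the two directions, so its two mean-value representations
    force [a' = b']; the triangle inequality does the rest. *)
Lemma close_of_common_limit (A B C D p a b a' b' k : R) :
  p != 0 -> A - B - C + D = p * a' -> A - C - B + D = p * b' ->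
  `|a - a'| < k -> `|b - b'| < k -> `|a - b| < k + k.
Proof.
move=> p0 E1 E2 H1 H2; have ab : a' = b'.
  by apply: (mulfI p0); rewrite -E1 -E2; ring.
have -> : a - b = (a - a') - (b - b') by rewrite ab; ring.
by apply: (le_lt_trans (ler_normB _ _)); exact: ltrD.
Qed.

Lemma deriveC (V : normedModType R) (f : V -> R) (x u v : V) :
  (\near x, derivable f x u) -> (\near x, derivable f x v) ->
  (\near x, derivable ('D_u f) x v) -> (\near x, derivable ('D_v f) x u) ->
  {for x, continuous ('D_v ('D_u f))} -> {for x, continuous ('D_u ('D_v f))} ->
  'D_v ('D_u f) x = 'D_u ('D_v f) x.
Proof.
move=> fu fv fuv fvu cuv cvu; apply/eqP; rewrite -subr_eq0; apply: contraT => ne.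
(* Half the supposed gap: the bound [k + k] of [close_of_common_limit] is then the gap itself, a
   contradiction. *)
pose k := `|'D_v ('D_u f) x - 'D_u ('D_v f) x| / 2.
have k0 : 0 < k by rewrite divr_gt0 // normr_gt0.
move/cvgr_dist_lt: cuv => /(_ _ k0) nuv; move/cvgr_dist_lt: cvu => /(_ _ k0) nvu.
have : nbhs x [set y | [/\ derivable f y u /\ derivable f y v,
    derivable ('D_u f) y v /\ derivable ('D_v f) y u,
    `|'D_v ('D_u f) x - 'D_v ('D_u f) y| < k &
    `|'D_u ('D_v f) x - 'D_u ('D_v f) y| < k]].
  apply: filterS (filterI (filterI fu fv) (filterI (filterI fuv fvu) (filterI nuv nvu))).
  by move=> y [[a b] [[a' b'] [c c']]]; exact: And4 (conj a b) (conj a' b') c c'.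
move=> /nbhs_ballP[d /= d0 good].
(* Keeps [x + s u + t v] within [d / 2] of [x] for all [s], [t] between 0 and [e]; the [+ 1] keeps
   the denominator positive when both directions vanish. *)
pose e := d / 2 / (`|u| + `|v| + 1).
have D0 : 0 < `|u| + `|v| + 1 by rewrite ltr_wpDl // addr_ge0.
have e0 : 0 < e by rewrite !divr_gt0.
have near_x s t : 0 <= s <= e -> 0 <= t <= e -> ball x d (x + s *: u + t *: v).
  move=> /andP[s0 s1] /andP[t0 t1]; rewrite -ball_normE /= -addrA opprD addNKr normrN.
  apply: (le_lt_trans (ler_normD _ _)); rewrite !normrZ !ger0_norm //.
  apply: (@le_lt_trans _ _ (d / 2)); last by rewrite ltr_pdivrMr // mulrDr mulr1 ltrDl.
  have -> : d / 2 = e * (`|u| + `|v| + 1) by rewrite /e divfK // gt_eqF.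
  rewrite !mulrDr mulr1; apply: ler_wpDr; first exact: ltW.
  by apply: lerD; apply: ler_wpM2r.
have near_x' s t : 0 <= s <= e -> 0 <= t <= e -> ball x d (x + t *: v + s *: u).
  by move=> ? ?; rewrite addrAC; exact: near_x.
have [|s [t [sb tb E1]]] := @second_difference _ f x u v e e0.
  move=> s t sb tb; split.
    have [[a b] _ _ _] := good _ (near_x' _ _ sb tb); exact: a.
  have [_ [a b] _ _] := good _ (near_x _ _ sb tb); exact: a.
have [|t' [s' [tb' sb' E2]]] := @second_difference _ f x v u e e0.
  move=> t' s' tb' sb'; split.
    have [[a b] _ _ _] := good _ (near_x _ _ sb' tb'); exact: b.
  have [_ [a b] _ _] := good _ (near_x' _ _ sb' tb'); exact: b.
rewrite (addrAC x (e *: u)) in E2.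
have e2 : e ^+ 2 != 0 by rewrite expf_neq0 // gt_eqF.
have [_ _ H1 _] := good _ (near_x _ _ sb tb).
have [_ _ _ H2] := good _ (near_x' _ _ sb' tb').
have := close_of_common_limit e2 E1 E2 H1 H2.
by rewrite /k -splitr ltxx.
Qed.

End RealCalculus.

(** * Calculus of complex-valued functions *)

Section ComplexCalculus.
Variables (R : realType) (k : nat).
Local Notation C := R[i].
Local Notation pt := 'rV[R]_k.
Implicit Types (F G : pt -> C) (x : pt).

(** Differentiability over the reals, taken componentwise as in [pd]. *)
Definition cdiff F x : Prop :=
  differentiable (fun y => complex.Re (F y)) x /\
  differentiable (fun y => complex.Im (F y)) x.

(** The direction has complex entries because the frame contains Wirtinger fields; the derivative is
    extended linearly over the complex numbers from the real partial derivatives. *)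
Definition ddir (v : 'cV[C]_k) F x : C := \sum_a v a 0 * pd a F x.

Lemma pd_ddir a F x : pd a F x = ddir (delta_mx a 0) F x.
Proof.
rewrite /ddir (bigD1 a) //= mxE !eqxx mul1r big1 ?addr0 // => b ba.
by rewrite mxE (negbTE ba) mul0r.
Qed.

Lemma cdiff_near F G x : (\forall y \near x, F y = G y) -> cdiff F x -> cdiff G x.
Proof.
move=> FG [a b]; split; [apply: near_eq_differentiable a | apply: near_eq_differentiable b];
  by apply: filterS FG => y ->.
Qed.

Lemma pd_near a F G x : (\forall y \near x, F y = G y) -> pd a F x = pd a G x.
Proof.
by move=> FG; congr (_ +i* _); apply: near_eq_derive; apply: filterS FG => y ->.
Qed.

Lemma ddir_near v F G x : (\forall y \near x, F y = G y) -> ddir v F x = ddir v G x.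
Proof. by move=> FG; apply: eq_bigr => a _; rewrite (pd_near _ FG). Qed.

Lemma cdiff_cst (c : C) x : cdiff (fun=> c) x.
Proof. by split; apply: differentiable_cst. Qed.

Lemma pd_cst a (c : C) x : pd a (fun=> c) x = 0.
Proof. by rewrite /pd !derive_cst. Qed.

Lemma ddir_cst v (c : C) x : ddir v (fun=> c) x = 0.
Proof. by rewrite /ddir big1 // => a _; rewrite pd_cst mulr0. Qed.

Lemma Re_add (z w : C) : complex.Re (z + w) = complex.Re z + complex.Re w.
Proof. by case: z w => [? ?] []. Qed.
Lemma Im_add (z w : C) : complex.Im (z + w) = complex.Im z + complex.Im w.
Proof. by case: z w => [? ?] []. Qed.
Lemma Re_mul (z w : C) : complex.Re (z * w) =
  complex.Re z * complex.Re w - complex.Im z * complex.Im w.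
Proof. by case: z w => [? ?] []. Qed.
Lemma Im_mul (z w : C) : complex.Im (z * w) =
  complex.Re z * complex.Im w + complex.Im z * complex.Re w.
Proof. by case: z w => [? ?] []. Qed.
Lemma Re_inv (z : C) : complex.Re z^-1 =
  complex.Re z / (complex.Re z ^+ 2 + complex.Im z ^+ 2).
Proof. by case: z. Qed.
Lemma Im_inv (z : C) : complex.Im z^-1 =
  - complex.Im z / (complex.Re z ^+ 2 + complex.Im z ^+ 2).
Proof. by case: z => a b; rewrite mulNr. Qed.

Lemma cdiffD F G x : cdiff F x -> cdiff G x -> cdiff (fun y => F y + G y) x.
Proof.
move=> [a b] [c d]; split.
  by under eq_fun do rewrite Re_add; apply: differentiableD.
by under eq_fun do rewrite Im_add; apply: differentiableD.
Qed.

Lemma pdD a F G x : cdiff F x -> cdiff G x ->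
  pd a (fun y => F y + G y) x = pd a F x + pd a G x.
Proof.
move=> [f f'] [g g']; rewrite /pd; apply/eqP; rewrite eq_complex /=.
rewrite (_ : (fun y => complex.Re _) = (fun y => complex.Re (F y)) + (fun y => complex.Re (G y))); last first.
  by apply/funext => y; exact: Re_add.
rewrite (_ : (fun y => complex.Im _) = (fun y => complex.Im (F y)) + (fun y => complex.Im (G y))); last first.
  by apply/funext => y; exact: Im_add.
by rewrite !deriveD ?eqxx //; apply: diff_derivable.
Qed.

Lemma cdiffM F G x : cdiff F x -> cdiff G x -> cdiff (fun y => F y * G y) x.
Proof.
move=> [a b] [c d]; split.
  by under eq_fun do rewrite Re_mul; apply: differentiableB; apply: differentiableM.
by under eq_fun do rewrite Im_mul; apply: differentiableD; apply: differentiableM.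
Qed.

(** This combination is the real part of a complex product; [derive_prodD] serves the imaginary
    part. *)
Lemma derive_prodB (V : normedModType R) (p q r s : V -> R) (x v : V) :
  derivable p x v -> derivable q x v -> derivable r x v -> derivable s x v ->
  'D_v (p * q - r * s) x =
  'D_v p x * q x + p x * 'D_v q x - ('D_v r x * s x + r x * 'D_v s x).
Proof.
move=> dp dq dr ds; have dpq := derivableM dp dq; have drs := derivableM dr ds.
rewrite (deriveB dpq drs) (deriveM dp dq) (deriveM dr ds) /GRing.scale /=.
move: ('D_v p x : R) ('D_v q x : R) ('D_v r x : R) ('D_v s x : R) => a b c d.
by ring.
Qed.

Lemma derive_prodD (V : normedModType R) (p q r s : V -> R) (x v : V) :
  derivable p x v -> derivable q x v -> derivable r x v -> derivable s x v ->
  'D_v (p * q + r * s) x =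
  'D_v p x * q x + p x * 'D_v q x + ('D_v r x * s x + r x * 'D_v s x).
Proof.
move=> dp dq dr ds; have dpq := derivableM dp dq; have drs := derivableM dr ds.
rewrite (deriveD dpq drs) (deriveM dp dq) (deriveM dr ds) /GRing.scale /=.
move: ('D_v p x : R) ('D_v q x : R) ('D_v r x : R) ('D_v s x : R) => a b c d.
by ring.
Qed.

Lemma pdM a F G x : cdiff F x -> cdiff G x ->
  pd a (fun y => F y * G y) x = pd a F x * G x + F x * pd a G x.
Proof.
move=> [f f'] [g g']; rewrite /pd.
rewrite (_ : (fun y => complex.Re (F y * G y)) =
    (fun y => complex.Re (F y)) * (fun y => complex.Re (G y)) -
    (fun y => complex.Im (F y)) * (fun y => complex.Im (G y))); last first.
  by apply/funext => y; exact: Re_mul.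
rewrite (_ : (fun y => complex.Im (F y * G y)) =
    (fun y => complex.Re (F y)) * (fun y => complex.Im (G y)) +
    (fun y => complex.Im (F y)) * (fun y => complex.Re (G y))); last first.
  by apply/funext => y; exact: Im_mul.
have dF := @diff_derivable _ _ _ _ _ 'e_a f; have dF' := @diff_derivable _ _ _ _ _ 'e_a f'.
have dG := @diff_derivable _ _ _ _ _ 'e_a g; have dG' := @diff_derivable _ _ _ _ _ 'e_a g'.
rewrite (derive_prodB dF dG dF' dG') (derive_prodD dF dG' dF' dG).
by case: (F x) => ? ?; case: (G x) => ? ? /=; congr (_ +i* _); rewrite /GRing.scale /=; ring.
Qed.

Lemma ddirD v F G x : cdiff F x -> cdiff G x ->
  ddir v (fun y => F y + G y) x = ddir v F x + ddir v G x.
Proof. by move=> f g; rewrite -big_split; apply: eq_bigr => a _; rewrite pdD // mulrDr. Qed.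

Lemma ddirM v F G x : cdiff F x -> cdiff G x ->
  ddir v (fun y => F y * G y) x = ddir v F x * G x + F x * ddir v G x.
Proof.
move=> f g; rewrite mulr_suml mulr_sumr -big_split; apply: eq_bigr => a _.
by rewrite pdM //= mulrDr mulrA mulrCA.
Qed.

Lemma cdiffZ c F x : cdiff F x -> cdiff (fun y => c * F y) x.
Proof. by move=> f; apply: cdiffM f; apply: cdiff_cst. Qed.

Lemma ddirZ v c F x : cdiff F x -> ddir v (fun y => c * F y) x = c * ddir v F x.
Proof. by move=> f; rewrite ddirM // ?ddir_cst ?mul0r ?add0r //; apply: cdiff_cst. Qed.

Lemma cdiffN F x : cdiff F x -> cdiff (fun y => - F y) x.
Proof. by move=> /(cdiffZ (-1)); under eq_fun do rewrite mulN1r. Qed.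

Lemma ddirN v F x : cdiff F x -> ddir v (fun y => - F y) x = - ddir v F x.
Proof. by move=> /(ddirZ v (-1)); under eq_fun do rewrite mulN1r; rewrite mulN1r. Qed.

Lemma cdiffB F G x : cdiff F x -> cdiff G x -> cdiff (fun y => F y - G y) x.
Proof. by move=> f g; apply/cdiffD/cdiffN. Qed.

Lemma ddirB v F G x : cdiff F x -> cdiff G x ->
  ddir v (fun y => F y - G y) x = ddir v F x - ddir v G x.
Proof. by move=> f g; rewrite ddirD ?ddirN //; apply: cdiffN. Qed.

Lemma cdiff_sum (I : Type) (s : seq I) (P : pred I) (H : I -> pt -> C) x :
  (forall i, P i -> cdiff (H i) x) -> cdiff (fun y => \sum_(i <- s | P i) H i y) x.
Proof.
move=> h; elim: s => [|i s IH].
  by under eq_fun do rewrite big_nil; apply: cdiff_cst.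
under eq_fun do rewrite big_cons; case Pi: (P i) => //.
by apply: cdiffD => //; apply: h.
Qed.

Lemma ddir_sum v (I : Type) (s : seq I) (P : pred I) (H : I -> pt -> C) x :
  (forall i, P i -> cdiff (H i) x) ->
  ddir v (fun y => \sum_(i <- s | P i) H i y) x = \sum_(i <- s | P i) ddir v (H i) x.
Proof.
move=> h; elim: s => [|i s IH].
  by under eq_fun do rewrite big_nil; rewrite ddir_cst big_nil.
under eq_fun do rewrite big_cons; rewrite big_cons; case Pi: (P i) => //.
by rewrite ddirD ?IH //; [apply: h|apply: cdiff_sum].
Qed.

Lemma cdiff_prod (I : Type) (s : seq I) (P : pred I) (H : I -> pt -> C) x :
  (forall i, P i -> cdiff (H i) x) -> cdiff (fun y => \prod_(i <- s | P i) H i y) x.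
Proof.
move=> h; elim: s => [|i s IH].
  by under eq_fun do rewrite big_nil; apply: cdiff_cst.
under eq_fun do rewrite big_cons; case Pi: (P i) => //.
by apply: cdiffM => //; apply: h.
Qed.

Lemma ddir_prod v (I : Type) (s : seq I) (P : pred I) (H : I -> pt -> C) x :
  (forall i, P i -> cdiff (H i) x) -> (forall i, P i -> H i x != 0) ->
  ddir v (fun y => \prod_(i <- s | P i) H i y) x =
  (\prod_(i <- s | P i) H i x) * \sum_(i <- s | P i) ddir v (H i) x / H i x.
Proof.
move=> h h0; elim: s => [|i s IH].
  by under eq_fun do rewrite big_nil; rewrite ddir_cst !big_nil mulr0.
under eq_fun do rewrite big_cons; rewrite !big_cons; case Pi: (P i) => //.
rewrite ddirM ?IH; [|exact: h|exact: cdiff_prod].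
have := h0 _ Pi; set S := \sum_(_ <- _ | _) _; set p := \prod_(_ <- _ | _) _ => n0.
by field.
Qed.

Lemma cdiffX F n x : cdiff F x -> cdiff (fun y => F y ^+ n) x.
Proof.
move=> f; elim: n => [|n IH]; first by under eq_fun do rewrite expr0; apply: cdiff_cst.
by under eq_fun do rewrite exprS; apply: cdiffM.
Qed.

(** The logarithmic form avoids the exponent [n - 1] and covers [n = 0] uniformly. *)
Lemma ddirX v F n x : cdiff F x -> F x != 0 ->
  ddir v (fun y => F y ^+ n) x = n%:R * F x ^+ n * (ddir v F x / F x).
Proof.
move=> f f0; elim: n => [|n IH].
  by under eq_fun do rewrite expr0; rewrite ddir_cst !mul0r.
under eq_fun do rewrite exprS; rewrite ddirM ?IH //; last exact: cdiffX.
by rewrite -natr1 exprS; field.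
Qed.

Lemma normsq_neq0 (z : C) : (complex.Re z ^+ 2 + complex.Im z ^+ 2 != 0) = (z != 0).
Proof.
case: z => a b /=; rewrite paddr_eq0 ?sqr_ge0 // !sqrf_eq0.
by rewrite eq_complex /=.
Qed.

Lemma normsq_differentiable F x : cdiff F x ->
  differentiable (fun y => complex.Re (F y) ^+ 2 + complex.Im (F y) ^+ 2) x.
Proof.
move=> [f f']; under eq_fun do rewrite !expr2.
exact: differentiableD (differentiableM f f) (differentiableM f' f').
Qed.

Lemma cdiffV F x : F x != 0 -> cdiff F x -> cdiff (fun y => (F y)^-1) x.
Proof.
rewrite -normsq_neq0 => n0 /[dup] [[f f']] /normsq_differentiable g0.
have g : differentiable (fun y => (complex.Re (F y) ^+ 2 + complex.Im (F y) ^+ 2)^-1) x.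
  exact: differentiableV.
split; first by under eq_fun do rewrite Re_inv; apply: differentiableM.
under eq_fun do rewrite Im_inv; apply: differentiableM => //; exact: differentiableN.
Qed.

Lemma cdiff_near_neq0 F x : F x != 0 -> cdiff F x -> \forall y \near x, F y != 0.
Proof.
rewrite -normsq_neq0 => n0 f.
have : {for x, continuous (fun y => complex.Re (F y) ^+ 2 + complex.Im (F y) ^+ 2)}.
  exact/differentiable_continuous/normsq_differentiable.
move=> /cvgr_neq0 /(_ n0); apply: filterS => y; by rewrite normsq_neq0.
Qed.

Lemma ddirV v F x : F x != 0 -> cdiff F x ->
  ddir v (fun y => (F y)^-1) x = - ddir v F x / F x ^+ 2.
Proof.
(* The product equals 1 only where [F] does not vanish, hence near [x]; the product rule then gives
   the derivative of the inverse. *)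
move=> n0 f; have : ddir v (fun y => F y * (F y)^-1) x = 0.
  rewrite -(ddir_cst v 1 x); apply: ddir_near.
  by apply: filterS (cdiff_near_neq0 n0 f) => y y0; rewrite mulfV.
rewrite ddirM //; last exact: cdiffV.
move=> /eqP; rewrite addrC addr_eq0 => /eqP E; apply: (mulfI n0); rewrite E.
by field.
Qed.

Lemma cdiff_div F G x : G x != 0 -> cdiff F x -> cdiff G x ->
  cdiff (fun y => F y / G y) x.
Proof. by move=> n0 f g; apply: cdiffM f _; apply: cdiffV. Qed.

Lemma pd_conj a F x : cdiff F x -> pd a (fun y => (F y)^*%C) x = (pd a F x)^*%C.
Proof.
move=> [f f']; rewrite /pd /=; congr (_ +i* _).
  by apply: (congr1 (fun g => 'D__ g x)); apply/funext => y; case: (F y).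
rewrite -deriveN; last exact: diff_derivable.
rewrite (_ : (fun y => complex.Im (F y)^*%C) = - (fun y => complex.Im (F y))) //.
by apply/funext => y /=; rewrite /GRing.opp /=; case: (F y).
Qed.

Lemma cdiff_conj F x : cdiff F x -> cdiff (fun y => (F y)^*%C) x.
Proof.
move=> [f f']; split.
  by rewrite (_ : (fun _ => _) = (fun y => complex.Re (F y))) //; apply/funext => y; case: (F y).
rewrite (_ : (fun _ => _) = (fun y => - complex.Im (F y))); first exact: differentiableN.
by apply/funext => y; case: (F y).
Qed.

Lemma smooth_cdiff D F s x : smooth D F -> D x -> cdiff (pds s F) x.
Proof. by move=> sF Dx; exact: sF. Qed.

Lemma pdC D F a b x : open D -> smooth D F -> D x ->
  pd a (pd b F) x = pd b (pd a F) x.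
Proof.
move=> oD sF Dx.
have nD : nbhs x D by apply: open_nbhs_nbhs.
have d1 s y : D y -> cdiff (pds s F) y by exact: smooth_cdiff.
have near_derivable (g : pt -> R) u : (forall y, D y -> differentiable g y) ->
    \forall y \near x, derivable g y u.
  by move=> dg; apply: filterS nD => y Dy; apply/diff_derivable/dg.
have ReC : 'D_'e_a ('D_'e_b (fun y => complex.Re (F y))) x =
    'D_'e_b ('D_'e_a (fun y => complex.Re (F y))) x.
  apply: deriveC.
  - by apply: near_derivable => y Dy; exact: (d1 [::] y Dy).1.
  - by apply: near_derivable => y Dy; exact: (d1 [::] y Dy).1.
  - by apply: near_derivable => y Dy; exact: (d1 [:: b] y Dy).1.
  - by apply: near_derivable => y Dy; exact: (d1 [:: a] y Dy).1.
  - exact: differentiable_continuous (d1 [:: a; b] x Dx).1.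
  - exact: differentiable_continuous (d1 [:: b; a] x Dx).1.
have ImC : 'D_'e_a ('D_'e_b (fun y => complex.Im (F y))) x =
    'D_'e_b ('D_'e_a (fun y => complex.Im (F y))) x.
  apply: deriveC.
  - by apply: near_derivable => y Dy; exact: (d1 [::] y Dy).2.
  - by apply: near_derivable => y Dy; exact: (d1 [::] y Dy).2.
  - by apply: near_derivable => y Dy; exact: (d1 [:: b] y Dy).2.
  - by apply: near_derivable => y Dy; exact: (d1 [:: a] y Dy).2.
  - exact: differentiable_continuous (d1 [:: a; b] x Dx).2.
  - exact: differentiable_continuous (d1 [:: b; a] x Dx).2.
by rewrite /pd /= ReC ImC.
Qed.

End ComplexCalculus.

Section LinearChange.
Variables (R : realType) (m n : nat) (B : 'M[R]_(m, n)).
Local Notation C := R[i].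

Lemma cdiff_mulmx (F : 'rV[R]_n -> C) (x : 'rV[R]_m) :
  cdiff F (x *m B) -> cdiff (fun y => F (y *m B)) x.
Proof.
have d := mulmxl_differentiable B x.
by move=> [f f']; split; [exact: differentiable_comp d f|exact: differentiable_comp d f'].
Qed.

Lemma derive_mulmx (f : 'rV[R]_n -> R) (x v : 'rV[R]_m) :
  'D_v (fun y => f (y *m B)) x = 'D_(v *m B) f (x *m B).
Proof.
rewrite /derive.
rewrite [X in lim (X @ _)](_ : _ = fun h : R =>
  h^-1 *: ((f \o shift (x *m B)) (h *: (v *m B)) - f (x *m B))) //.
by apply/funext => h /=; rewrite mulmxDl scalemxAl.
Qed.

Lemma pd_mulmx (F : 'rV[R]_n -> C) (x : 'rV[R]_m) a b :
  delta_mx 0 a *m B = delta_mx 0 b :> 'rV_n -> pd a (fun y => F (y *m B)) x = pd b F (x *m B).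
Proof. by move=> e; rewrite /pd !(derive_mulmx (fun y => _ (F y))) e. Qed.

Lemma pd_mulmx0 (F : 'rV[R]_n -> C) (x : 'rV[R]_m) a :
  delta_mx 0 a *m B = 0 :> 'rV_n -> pd a (fun y => F (y *m B)) x = 0.
Proof. by move=> e; rewrite /pd !(derive_mulmx (fun y => _ (F y))) e !derive0. Qed.

Lemma mulmxl_continuous : continuous (fun y : 'rV[R]_m => y *m B).
Proof. by move=> x; apply/differentiable_continuous/mulmxl_differentiable. Qed.

End LinearChange.

(** * Divergence in a moving frame *)

Lemma invmx_unique (K : comUnitRingType) n (A B : 'M[K]_n) :
  A *m B = 1%:M -> invmx A = B.
Proof.
move=> AB; have [uA _] := mulmx1_unit AB.
by rewrite -[invmx A]mulmx1 -AB mulmxA mulVmx // mul1mx.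
Qed.

Lemma invmx_congruent (K : comUnitRingType) n (E F G H : 'M[K]_n) :
  E *m F = 1%:M -> G *m H = 1%:M -> invmx (E^T *m G *m E) = F *m H *m F^T.
Proof.
move=> EF GH; apply: invmx_unique.
rewrite !mulmxA -(mulmxA _ E) EF mulmx1 -(mulmxA _ G) GH mulmx1.
by rewrite -trmx_mul (mulmx1C EF) trmx1.
Qed.

Section MatrixCalculus.
Variables (R : realType) (k : nat).
Local Notation C := R[i].
Local Notation pt := 'rV[R]_k.

Definition cdiff_mx m n (M : pt -> 'M[C]_(m, n)) x : Prop :=
  forall i j, cdiff (fun y => M y i j) x.

Definition dmx v m n (M : pt -> 'M[C]_(m, n)) x : 'M[C]_(m, n) :=
  \matrix_(i, j) ddir v (fun y => M y i j) x.

Lemma cdiff_mx_mul m n p (M : pt -> 'M[C]_(m, n)) (N : pt -> 'M[C]_(n, p)) x :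
  cdiff_mx M x -> cdiff_mx N x -> cdiff_mx (fun y => M y *m N y) x.
Proof.
move=> dM dN i j; under eq_fun do rewrite mxE.
by apply: cdiff_sum => l _; apply: cdiffM.
Qed.

Lemma dmx_mul v m n p (M : pt -> 'M[C]_(m, n)) (N : pt -> 'M[C]_(n, p)) x :
  cdiff_mx M x -> cdiff_mx N x ->
  dmx v (fun y => M y *m N y) x = dmx v M x *m N x + M x *m dmx v N x.
Proof.
move=> dM dN; apply/matrixP => i j; rewrite !mxE.
under eq_fun do rewrite mxE.
rewrite ddir_sum; last by move=> l _; apply: cdiffM.
rewrite -big_split; apply: eq_bigr => l _ /=.
by rewrite ddirM // !mxE.
Qed.

Lemma cdiff_mx_tr m n (M : pt -> 'M[C]_(m, n)) x :
  cdiff_mx M x -> cdiff_mx (fun y => (M y)^T) x.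
Proof. by move=> dM i j; under eq_fun do rewrite mxE. Qed.

Lemma dmx_tr v m n (M : pt -> 'M[C]_(m, n)) x :
  dmx v (fun y => (M y)^T) x = (dmx v M x)^T.
Proof. by apply/matrixP => i j; rewrite !mxE; under eq_fun do rewrite mxE. Qed.

Lemma dmx_near v m n (M N : pt -> 'M[C]_(m, n)) x :
  (\forall y \near x, M y = N y) -> dmx v M x = dmx v N x.
Proof.
move=> MN; apply/matrixP => i j; rewrite !mxE; apply: ddir_near.
by apply: filterS MN => y ->.
Qed.

Lemma ddir_mulmx n (F : 'M[C]_(k, n)) (c : 'cV[C]_n) (G : pt -> C) x :
  ddir (F *m c) G x = \sum_i c i 0 * ddir (col i F) G x.
Proof.
rewrite /ddir; under eq_bigr do rewrite mxE mulr_suml.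
rewrite exchange_big; apply: eq_bigr => i _; rewrite mulr_sumr.
by apply: eq_bigr => j _; rewrite mxE mulrA [c _ _ * _]mulrC.
Qed.

(** The product rule without division: in [jacobi_formula] the factors are matrix entries, which may
    vanish. *)
Lemma ddir_prod_uniq v (I : eqType) (s : seq I) (H : I -> pt -> C) x :
  uniq s -> (forall i, cdiff (H i) x) ->
  ddir v (fun y => \prod_(i <- s) H i y) x =
  \sum_(i <- s) ddir v (H i) x * \prod_(j <- s | j != i) H j x.
Proof.
move=> + h; elim: s => [_|i s IH /= /andP[si us]].
  by under eq_fun do rewrite big_nil; rewrite ddir_cst big_nil.
under eq_fun do rewrite big_cons; rewrite big_cons big_cons eqxx /=.
rewrite ddirM ?IH //; last exact: cdiff_prod.
congr (_ * _ + _).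
  rewrite [RHS]big_seq_cond [LHS]big_seq; apply: eq_bigl => j.
  by case: (boolP (j \in s)) => //= js; apply/esym; apply: contraNneq si => <-.
rewrite mulr_sumr; apply: eq_big_seq => j js.
rewrite big_cons; have -> : i != j by apply: contraNneq si => ->.
by rewrite mulrCA.
Qed.

Lemma jacobi_formula v n (M : pt -> 'M[C]_n) x : cdiff_mx M x ->
  ddir v (fun y => \det (M y)) x = \tr (\adj (M x) *m dmx v M x).
Proof.
move=> dM; rewrite /determinant.
have dP (s : 'S_n) : cdiff (fun y => \prod_i M y i (s i)) x.
  by apply: cdiff_prod => i _; apply: dM.
rewrite ddir_sum; last by move=> s _; apply: cdiffZ.
under eq_bigr => s _ do
  rewrite ddirZ // (ddir_prod_uniq v (H := fun i y => M y i (s i))) ?index_enum_uniq // mulr_sumr.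
rewrite exchange_big mxtrace_mulC /mxtrace; apply: eq_bigr => i _.
(* The sum over permutations with row [i] differentiated is the determinant of this matrix;
   expanding it along row [i] produces the cofactors of [M]. *)
pose A := \matrix_(i', j) if i' == i then dmx v M x i j else M x i' j.
transitivity (\det A).
  apply: eq_bigr => s _; congr (_ * _); rewrite [RHS](bigD1 i) //= mxE eqxx mxE.
  by congr (_ * _); apply: eq_bigr => j ji; rewrite mxE (negbTE ji).
rewrite (expand_det_row A i) mxE; apply: eq_bigr => j _.
rewrite [A i j]mxE eqxx; congr (_ * _); rewrite [RHS]mxE; congr (_ * \det _).
by apply/matrixP => a b; rewrite !mxE eq_sym (negbTE (neq_lift _ _)).
Qed.

Lemma cdiff_det n (M : pt -> 'M[C]_n) x : cdiff_mx M x -> cdiff (fun y => \det (M y)) x.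
Proof.
move=> dM; rewrite /determinant; apply: cdiff_sum => s _; apply: cdiffZ.
by apply: cdiff_prod => i _; apply: dM.
Qed.

Lemma ddir_det v n (M : pt -> 'M[C]_n) x : cdiff_mx M x -> M x \in unitmx ->
  ddir v (fun y => \det (M y)) x = \det (M x) * \tr (invmx (M x) *m dmx v M x).
Proof.
by move=> dM uM; rewrite jacobi_formula // /invmx uM -scalemxAl mxtraceZ mulVKf.
Qed.

Lemma cdiff_invmx n (M : pt -> 'M[C]_n) x : cdiff_mx M x ->
  (\forall y \near x, M y \in unitmx) -> cdiff_mx (fun y => invmx (M y)) x.
Proof.
move=> dM uM i j.
have uMx : M x \in unitmx := nbhs_singleton uM.
have d0 : \det (M x) != 0 by move: uMx; rewrite unitmxE unitfE.
apply: (@cdiff_near _ _ (fun y => (\det (M y))^-1 * \adj (M y) i j)).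
  by apply: filterS uM => y uy; rewrite /invmx uy [RHS]mxE.
apply: cdiffM; first by apply: cdiffV => //; apply: cdiff_det.
under eq_fun do rewrite mxE /cofactor; apply: cdiffZ; apply: cdiff_det => a b.
under eq_fun do rewrite !mxE; exact: dM.
Qed.

(** The derivative along [v] of the logarithm of [|det g|^(1/2)], written so that no root or sign of
    the determinant has to be chosen. *)
Definition log_volume_diff (g : pt -> 'M[C]_k) v x : C :=
  2^-1 * \tr (invmx (g x) *m dmx v g x).

(** Of the three metric derivatives, two form an expression antisymmetric in the summed indices;
    contracted with the symmetric inverse metric it vanishes. *)
Lemma christoffel_trace (g : pt -> 'M[C]_k) x l :
  (\forall y \near x, (g y)^T = g y) ->
  \sum_j christoffel g x j j l = log_volume_diff g (delta_mx l 0) x.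
Proof.
move=> gs; have gx : (g x)^T = g x := nbhs_singleton gs.
have gC i j p : pd p (fun y => g y i j) x = pd p (fun y => g y j i) x.
  by apply: pd_near; apply: filterS gs => y e; rewrite -{1}e mxE.
have gi i j : invmx (g x) i j = invmx (g x) j i.
  by rewrite -{1}gx -trmx_inv mxE.
rewrite /christoffel -mulr_sumr; congr (_ * _); rewrite /mxtrace.
under eq_bigr do (under eq_bigr do rewrite -addrA addrCA mulrDr);
under eq_bigr do rewrite big_split /=; rewrite big_split /=.
rewrite [X in _ + X](_ : _ = 0) ?addr0.
  apply: eq_bigr => j _; rewrite mxE; apply: eq_bigr => p _.
  by rewrite [dmx _ _ _ _ _]mxE -pd_ddir.
under eq_bigr do (under eq_bigr do rewrite mulrBr);
under eq_bigr do rewrite sumrB; rewrite sumrB.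
rewrite [X in _ - X]exchange_big /=; apply/eqP; rewrite subr_eq0; apply/eqP.
by apply: eq_bigr => j _; apply: eq_bigr => p _; rewrite gi.
Qed.

Lemma log_volume_diff_lin (g : pt -> 'M[C]_k) n (F : 'M[C]_(k, n)) (c : 'cV[C]_n) x :
  log_volume_diff g (F *m c) x = \sum_i c i 0 * log_volume_diff g (col i F) x.
Proof.
rewrite /log_volume_diff (_ : dmx _ _ _ = \sum_i c i 0 *: dmx (col i F) g x).
  rewrite mulmx_sumr raddf_sum /= mulr_sumr; apply: eq_bigr => i _.
  by rewrite -scalemxAr mxtraceZ mulrCA.
apply/matrixP => a b; rewrite mxE ddir_mulmx summxE; apply: eq_bigr => i _.
by rewrite !mxE.
Qed.

Lemma divergenceE (g : pt -> 'M[C]_k) (X : pt -> 'cV[C]_k) x :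
  (\forall y \near x, (g y)^T = g y) ->
  divergence g X x = \sum_j pd j (fun y => X y j 0) x + log_volume_diff g (X x) x.
Proof.
move=> gs; rewrite /divergence big_split; congr (_ + _) => /=.
rewrite exchange_big -[X in log_volume_diff _ X]mul1mx log_volume_diff_lin.
apply: eq_bigr => l _; rewrite -mulr_suml christoffel_trace // mulrC; congr (_ * log_volume_diff _ _ _).
by apply/matrixP => i j; rewrite !mxE ord1 eqxx andbT.
Qed.

(** The number [n] of columns is free: a single constant column serves for [L_t], a full moving
    frame for [Q_t]. *)
Lemma divergence_frame (g : pt -> 'M[C]_k) n (F : pt -> 'M[C]_(k, n))
    (c : pt -> 'cV[C]_n) (X : pt -> 'cV[C]_k) x :
  (\forall y \near x, (g y)^T = g y) -> (\forall y \near x, X y = F y *m c y) ->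
  cdiff_mx F x -> cdiff_mx c x ->
  (forall i, \sum_j pd j (fun y => F y j i) x = 0) ->
  divergence g X x = \sum_i (ddir (col i (F x)) (fun y => c y i 0) x
                             + log_volume_diff g (col i (F x)) x * c x i 0).
Proof.
move=> gs XE dF dc divF; rewrite divergenceE // (nbhs_singleton XE) log_volume_diff_lin.
rewrite big_split /=; congr (_ + _); last by apply: eq_bigr => i _; rewrite mulrC.
transitivity (\sum_j \sum_i (pd j (fun y => F y j i) x * c x i 0
                             + F x j i * pd j (fun y => c y i 0) x)).
  apply: eq_bigr => j _.
  rewrite (@pd_near _ _ j _ (fun y => \sum_i F y j i * c y i 0)); last first.
    by apply: filterS XE => y ->; rewrite mxE.
  rewrite pd_ddir ddir_sum; last by move=> i _; apply: cdiffM.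
  by apply: eq_bigr => i _; rewrite -pd_ddir pdM.
rewrite exchange_big; apply: eq_bigr => i _; rewrite big_split /= -mulr_suml divF.
rewrite mul0r add0r; apply: eq_bigr => j _.
by rewrite mxE.
Qed.

(** Half the logarithm of [det (E^T G E)] is [log det E] plus half of [log det G]: the coframe
    occurs twice, so its share loses the factor 1/2. *)
Lemma log_volume_diff_frame (g G E F : pt -> 'M[C]_k) v x :
  (\forall y \near x, g y = (E y)^T *m G y *m E y) ->
  E x *m F x = 1%:M -> G x \in unitmx -> cdiff_mx E x -> cdiff_mx G x ->
  log_volume_diff g v x = \tr (F x *m dmx v E x) + 2^-1 * \tr (invmx (G x) *m dmx v G x).
Proof.
move=> gE EF uG dE dG.
have dET := cdiff_mx_tr dE.
rewrite /log_volume_diff (dmx_near v gE) (dmx_mul v (cdiff_mx_mul dET dG) dE).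
rewrite (dmx_mul v dET dG) dmx_tr (nbhs_singleton gE).
rewrite (invmx_congruent EF (mulmxV uG)).
set dEx := dmx v E x; set dGx := dmx v G x.
set Gi := invmx _.
have EFT : (F x)^T *m (E x)^T = 1%:M by rewrite -trmx_mul EF trmx1.
rewrite mulmxDl !mulmxDr !raddfD /=.
have -> : \tr (F x *m Gi *m (F x)^T *m (dEx^T *m G x *m E x)) = \tr (F x *m dEx).
  rewrite mxtrace_mulC !mulmxA -(mulmxA _ (E x)) EF mulmx1 -(mulmxA _ (G x)) mulmxV //.
  by rewrite mulmx1 -trmx_mul mxtrace_tr.
have -> : \tr (F x *m Gi *m (F x)^T *m ((E x)^T *m dGx *m E x)) = \tr (Gi *m dGx).
  by rewrite !mulmxA -[_ *m (F x)^T *m (E x)^T]mulmxA EFT mulmx1 mxtrace_mulC !mulmxA EF mul1mx.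
have -> : \tr (F x *m Gi *m (F x)^T *m ((E x)^T *m G x *m dEx)) = \tr (F x *m dEx).
  by rewrite !mulmxA -[_ *m (F x)^T *m (E x)^T]mulmxA EFT mulmx1 -(mulmxA _ Gi) mulVmx // mulmx1.
by field.
Qed.

End MatrixCalculus.

(** * Elementary symmetric polynomials *)

Section SymmetricPolynomials.
Variables (R : realType) (I : finType).
Local Notation C := R[i].
Local Notation elsym := Defs.esym.
Implicit Types (A : {set I}) (v : I -> C).

Lemma eq_elsym A v w i : {in A, v =1 w} -> elsym A v i = elsym A w i.
Proof.
move=> vw; apply: eq_bigr => B /andP[/fintype.subsetP BA _].
by apply: eq_bigr => s sB; apply/vw/BA.
Qed.

(** The subsets of [A] are split by membership of [s]; those containing [s] correspond to subsets of
    [A :\ s] with one element fewer. *)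
Lemma elsymS A v s i : s \in A ->
  elsym A v i.+1 = elsym (A :\ s) v i.+1 + v s * elsym (A :\ s) v i.
Proof.
move=> sA; rewrite /Defs.esym (bigID (fun B : {set I} => s \in B)) /= addrC; congr (_ + _).
  apply: eq_bigl => B; rewrite finset.subsetD1.
  by case: (B \subset A); case: (s \in B); case: (#|B| == i.+1).
rewrite mulr_sumr (reindex_onto (fun B => s |: B) (fun B => B :\ s)) /=; last first.
  by move=> B /andP[_ sB]; rewrite finset.setD1K.
apply: eq_big => [B|B /andP[/andP[/andP[_ cB] _] /eqP BE]]; last first.
  have sB : s \notin B by rewrite -BE !inE eqxx.
  by rewrite big_setU1.
rewrite !inE eqxx /= andbT finset.subUset finset.sub1set sA /= finset.subsetD1.
case: (boolP (s \in B)) => sB /=; last first.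
  by rewrite finset.setU1K // eqxx cardsU1 sB add1n eqSS !andbT.
rewrite andbF /=; apply/negP => /andP[_ /eqP E].
by move: sB; rewrite -E !inE eqxx.
Qed.

Lemma elsym_big A v i : (#|A| < i)%N -> elsym A v i = 0.
Proof.
move=> Ai; rewrite /Defs.esym big_pred0 // => B; apply/negP => /andP[/subset_leq_card BA /eqP Bi].
by move: Ai; rewrite -Bi ltnNge BA.
Qed.

Lemma elsym0 A v : elsym A v 0 = 1.
Proof.
rewrite /Defs.esym (big_pred1 (finset.set0 : {set I})) ?big_set0 // => B.
by rewrite cards_eq0 /=; case: (altP (B =P finset.set0)) => [->|]; rewrite ?finset.sub0set ?andbF.
Qed.

(** Vieta's formula, by induction on the size: the recursion [elsymS] matches multiplication by one
    more linear factor. *)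
Lemma prod_sub_esym A v (t : C) n : #|A| = n ->
  \prod_(i in A) (t - v i) = \sum_(j < n.+1) (-1) ^+ j * elsym A v j * t ^+ (n - j).
Proof.
elim: n A => [|n IH] A cA.
  by rewrite (cards0_eq cA) big_set0 big_ord1 /= expr0 mulr1 mul1r elsym0.
have /card_gt0P[s sA] : (0 < #|A|)%N by rewrite cA.
have cAs : #|A :\ s| = n by move: cA; rewrite (cardsD1 s) sA => -[].
rewrite (big_setD1 s) //= IH // mulrBl.
set P := \sum_(j < n.+1) _.
rewrite big_ord_recl elsym0 subn0.
under eq_bigr => j _ do rewrite lift0 subSS (elsymS _ _ sA) mulrDr mulrDl.
rewrite big_split /= addrA; congr (_ + _).
  rewrite /P big_ord_recl elsym0 subn0 mulrDr [t * (_ * _ * _)]mulrC.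
  rewrite -[_ * t ^+ n * t]mulrA -exprSr; congr (_ + _).
  rewrite [RHS]big_ord_recr /= (elsym_big _ (i := n.+1)) ?cAs // mulr0 mul0r addr0.
  rewrite mulr_sumr; apply: eq_bigr => j _; rewrite /bump /= add1n mulrCA -exprS.
  by rewrite subnSK.
rewrite -mulNr mulr_sumr; apply: eq_bigr => j _; rewrite exprS; ring.
Qed.

End SymmetricPolynomials.

(** * Coordinates and eigenvalue functions *)

Section DirectionalCalculus.
Variables (R : realType) (k : nat).
Local Notation C := R[i].
Local Notation pt := 'rV[R]_k.

Lemma ddirC (D : set pt) (F : pt -> C) v w x : open D -> smooth D F -> D x ->
  ddir v (ddir w F) x = ddir w (ddir v F) x.
Proof.
move=> oD sF Dx; have cd a : cdiff (pd a F) x by exact: (smooth_cdiff [:: a] sF Dx).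
have E u u' : ddir u (ddir u' F) x = \sum_a \sum_b u a 0 * u' b 0 * pd a (pd b F) x.
  rewrite {1}/ddir; apply: eq_bigr => a _; rewrite pd_ddir ddir_sum; last first.
    by move=> b _; apply: cdiffZ.
  by rewrite mulr_sumr; apply: eq_bigr => b _; rewrite ddirZ // -pd_ddir mulrA.
rewrite !E exchange_big; apply: eq_bigr => a _; apply: eq_bigr => b _.
by rewrite (pdC _ _ oD sF Dx) [v _ _ * _]mulrC.
Qed.

Lemma smooth_cdiff0 (D : set pt) (F : pt -> C) x : smooth D F -> D x -> cdiff F x.
Proof. exact: (smooth_cdiff [::]). Qed.

Lemma smooth_cdiff_pd (D : set pt) (F : pt -> C) a x : smooth D F -> D x -> cdiff (pd a F) x.
Proof. exact: (smooth_cdiff [:: a]). Qed.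

Lemma smooth_cdiff_ddir (D : set pt) (F : pt -> C) v x :
  smooth D F -> D x -> cdiff (ddir v F) x.
Proof.
move=> sF Dx; apply: cdiff_sum => a _; apply: cdiffZ.
exact: smooth_cdiff_pd sF Dx.
Qed.

Lemma smooth_conj (D : set pt) (F : pt -> C) : open D -> smooth D F ->
  smooth D (fun x => (F x)^*%C).
Proof.
move=> oD sF s.
have E : forall x, D x -> pds s (fun x => (F x)^*%C) x = (pds s F x)^*%C.
  elim: s => [//|a s IH] x Dx /=.
  have nD : nbhs x D by apply: open_nbhs_nbhs.
  rewrite (@pd_near _ _ a _ (fun y => (pds s F y)^*%C)); last exact: filterS nD.
  by rewrite pd_conj //; apply: smooth_cdiff sF Dx.
move=> x Dx; have nD : nbhs x D by apply: open_nbhs_nbhs.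
apply: (@cdiff_near _ _ (fun y => (pds s F y)^*%C)).
  by apply: filterS nD => y /E ->.
by apply: cdiff_conj; apply: smooth_cdiff sF Dx.
Qed.

(** The condition on [B] says that it is a coordinate projection: an iterated partial derivative of
    the composite is then zero or an iterated partial derivative of [F], and no linear combinations
    arise. *)
Lemma smooth_mulmx n (B : 'M[R]_(k, n)) (D : set 'rV[R]_n) (F : 'rV[R]_n -> C) :
  (forall a, (exists b, delta_mx 0 a *m B = delta_mx 0 b :> 'rV_n) \/
             delta_mx 0 a *m B = 0 :> 'rV_n) ->
  smooth D F -> smooth [set x | D (x *m B)] (fun x => F (x *m B)).
Proof.
move=> hB sF s.
have [E|[s' E]] : pds s (fun x => F (x *m B)) = (fun=> 0) \/
    exists s', pds s (fun x => F (x *m B)) = (fun x => pds s' F (x *m B)).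
- elim: s => [|a s [E|[s' E]]] /=; first by right; exists [::].
    by left; rewrite E; apply/funext => x; rewrite pd_cst.
  rewrite E; case: (hB a) => [[b e]|e]; [right; exists (b :: s')|left]; apply/funext => x /=.
    exact: pd_mulmx.
  exact: pd_mulmx0.
- by move=> x _; rewrite E; apply: cdiff_cst.
- by move=> x Dx; rewrite E; apply: cdiff_mulmx; apply: smooth_cdiff sF Dx.
Qed.

End DirectionalCalculus.

Section Coordinates.
Variables (R : realType) (l q nb : nat) (h : 'I_nb -> nat).
Local Notation C := R[i].
Local Notation r := (l + l + q)%N.
Local Notation m c := ((h c).*2).
Local Notation dimS := (\sum_(c < nb) m c)%N.
Local Notation N := (r + r + dimS)%N.
Local Notation pt := 'rV[R]_N.

Lemma comp_ext (A B T : Type) (f g : A -> B) (F : B -> T) :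
  f =1 g -> (fun y => F (f y)) = (fun y => F (g y)).
Proof. by move=> /funext ->. Qed.

Lemma u_partE (x : pt) : u_part x = x *m col_mx (col_mx 1%:M 0) 0.
Proof.
rewrite /u_part -{2}[x]hsubmxK mul_row_col mulmx0 addr0 -{2}[lsubmx x]hsubmxK.
by rewrite mul_row_col mulmx0 addr0 mulmx1.
Qed.

Lemma s_partE (x : pt) : s_part x = x *m col_mx 0 1%:M.
Proof. by rewrite /s_part -{2}[x]hsubmxK mul_row_col mulmx0 add0r mulmx1. Qed.

Lemma t_partE (x : pt) : t_part x = x *m col_mx (col_mx 0 1%:M) 0.
Proof.
rewrite /t_part -{2}[x]hsubmxK mul_row_col mulmx0 addr0 -{2}[lsubmx x]hsubmxK.
by rewrite mul_row_col mulmx0 add0r mulmx1.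
Qed.

Lemma y_partE c (y : 'rV[R]_dimS) :
  y_part c y = y *m (\matrix_(j, b) (j == tagnat.Rank c b)%:R).
Proof.
apply/rowP => b; rewrite !mxE (bigD1 (tagnat.Rank c b)) //= !mxE eqxx mulr1.
by rewrite [X in _ + X]big1 ?addr0 // => j jb; rewrite mxE (negbTE jb) mulr0.
Qed.

Lemma linear_continuous_eq n k (B : 'M[R]_(n, k)) (f : 'rV[R]_n -> 'rV[R]_k) :
  (forall x, f x = x *m B) -> continuous f.
Proof. by move=> /funext ->; apply: mulmxl_continuous. Qed.

Lemma u_part_continuous : continuous (@u_part R l q nb h).
Proof. exact: linear_continuous_eq u_partE. Qed.

Lemma t_part_continuous : continuous (@t_part R l q nb h).
Proof. exact: linear_continuous_eq t_partE. Qed.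

Lemma s_part_continuous : continuous (@s_part R l q nb h).
Proof. exact: linear_continuous_eq s_partE. Qed.

Lemma y_part_continuous c : continuous (@y_part R nb h c).
Proof. exact: linear_continuous_eq (y_partE c). Qed.

Lemma delta_block (K : pzSemiRingType) n1 n2 n3 (v1 : 'cV[K]_n1) (v2 : 'cV[K]_n2) (v3 : 'cV[K]_n3) F :
  \sum_a col_mx (col_mx v1 v2) v3 a 0 * F a =
  \sum_a v1 a 0 * F (lshift n3 (lshift n2 a)) + \sum_a v2 a 0 * F (lshift n3 (rshift n1 a))
  + \sum_a v3 a 0 * F (rshift (n1 + n2) a).
Proof.
rewrite big_split_ord big_split_ord /=; congr (_ + _ + _); apply: eq_bigr => a _.
- by rewrite !col_mxEu.
- by rewrite col_mxEu col_mxEd.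
- by rewrite col_mxEd.
Qed.

Lemma block_sum_u (K : pzSemiRingType) n1 n2 n3 (v1 : 'cV[K]_n1) (v2 : 'cV[K]_n2) (v3 : 'cV[K]_n3) F f :
  (forall a, F (lshift n3 (lshift n2 a)) = f a) ->
  (forall a, F (lshift n3 (rshift n1 a)) = 0) -> (forall a, F (rshift (n1 + n2) a) = 0) ->
  \sum_a col_mx (col_mx v1 v2) v3 a 0 * F a = \sum_a v1 a 0 * f a.
Proof.
move=> f1 f2 f3; rewrite delta_block [X in _ + X + _]big1 ?[X in _ + _ + X]big1 ?addr0.
- by apply: eq_bigr => a _; rewrite f1.
- by move=> a _; rewrite f3 mulr0.
- by move=> a _; rewrite f2 mulr0.
Qed.

Lemma block_sum_s (K : pzSemiRingType) n1 n2 n3 (v1 : 'cV[K]_n1) (v2 : 'cV[K]_n2) (v3 : 'cV[K]_n3) F f :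
  (forall a, F (lshift n3 (lshift n2 a)) = 0) ->
  (forall a, F (lshift n3 (rshift n1 a)) = 0) -> (forall a, F (rshift (n1 + n2) a) = f a) ->
  \sum_a col_mx (col_mx v1 v2) v3 a 0 * F a = \sum_a v3 a 0 * f a.
Proof.
move=> f1 f2 f3; rewrite delta_block [X in X + _ + _]big1 ?[X in _ + X + _]big1 ?add0r.
- by apply: eq_bigr => a _; rewrite f3.
- by move=> a _; rewrite f2 mulr0.
- by move=> a _; rewrite f1 mulr0.
Qed.

Lemma ddir_u (F : 'rV[R]_r -> C) v1 v2 v3 (x : pt) :
  ddir (col_mx (col_mx v1 v2) v3) (fun y : pt => F (u_part y)) x = ddir v1 F (u_part x).
Proof.
rewrite (comp_ext F u_partE) u_partE; apply: block_sum_u => a.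
- by apply: pd_mulmx; rewrite !delta_mx_lshift !mul_row_col !mul0mx !addr0 mulmx1.
- apply: pd_mulmx0.
  by rewrite delta_mx_lshift delta_mx_rshift !mul_row_col !mul0mx mulmx0 !addr0.
- by apply: pd_mulmx0; rewrite delta_mx_rshift !mul_row_col !mul0mx mulmx0 !addr0.
Qed.

Lemma ddir_s (F : 'rV[R]_dimS -> C) v1 v2 v3 (x : pt) :
  ddir (col_mx (col_mx v1 v2) v3) (fun y : pt => F (s_part y)) x = ddir v3 F (s_part x).
Proof.
rewrite (comp_ext F s_partE) s_partE; apply: block_sum_s => a.
- by apply: pd_mulmx0; rewrite !delta_mx_lshift !mul_row_col !mul0mx mulmx0 !addr0.
- apply: pd_mulmx0.
  by rewrite delta_mx_lshift delta_mx_rshift !mul_row_col !mul0mx mulmx0 !addr0.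
- by apply: pd_mulmx; rewrite delta_mx_rshift !mul_row_col !mul0mx !add0r mulmx1.
Qed.

Lemma cdiff_u (F : 'rV[R]_r -> C) (x : pt) :
  cdiff F (u_part x) -> cdiff (fun y : pt => F (u_part y)) x.
Proof. by rewrite u_partE; rewrite (comp_ext F u_partE); apply: cdiff_mulmx. Qed.

Lemma cdiff_s (F : 'rV[R]_dimS -> C) (x : pt) :
  cdiff F (s_part x) -> cdiff (fun y : pt => F (s_part y)) x.
Proof. by rewrite s_partE; rewrite (comp_ext F s_partE); apply: cdiff_mulmx. Qed.

Lemma cdiff_y c (F : 'rV[R]_(m c) -> C) (y : 'rV[R]_dimS) :
  cdiff F (y_part c y) -> cdiff (fun y => F (y_part c y)) y.
Proof. by rewrite y_partE; rewrite (comp_ext F (y_partE c)); apply: cdiff_mulmx. Qed.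

Lemma pd_y_neq c (F : 'rV[R]_(m c) -> C) (y : 'rV[R]_dimS) j :
  tagnat.sig1 j != c -> pd j (fun y => F (y_part c y)) y = 0.
Proof.
move=> jc; rewrite (comp_ext F (y_partE c)); apply: pd_mulmx0.
apply/rowP => b'; rewrite -rowE !mxE; case: eqP => // E.
by move: jc; rewrite E tagnat.Rank1K eqxx.
Qed.

End Coordinates.

Section ChiFrame.
Variables (R : realType) (l q nb : nat) (h : 'I_nb -> nat).
Local Notation C := R[i].
Local Notation r := (l + l + q)%N.
Local Notation m c := ((h c).*2).
Local Notation dimS := (\sum_(c < nb) m c)%N.
Local Notation N := (r + r + dimS)%N.
Local Notation pt := 'rV[R]_N.

Definition dchi_u : 'I_r -> 'rV[C]_r :=
  by_chi (fun j => delta_mx 0 (ire q j) + 'i%C *: delta_mx 0 (iim q j))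
         (fun j => delta_mx 0 (ire q j) - 'i%C *: delta_mx 0 (iim q j))
         (fun j => delta_mx 0 (ixr l j)).

Definition Dchi_u : 'I_r -> 'cV[C]_r :=
  by_chi (fun j => 2^-1 *: (delta_mx (ire q j) 0 - 'i%C *: delta_mx (iim q j) 0))
         (fun j => 2^-1 *: (delta_mx (ire q j) 0 + 'i%C *: delta_mx (iim q j) 0))
         (fun j => delta_mx (ixr l j) 0).

Lemma by_chiP (P : 'I_r -> Prop) :
  (forall j, P (ire q j)) -> (forall j, P (iim q j)) -> (forall j, P (ixr l j)) ->
  forall k, P k.
Proof.
move=> h1 h2 h3 k; rewrite -[k]splitK; case: (fintype.split k) => k' /=; last exact: h3.
by rewrite -[k']splitK; case: (fintype.split k') => j /=; [exact: h1|exact: h2].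
Qed.

Lemma by_chi_ire T (a b : 'I_l -> T) (c : 'I_q -> T) j : by_chi a b c (ire q j) = a j.
Proof. by rewrite /by_chi /ire !(unsplitK (inl _)). Qed.

Lemma by_chi_iim T (a b : 'I_l -> T) (c : 'I_q -> T) j : by_chi a b c (iim q j) = b j.
Proof. by rewrite /by_chi /iim (unsplitK (inl _)) (unsplitK (inr _)). Qed.

Lemma by_chi_ixr T (a b : 'I_l -> T) (c : 'I_q -> T) j : by_chi a b c (ixr l j) = c j.
Proof. by rewrite /by_chi /ixr (unsplitK (inr _)). Qed.

Definition by_chiE := (by_chi_ire, by_chi_iim, by_chi_ixr).

Lemma dchi_row k : dchi R h k = row_mx (row_mx (dchi_u k) 0) 0.
Proof.
elim/by_chiP: k => j; rewrite /dchi /dchi_u !by_chiE /du /iu !delta_mx_lshift.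
- by rewrite !scale_row_mx !add_row_mx !scaler0 !addr0.
- by rewrite !scale_row_mx !opp_row_mx !add_row_mx !scaler0 !oppr0 !addr0.
- by [].
Qed.

Lemma Dchi_col k : Dchi R h k = col_mx (col_mx (Dchi_u k) 0) 0.
Proof.
elim/by_chiP: k => j; rewrite /Dchi /Dchi_u !by_chiE /Du /iu !delta_mx_ushift.
- by rewrite !scale_col_mx !opp_col_mx !add_col_mx !scale_col_mx !scaler0 !oppr0 !addr0 !scaler0.
- by rewrite !scale_col_mx !add_col_mx !scale_col_mx !scaler0 !addr0 !scaler0.
- by [].
Qed.

Lemma Dt_col (k : 'I_r) : Dt R h k = col_mx (col_mx 0 (delta_mx k 0)) 0.
Proof. by rewrite /Dt /it delta_mx_ushift delta_mx_dshift. Qed.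

Lemma dt_row (k : 'I_r) : dt R h k = row_mx (row_mx 0 (delta_mx 0 k)) 0.
Proof. by rewrite /dt /it delta_mx_lshift delta_mx_rshift. Qed.

Lemma dy_row c (b : 'I_(m c)) : dy R l q b = row_mx 0 (delta_mx 0 (tagnat.Rank c b)).
Proof. by rewrite /dy /iy delta_mx_rshift. Qed.

Lemma Dy_col c (b : 'I_(m c)) : Dy R l q b = col_mx 0 (delta_mx (tagnat.Rank c b) 0).
Proof. by rewrite /Dy /iy delta_mx_dshift. Qed.

Lemma ddir_Dchi_u k (F : 'rV[R]_r -> C) (u : 'rV[R]_r) : ddir (Dchi_u k) F u =
  by_chi (fun j => 2^-1 * (pd (ire q j) F u - 'i%C * pd (iim q j) F u))
         (fun j => 2^-1 * (pd (ire q j) F u + 'i%C * pd (iim q j) F u))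
         (fun j => pd (ixr l j) F u) k.
Proof.
have D (v w : 'cV[C]_r) : ddir (v + w) F u = ddir v F u + ddir w F u.
  by rewrite /ddir -big_split; apply: eq_bigr => a _; rewrite mxE mulrDl.
have Z (a : C) (v : 'cV[C]_r) : ddir (a *: v) F u = a * ddir v F u.
  by rewrite /ddir mulr_sumr; apply: eq_bigr => b _; rewrite mxE mulrA.
elim/by_chiP: k => j; rewrite /Dchi_u !by_chiE ?pd_ddir //.
  by rewrite Z -scaleNr D Z mulNr.
by rewrite Z D Z.
Qed.

Lemma ire_eq (i j : 'I_l) : (ire q i == ire q j) = (i == j).
Proof. by rewrite /ire !(inj_eq (@lshift_inj _ _)). Qed.

Lemma iim_eq (i j : 'I_l) : (iim q i == iim q j) = (i == j).
Proof. by rewrite /iim (inj_eq (@lshift_inj _ _)) (inj_eq (@rshift_inj _ _)). Qed.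

Lemma ixr_eq (i j : 'I_q) : (ixr l i == ixr l j) = (i == j).
Proof. by rewrite /ixr (inj_eq (@rshift_inj _ _)). Qed.

Lemma ire_iim (i j : 'I_l) : (ire q i == iim q j) = false.
Proof. by rewrite /ire /iim (inj_eq (@lshift_inj _ _)) eq_lrshift. Qed.

Lemma iim_ire (i j : 'I_l) : (iim q i == ire q j) = false.
Proof. by rewrite eq_sym ire_iim. Qed.

Lemma ire_ixr (i : 'I_l) (j : 'I_q) : (ire q i == ixr l j) = false.
Proof. by rewrite /ire /ixr eq_lrshift. Qed.

Lemma ixr_ire (i : 'I_l) (j : 'I_q) : (ixr l j == ire q i) = false.
Proof. by rewrite eq_sym ire_ixr. Qed.

Lemma iim_ixr (i : 'I_l) (j : 'I_q) : (iim q i == ixr l j) = false.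
Proof. by rewrite /iim /ixr eq_lrshift. Qed.

Lemma ixr_iim (i : 'I_l) (j : 'I_q) : (ixr l j == iim q i) = false.
Proof. by rewrite eq_sym iim_ixr. Qed.

Definition chi_eqE := (ire_eq, iim_eq, ixr_eq, ire_iim, iim_ire, ire_ixr, ixr_ire, iim_ixr, ixr_iim).

Lemma dchi_u_mul s n (v : 'M[C]_(r, n)) b : (dchi_u s *m v) 0 b =
  by_chi (fun j => v (ire q j) b + 'i%C * v (iim q j) b)
         (fun j => v (ire q j) b - 'i%C * v (iim q j) b) (fun j => v (ixr l j) b) s.
Proof.
by elim/by_chiP: s => j; rewrite /dchi_u !by_chiE ?mulmxDl ?mulNmx -?scalemxAl -?rowE !mxE.
Qed.

Lemma dchi_u_Dchi_u s k : (dchi_u s *m Dchi_u k) 0 0 = (s == k)%:R.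
Proof.
have i2 : 'i%C * 'i%C = -1 :> C by rewrite -expr2 sqr_i.
have half : 2^-1 + 2^-1 = 1 :> C by field.
rewrite dchi_u_mul; elim/by_chiP: s => i; elim/by_chiP: k => j.
all: rewrite /Dchi_u !by_chiE !mxE !chi_eqE ?andbT /=; try by ring.
all: case: eqP => _ /=; try by ring.
(* With 1/2 and the imaginary unit abstracted, the remaining goals are ring identities modulo
   [i^2 = -1]; those on the diagonal reduce to 1/2 + 1/2 = 1. *)
all: move: half i2; move: (2^-1 : C) ('i%C : C) => a i0 half i2.
all: first [by ring: i2 | by apply: etrans half; ring: i2].
Qed.

End ChiFrame.

Section Eigenvalues.
Variables (R : realType) (l q nb : nat) (h : 'I_nb -> nat) (d : nf_data R l q nb h).
Local Notation C := R[i].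
Local Notation r := (l + l + q)%N.
Local Notation m c := ((h c).*2).
Local Notation dimS := (\sum_(c < nb) m c)%N.
Local Notation N := (r + r + dimS)%N.
Local Notation pt := 'rV[R]_N.
Hypothesis nfd : normal_form d.

(** The eigenvalues as functions on U alone, so that their derivatives along [t] and [y] vanish by
    the chain rule. *)
Definition rho_u (k : 'I_r) : 'rV[R]_r -> C :=
  by_chi (fun j u => nf_sigmac d j (zcoord j u))
         (fun j u => (nf_sigmac d j (zcoord j u))^*%C)
         (fun j u => (nf_sigmar d j (u 0 (ixr l j)))%:C) k.

Lemma rhoE k (x : pt) : rho d k x = rho_u k (u_part x).
Proof. by rewrite /rho /rho_u; elim/by_chiP: k => j; rewrite !by_chiE. Qed.

Lemma rho_funE k : rho d k = (fun y : pt => rho_u k (u_part y)).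
Proof. by apply/funext => y; rewrite rhoE. Qed.

Definition zproj (j : 'I_l) : 'M[R]_(r, 2) :=
  \matrix_(a, b) (a == if b == 0 then ire q j else iim q j)%:R.

Definition xproj (j : 'I_q) : 'M[R]_(r, 1) := \matrix_(a, b) (a == ixr l j)%:R.

Lemma mul_col_select (u : 'rV[R]_r) n (f : 'I_n -> 'I_r) b :
  (u *m (\matrix_(a, b) (a == f b)%:R)) 0 b = u 0 (f b).
Proof.
rewrite mxE (bigD1 (f b)) //= !mxE eqxx mulr1 [X in _ + X]big1 ?addr0 // => a ab.
by rewrite mxE (negbTE ab) mulr0.
Qed.

Lemma zcoordE j (u : 'rV[R]_r) : zcoord j u = plane (u *m zproj j).
Proof.
by rewrite /plane /zproj !(mul_col_select u (fun b => if b == 0 then ire q j else iim q j)).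
Qed.

Lemma xcoordE j (u : 'rV[R]_r) : u 0 (ixr l j) = (u *m xproj j) 0 0.
Proof. by rewrite /xproj (mul_col_select u (fun b => ixr l j)). Qed.

Lemma delta_zproj j a : delta_mx 0 a *m zproj j =
  (a == ire q j)%:R *: delta_mx 0 0 + (a == iim q j)%:R *: delta_mx 0 1 :> 'rV[R]_2.
Proof.
apply/rowP => b; rewrite -rowE !mxE /=; case: (altP (b =P 0)) => [->|b0] /=.
  by rewrite mulr1 mulr0 addr0.
have -> : b = 1 by case: b b0 => [[|[|]]] //= *; apply/val_inj.
by rewrite mulr0 add0r mulr1.
Qed.

Lemma delta_xproj j a : delta_mx 0 a *m xproj j = (a == ixr l j)%:R *: delta_mx 0 0 :> 'rV[R]_1.
Proof. by apply/rowP => b; rewrite -rowE !mxE ord1 /= mulr1. Qed.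

Lemma pd_zproj (F : 'rV[R]_2 -> C) j a (u : 'rV[R]_r) :
  pd a (fun u => F (u *m zproj j)) u =
  (a == ire q j)%:R * pd 0 F (u *m zproj j) + (a == iim q j)%:R * pd 1 F (u *m zproj j).
Proof.
elim/by_chiP: a => i; rewrite !chi_eqE.
- case: (altP (i =P j)) => [->|ij].
    by rewrite mul1r mul0r addr0; apply: pd_mulmx; rewrite delta_zproj !chi_eqE eqxx scale1r scale0r addr0.
  rewrite !mul0r addr0; apply: pd_mulmx0.
  by rewrite delta_zproj !chi_eqE (negbTE ij) !scale0r addr0.
- case: (altP (i =P j)) => [->|ij].
    by rewrite mul1r mul0r add0r; apply: pd_mulmx; rewrite delta_zproj !chi_eqE eqxx scale1r scale0r add0r.
  rewrite !mul0r addr0; apply: pd_mulmx0.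
  by rewrite delta_zproj !chi_eqE (negbTE ij) !scale0r addr0.
- rewrite !mul0r addr0; apply: pd_mulmx0.
  by rewrite delta_zproj !chi_eqE !scale0r addr0.
Qed.

Lemma pd_xproj (F : 'rV[R]_1 -> C) j a (u : 'rV[R]_r) :
  pd a (fun u => F (u *m xproj j)) u = (a == ixr l j)%:R * pd 0 F (u *m xproj j).
Proof.
case: (altP (a =P ixr l j)) => [->|ij].
  by rewrite mul1r; apply: pd_mulmx; rewrite delta_xproj eqxx scale1r.
by rewrite mul0r; apply: pd_mulmx0; rewrite delta_xproj (negbTE ij) scale0r.
Qed.

Lemma rho_u_ire j : rho_u (ire q j) = (fun u => (nf_sigmac d j \o plane (R:=R)) (u *m zproj j)).
Proof. by rewrite /rho_u by_chiE; apply/funext => u; rewrite /= -zcoordE. Qed.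

Lemma rho_u_iim j : rho_u (iim q j) = (fun u => (rho_u (ire q j) u)^*%C).
Proof. by rewrite /rho_u !by_chiE. Qed.

Lemma rho_u_ixr j : rho_u (ixr l j) =
  (fun u => (fun p : 'rV[R]_1 => (nf_sigmar d j (p 0 0))%:C) (u *m xproj j)).
Proof. by rewrite /rho_u by_chiE; apply/funext => u; rewrite /= -xcoordE. Qed.

Lemma rho_u_smooth k : smooth (nf_U d) (rho_u k).
Proof.
have sub (D D' : set 'rV[R]_r) F : D `<=` D' -> smooth D' F -> smooth D F.
  by move=> DD sF s x /DD; apply: sF.
have sre j : smooth (nf_U d) (rho_u (ire q j)).
  rewrite rho_u_ire.
  have [sm _] := nf_sigmac_hol nfd j.
  apply: sub (smooth_mulmx (B := zproj j) _ sm).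
    by move=> u Uu /=; rewrite -zcoordE; exists u.
  move=> a; rewrite delta_zproj; elim/by_chiP: a => i; rewrite !chi_eqE.
  - by case: eqP => _; [left; exists 0; rewrite scale1r scale0r addr0|right; rewrite !scale0r addr0].
  - by case: eqP => _; [left; exists 1; rewrite scale1r scale0r add0r|right; rewrite !scale0r addr0].
  - by right; rewrite !scale0r addr0.
elim/by_chiP: k => j; first exact: sre.
  by rewrite rho_u_iim; apply: smooth_conj => //; apply: nf_U_open nfd.
have sm := @nf_sigmar_smooth _ _ _ _ _ _ nfd j; rewrite /smooth1 in sm.
rewrite rho_u_ixr; apply: sub (smooth_mulmx (B := xproj j) _ sm).
  by move=> u Uu /=; rewrite -xcoordE; exists u.
move=> a; rewrite delta_xproj; case: eqP => _; first by left; exists 0; rewrite scale1r.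
by right; rewrite scale0r.
Qed.

(** Only the pair [z_j], [bar z_j] needs an argument: it is the Cauchy-Riemann equation for
    [sigma_j], or its complex conjugate. In all other cases the function does not involve the
    coordinate. *)
Lemma rho_u_indep s k u : nf_U d u -> s != k -> ddir (Dchi_u R s) (rho_u k) u = 0.
Proof.
move=> Uu sk; rewrite ddir_Dchi_u.
have hol j : pd (ire q j) (rho_u (ire q j)) u + 'i%C * pd (iim q j) (rho_u (ire q j)) u = 0.
  rewrite rho_u_ire !pd_zproj !chi_eqE eqxx !mul1r !mul0r addr0 add0r.
  have [_] := nf_sigmac_hol nfd j; apply.
  by rewrite -zcoordE; exists u.
have pz0 j p : pd (ixr l p) (rho_u (ire q j)) u = 0.
  by rewrite rho_u_ire pd_zproj !chi_eqE !mul0r addr0.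
have pzn i j : i != j -> pd (ire q i) (rho_u (ire q j)) u = 0 /\ pd (iim q i) (rho_u (ire q j)) u = 0.
  by move=> ij; rewrite rho_u_ire !pd_zproj !chi_eqE (negbTE ij) !mul0r addr0.
have cz j a : pd a (rho_u (iim q j)) u = (pd a (rho_u (ire q j)) u)^*%C.
  by rewrite rho_u_iim pd_conj //; apply: smooth_cdiff0 (rho_u_smooth _) Uu.
have px j a : a != ixr l j -> pd a (rho_u (ixr l j)) u = 0.
  by move=> aj; rewrite rho_u_ixr (pd_xproj (fun p : 'rV[R]_1 => (nf_sigmar d j (p 0 0))%:C)) (negbTE aj) mul0r.
elim/by_chiP: k sk => j; elim/by_chiP: s => i; rewrite !chi_eqE !by_chiE => sk.
- by have [-> ->] := pzn i j sk; rewrite mulr0 subrr mulr0.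
- have [->|ij] := eqVneq i j; first by rewrite hol mulr0.
  by have [-> ->] := pzn i j ij; rewrite mulr0 addr0 mulr0.
- exact: pz0.
- rewrite !cz; have [->|ij] := eqVneq i j; last first.
    by have [-> ->] := pzn i j ij; rewrite !conjc0 mulr0 subrr mulr0.
  have := congr1 conjc (hol j); rewrite rmorphD rmorphM conjc0 /= => E.
  by rewrite -[RHS](mulr0 2^-1) -[in RHS]E; congr (_ * (_ + _)); rewrite -mulNr; congr (_ * _);
    apply/eqP; rewrite eq_complex /= oppr0 !eqxx.
- by have [pa pb] := pzn i j sk; rewrite !cz pa pb !conjc0 mulr0 addr0 mulr0.
- by rewrite cz pz0 conjc0.
- by rewrite !px ?chi_eqE // mulr0 subrr mulr0.
- by rewrite !px ?chi_eqE // mulr0 addr0 mulr0.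
- by apply: px; rewrite chi_eqE.
Qed.

Definition rho'_u k : 'rV[R]_r -> C := ddir (Dchi_u R k) (rho_u k).

Lemma rho'E k (x : pt) : rho' d k x = rho'_u k (u_part x).
Proof.
rewrite -[RHS](ddir_u (rho_u k) (Dchi_u R k) 0 0) -Dchi_col.
by rewrite -rho_funE.
Qed.

Lemma rho'_u_cdiff k u : nf_U d u -> cdiff (rho'_u k) u.
Proof. by move=> Uu; apply: smooth_cdiff_ddir (rho_u_smooth k) Uu. Qed.

(** The two derivatives commute, and the inner one then vanishes on a neighbourhood of [u] by
    [rho_u_indep]. *)
Lemma rho'_u_indep s k u : nf_U d u -> s != k -> ddir (Dchi_u R s) (rho'_u k) u = 0.
Proof.
move=> Uu sk; rewrite /rho'_u (ddirC _ _ (nf_U_open nfd) (rho_u_smooth k) Uu).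
rewrite -(ddir_cst (Dchi_u R k) 0 u); apply: ddir_near.
have : nbhs u (nf_U d) by apply: open_nbhs_nbhs; split=> //; apply: nf_U_open nfd.
by apply: filterS => v Uv; rewrite rho_u_indep.
Qed.

Lemma Dchi_u_dchi_u : \sum_s Dchi_u R s *m dchi_u R s = 1%:M :> 'M[C]_r.
Proof.
pose E : 'M[C]_r := \matrix_s dchi_u R s; pose F : 'M[C]_r := \matrix_(a, s) Dchi_u R s a 0.
have EF : E *m F = 1%:M.
  apply/matrixP => s k; rewrite [RHS]mxE -(dchi_u_Dchi_u R s k) [LHS]mxE [RHS]mxE.
  by apply: eq_bigr => a _; rewrite !mxE.
rewrite -(mulmx1C EF); apply/matrixP => a b; rewrite summxE mxE.
by apply: eq_bigr => s _; rewrite mxE big_ord1 !mxE.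
Qed.

(** All other [chi] derivatives of [rho_k] vanish, so [d rho_k] is [rho'_k dchi_k], and it is
    nonzero by assumption. *)
Lemma rho'_neq0 k x : nf_W d x -> rho' d k x != 0.
Proof.
move=> Wx; apply/eqP => r0; apply: (nf_drho nfd Wx (k := k)).
have Uu : nf_U d (u_part x) by case: Wx.
have z s : ddir (Dchi_u R s) (rho_u k) (u_part x) = 0.
  have [->|sk] := eqVneq s k; last exact: rho_u_indep.
  by rewrite -[LHS]/(rho'_u k _) -rho'E.
have pz a : pd a (rho_u k) (u_part x) = 0.
  have /matrixP/(_ a) E := Dchi_u_dchi_u.
  rewrite pd_ddir.
  have -> : delta_mx a 0 = \sum_s dchi_u R s 0 a *: Dchi_u R s :> 'cV[C]_r.
    apply/colP => b; rewrite summxE !mxE eqxx andbT.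
    have /matrixP/(_ b a) := Dchi_u_dchi_u; rewrite summxE mxE => <-.
    by apply: eq_bigr => s _; rewrite !mxE big_ord1 mulrC.
  rewrite /ddir; under eq_bigr do rewrite summxE mulr_suml.
  rewrite exchange_big big1 // => s _.
  under eq_bigr do rewrite mxE -mulrA; rewrite -mulr_sumr.
  by rewrite -/(ddir _ _ _) z mulr0.
apply/rowP => a; rewrite !mxE pd_ddir.
have -> : delta_mx a 0 = col_mx (col_mx (usubmx (usubmx (delta_mx a 0)))
    (dsubmx (usubmx (delta_mx a 0)))) (dsubmx (delta_mx a 0)) :> 'cV[C]_N by rewrite !vsubmxK.
by rewrite rho_funE ddir_u /ddir big1 // => b _; rewrite pz mulr0.
Qed.

End Eigenvalues.

(** * Adapted frame and spectrum *)

Section BlockSums.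
Variable K : fieldType.

Lemma sum_tagnat (V : nmodType) nb (p : 'I_nb -> nat) (f : 'I_(\sum_i p i) -> V) :
  \sum_c \sum_(b < p c) f (tagnat.Rank c b) = \sum_j f j.
Proof.
rewrite sig_big_dep /= [RHS](reindex (@tagnat.rank _ p)) /=; last exact/onW_bij/tagnat.rank_bij.
by apply: eq_bigr => -[c b] _; rewrite tagnat.rankE.
Qed.

Lemma sum_tagnat1 (V : nmodType) nb (p : 'I_nb -> nat) c (f : 'I_(\sum_i p i) -> V) :
  (forall c' b, c' != c -> f (tagnat.Rank c' b) = 0) ->
  \sum_j f j = \sum_(b < p c) f (tagnat.Rank c b).
Proof.
move=> f0; rewrite -(sum_tagnat f) [LHS](bigD1 c) //= [X in _ + X]big1 ?addr0 //.
by move=> c' c'c; apply: big1 => b _; apply: f0.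
Qed.

Lemma mxdiag_Rank nb (p : 'I_nb -> nat) (B : forall c, 'M[K]_(p c)) c a b :
  (\mxdiag_c B c) (tagnat.Rank c a) (tagnat.Rank c b) = B c a b.
Proof. by have /matrixP/(_ a b) := submxblock_diag B c; rewrite mxE. Qed.

Lemma mxdiag_Rank_neq nb (p : 'I_nb -> nat) (B : forall c, 'M[K]_(p c)) c c' a b :
  c != c' -> (\mxdiag_c B c) (tagnat.Rank c a) (tagnat.Rank c' b) = 0.
Proof.
move=> cc'; have : submxblock (\mxdiag_c B c) c c' = 0.
  by rewrite /mxdiag mxblockK (negbTE cc').
by move=> /matrixP/(_ a b); rewrite mxE [RHS]mxE.
Qed.

Lemma mxdiag_sum_delta nb (p : 'I_nb -> nat) (B : forall c, 'M[K]_(p c)) :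
  \mxdiag_c B c =
  \sum_c \sum_a \sum_b B c a b *: delta_mx (tagnat.Rank c a) (tagnat.Rank c b).
Proof.
rewrite [LHS]matrix_sum_delta -[LHS]sum_tagnat.
apply: eq_bigr => c _; apply: eq_bigr => a _.
rewrite (sum_tagnat1 (c := c)) => [|c' b c'c].
  by apply: eq_bigr => b _; rewrite mxdiag_Rank.
by rewrite mxdiag_Rank_neq ?scale0r // eq_sym.
Qed.

Lemma diag_mulmx_sum n n1 n2 (A : 'M[K]_(n1, n)) (D : 'rV[K]_n) (B : 'M[K]_(n, n2)) :
  A *m diag_mx D *m B = \sum_s D 0 s *: (col s A *m row s B).
Proof.
apply/matrixP => i j; rewrite mxE summxE; apply: eq_bigr => s _.
by rewrite mul_mx_diag !mxE big_ord1 !mxE mulrA [D _ _ * _]mulrC.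
Qed.

Lemma sandwich_sum_delta n1 n2 nb (p : 'I_nb -> nat) (A : 'M[K]_(n1, \sum_i p i))
    (B : forall c, 'M[K]_(p c)) (D : 'M[K]_(\sum_i p i, n2)) :
  A *m (\mxdiag_c B c) *m D =
  \sum_c \sum_a \sum_b B c a b *: (col (tagnat.Rank c a) A *m row (tagnat.Rank c b) D).
Proof.
rewrite mxdiag_sum_delta mulmx_sumr mulmx_suml; apply: eq_bigr => c _.
rewrite mulmx_sumr mulmx_suml; apply: eq_bigr => a _.
rewrite mulmx_sumr mulmx_suml; apply: eq_bigr => b _.
rewrite -scalemxAr -scalemxAl; congr (_ *: _).
by rewrite rowE colE -(mul_delta_mx (0 : 'I_1)) !mulmxA.
Qed.

Lemma row_mx0_sum n k (w : 'rV[K]_n) :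
  row_mx (0 : 'rV_k) w = \sum_j w 0 j *: row_mx 0 (delta_mx 0 j).
Proof.
rewrite {1}[w]row_sum_delta; rewrite (big_morph (row_mx 0) (id1 := 0) (op1 := +%R)).
- by apply: eq_bigr => j _; rewrite scale_row_mx scaler0.
- by move=> u v; rewrite add_row_mx addr0.
- by rewrite row_mx0.
Qed.

Lemma colmx_sum n n1 n2 (w : 'cV[K]_n) :
  col_mx (col_mx (0 : 'cV_n1) w) (0 : 'cV_n2) =
  \sum_j w j 0 *: col_mx (col_mx 0 (delta_mx j 0)) 0.
Proof.
have {1}-> : w = \sum_j w j 0 *: delta_mx j 0.
  rewrite [LHS]matrix_sum_delta; apply: eq_bigr => j _.
  by rewrite big_ord1.
rewrite (big_morph (fun v => col_mx (col_mx (0 : 'cV_n1) v) (0 : 'cV_n2)) (id1 := 0) (op1 := +%R)).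
- by apply: eq_bigr => j _; rewrite !scale_col_mx !scaler0.
- by move=> u v; rewrite !add_col_mx !addr0.
- by rewrite !col_mx0.
Qed.

Lemma block_diag_sandwich n1 n2 n3 k k' (F1 : 'M[K]_(k, n1)) (F2 : 'M[K]_(k, n2)) (F3 : 'M[K]_(k, n3))
   A1 A2 A3 (E1 : 'M[K]_(n1, k')) (E2 : 'M[K]_(n2, k')) (E3 : 'M[K]_(n3, k')) :
  row_mx (row_mx F1 F2) F3 *m block_mx (block_mx A1 0 0 A2) 0 0 A3 *m col_mx (col_mx E1 E2) E3
  = F1 *m A1 *m E1 + F2 *m A2 *m E2 + F3 *m A3 *m E3.
Proof.
rewrite !mul_row_block !mul_row_col !mulmx0 !addr0 !add0r.
by rewrite mul_row_col.
Qed.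

End BlockSums.

Section Frame.
Variables (R : realType) (l q nb : nat) (h : 'I_nb -> nat) (d : nf_data R l q nb h).
Local Notation C := R[i].
Local Notation r := (l + l + q)%N.
Local Notation m c := ((h c).*2).
Local Notation dimS := (\sum_(c < nb) m c)%N.
Local Notation N := (r + r + dimS)%N.
Local Notation pt := 'rV[R]_N.

Definition muhat_mx (x : pt) : 'M[C]_r := \matrix_(s, j) muhat d s j x.
Definition power_mx (x : pt) : 'M[C]_r := \matrix_(j, s) ((-1) ^+ j * rho d s x ^+ (r - j.+1)).
(** The inverse of [muhat_mx] given by Lagrange interpolation: a signed Vandermonde matrix with
    columns divided by the gaps [Delta]. *)
Definition muhat_inv (x : pt) : 'M[C]_r :=
  power_mx x *m diag_mx (\row_s (Delta d s x)^-1).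
Definition alpha_mx (x : pt) : 'M[C]_(r, dimS) := \matrix_(i, j) (nf_alpha d i (s_part x) 0 j)%:C.
Definition dchi_mx : 'M[C]_r := \matrix_s dchi_u R s.
Definition Dchi_mx : 'M[C]_r := \matrix_(a, s) Dchi_u R s a 0.
Definition theta_mx (x : pt) : 'M[C]_(r, N) := row_mx (row_mx 0 1%:M) (alpha_mx x).

Definition coframe_chi : 'M[C]_(r, N) := row_mx (row_mx dchi_mx 0) 0.
Definition coframe_t (x : pt) : 'M[C]_(r, N) := muhat_mx x *m theta_mx x.
Definition coframe_y : 'M[C]_(dimS, N) := row_mx 0 1%:M.
Definition coframe x : 'M[C]_N := col_mx (col_mx coframe_chi (coframe_t x)) coframe_y.

Definition frame_chi : 'M[C]_(N, r) := col_mx (col_mx Dchi_mx 0) 0.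
Definition frame_t (x : pt) : 'M[C]_(N, r) := col_mx (col_mx 0 (muhat_inv x)) 0.
(** Horizontal lifts of the coordinate fields of the factors [S_c]: they are annihilated by every
    [theta]. *)
Definition frame_y (x : pt) : 'M[C]_(N, dimS) := col_mx (col_mx 0 (- alpha_mx x)) 1%:M.
Definition frame x : 'M[C]_N := row_mx (row_mx frame_chi (frame_t x)) (frame_y x).

Lemma row_coframe_chi s : row s coframe_chi = dchi R h s.
Proof. by rewrite dchi_row !row_row_mx !row0 rowK. Qed.

Lemma col_frame_chi s : col s frame_chi = Dchi R h s.
Proof. by rewrite Dchi_col !col_col_mx !col0; congr col_mx; congr col_mx; apply/colP => a; rewrite !mxE. Qed.

Lemma row_theta_mx i x : row i (theta_mx x) = theta d i x.
Proof.
rewrite /theta dt_row /theta_mx !row_row_mx row0 row1.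
rewrite (_ : \sum_c \sum_b _ = row_mx 0 (row i (alpha_mx x))).
  by rewrite add_row_mx addr0 add0r.
rewrite row_mx0_sum -[RHS]sum_tagnat; apply: eq_bigr => c _; apply: eq_bigr => b _.
by rewrite dy_row !mxE.
Qed.

Lemma row_coframe_y c b : row (tagnat.Rank c b) coframe_y = dy R l q b.
Proof. by rewrite dy_row row_row_mx row0 row1. Qed.

Lemma col_frame_y x c b : col (tagnat.Rank c b) (frame_y x) =
  Dy R l q b - \sum_i alpha d i b x *: Dt R h i.
Proof.
rewrite Dy_col col_col_mx col1 col_col_mx col0.
rewrite (_ : \sum_i _ = col_mx (col_mx 0 (col (tagnat.Rank c b) (alpha_mx x))) 0).
  rewrite opp_col_mx add_col_mx oppr0 addr0 add0r opp_col_mx oppr0.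
  by congr (col_mx (col_mx _ _) _); apply/colP => j; rewrite !mxE.
rewrite colmx_sum; apply: eq_bigr => i _.
by rewrite Dt_col !mxE.
Qed.

End Frame.

Section FrameOnW.
Variables (R : realType) (l q nb : nat) (h : 'I_nb -> nat) (d : nf_data R l q nb h).
Local Notation C := R[i].
Local Notation r := (l + l + q)%N.
Local Notation m c := ((h c).*2).
Local Notation dimS := (\sum_(c < nb) m c)%N.
Local Notation N := (r + r + dimS)%N.
Local Notation pt := 'rV[R]_N.
Local Notation rhoc c := ((nf_rhoc d c)%:C).

(** Vieta's formula for the [r - 1] eigenvalues other than [rho_k]; thus row [k] of [muhat_mx]
    holds, up to signs, the coefficients of this polynomial. *)
Lemma muhat_sum (k : 'I_r) (t : C) (x : pt) :
  \sum_(j < r) muhat d k j x * ((-1) ^+ j * t ^+ (r - j.+1)) =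
  \prod_(i | i != k) (t - rho d i x).
Proof.
rewrite /muhat; set A := finset.setC _.
have cA : #|A| = r.-1 by rewrite /A cardsC1 card_ord.
have r0 : (0 < r)%N := leq_ltn_trans (leq0n k) (ltn_ord k).
transitivity (\prod_(i in A) (t - rho d i x)); last by apply: eq_bigl => i; rewrite !inE.
rewrite (prod_sub_esym _ _ cA)
  -(big_mkord xpredT (fun j => Defs.esym A (fun k => rho d k x) j * ((-1) ^+ j * t ^+ (r - j.+1)))).
rewrite -(big_mkord xpredT (fun j => (-1) ^+ j * Defs.esym A (fun k => rho d k x) j * t ^+ (r.-1 - j))).
rewrite prednK //.
by apply: eq_bigr => j _; rewrite mulrCA mulrA -subn1 -subnDA add1n.
Qed.

Lemma mu_sum (t : C) (x : pt) :
  \sum_(i < r.+1) (-1) ^+ i * mu d i x * t ^+ (r - i) = \prod_k (t - rho d k x).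
Proof.
rewrite /mu -prod_sub_esym ?cardsT ?card_ord //.
by apply: eq_bigl => i; rewrite !inE.
Qed.

Lemma muhat0 s (x : pt) : muhat d s 0 x = 1.
Proof. exact: elsym0. Qed.

Lemma muhat_top s (x : pt) : muhat d s r x = 0.
Proof.
apply: elsym_big; rewrite cardsC1 card_ord ltn_predL.
exact: leq_ltn_trans (leq0n s) (ltn_ord s).
Qed.

Lemma muS s i (x : pt) : mu d i.+1 x = muhat d s i.+1 x + rho d s x * muhat d s i x.
Proof.
rewrite /mu (elsymS (A := finset.setT) _ _ (s := s)) ?inE // /muhat.
by have -> : (finset.setT :\ s = [set~ s])%SET by apply/finset.setP => j; rewrite !inE andbT.
Qed.

(** By [muhat_sum], entry (s, k) is the polynomial with roots [rho_i], [i != s], evaluated at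
    [rho_k]; off the diagonal [rho_k] is one of the roots. *)
Lemma muhat_power (x : pt) : muhat_mx d x *m power_mx d x = diag_mx (\row_s Delta d s x).
Proof.
apply/matrixP => s k; rewrite mxE [RHS]mxE mxE.
under eq_bigr do rewrite !mxE; rewrite muhat_sum.
case: (altP (s =P k)) => [->|sk]; first by rewrite mulr1n.
by rewrite mulr0n (bigD1 k) 1?eq_sym //= subrr mul0r.
Qed.

Lemma eps_neq0 s : eps d s != 0.
Proof.
rewrite /eps; elim/by_chiP: s => j; rewrite !by_chiE.
- by rewrite oppr_eq0 invr_eq0 pnatr_eq0.
- by rewrite oppr_eq0 invr_eq0 pnatr_eq0.
- by rewrite signr_eq0.
Qed.

Section AtPoint.
Variable x : pt.
Hypotheses (nfd : normal_form d) (Wx : nf_W d x).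

Lemma rho_neq s k : s != k -> rho d s x - rho d k x != 0.
Proof. by move=> sk; rewrite subr_eq0 (inj_eq (nf_rho_inj nfd Wx)). Qed.

Lemma rho_rhoc_neq s c : rho d s x - rhoc c != 0.
Proof. by rewrite subr_eq0; apply/eqP; apply: nf_rho_rhoc nfd _ Wx _ _. Qed.

Lemma rhoc_rho_neq s c : rhoc c - rho d s x != 0.
Proof. by rewrite -opprB oppr_eq0 rho_rhoc_neq. Qed.

Lemma Delta_neq0 s : Delta d s x != 0.
Proof. by apply/prodf_neq0 => j js; apply: rho_neq; rewrite eq_sym. Qed.

Lemma muhat_invK : muhat_mx d x *m muhat_inv d x = 1%:M.
Proof.
rewrite mulmxA muhat_power mulmx_diag -[RHS]diag_const_mx; congr diag_mx.
by apply/rowP => s; rewrite !mxE mulfV ?Delta_neq0.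
Qed.

Lemma coframeK : coframe d x *m frame d x = 1%:M.
Proof.
have i1 : muhat_mx d x *m muhat_inv d x = 1%:M := muhat_invK.
have i2 : dchi_mx R l q *m Dchi_mx R l q = 1%:M.
  apply/matrixP => s k; rewrite [RHS]mxE -(dchi_u_Dchi_u R s k) [LHS]mxE [RHS]mxE.
  by apply: eq_bigr => a _; rewrite !mxE.
rewrite /coframe /frame mul_col_row [col_mx _ _ *m row_mx _ _]mul_col_row mul_col_mx mul_mx_row.
have -> : coframe_chi R l q h *m frame_chi R l q h = 1%:M.
  by rewrite !mul_row_col !mul0mx !addr0 i2.
have -> : coframe_chi R l q h *m frame_t d x = 0 by rewrite !mul_row_col !mul0mx !mulmx0 !addr0.
have -> : coframe_chi R l q h *m frame_y d x = 0 by rewrite !mul_row_col !mul0mx !mulmx0 !addr0.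
have -> : coframe_t d x *m frame_chi R l q h = 0.
  by rewrite -mulmxA !mul_row_col !mul0mx !mulmx0 !addr0 mulmx0.
have -> : coframe_t d x *m frame_t d x = 1%:M.
  by rewrite -mulmxA !mul_row_col !mul0mx !mulmx0 !addr0 mul1mx add0r.
have -> : coframe_t d x *m frame_y d x = 0.
  by rewrite -mulmxA !mul_row_col !mul0mx !mul1mx !mulmx1 add0r addNr mulmx0.
have -> : coframe_y R l q h *m frame_chi R l q h = 0 by rewrite !mul_row_col !mul0mx !mulmx0 !addr0.
have -> : coframe_y R l q h *m frame_t d x = 0 by rewrite !mul_row_col !mul0mx !mulmx0 !addr0.
have -> : coframe_y R l q h *m frame_y d x = 1%:M by rewrite !mul_row_col !mul0mx !mulmx1 !add0r.
by rewrite row_mx0 col_mx0 -!scalar_mx_block.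
Qed.

End AtPoint.
End FrameOnW.

(** * Semisimple endomorphisms and intertwined blocks with one eigenvalue *)

Section Semisimple.
Variable K : fieldType.

(** In a basis of eigenvectors [T - a] is diagonal, and over a field a product with the square of an
    entry vanishes only if the product with the entry does. *)
Lemma diagonalizable_ker_sqr n p (T : 'M[K]_n) (a : K) (v : 'M[K]_(p, n)) :
  diagonalizable T -> v *m (T - a%:M) *m (T - a%:M) = 0 -> v *m (T - a%:M) = 0.
Proof.
move=> [P uP /(diagonalizable_forLR uP)[D ->]].
rewrite mxpoly.conjumx ?unitmx_inv // invmxK.
set e := \row_i (D 0 i - a).
have -> : invmx P *m diag_mx D *m P - a%:M = invmx P *m diag_mx e *m P.
  have -> : a%:M = invmx P *m a%:M *m P.
    by rewrite mul_mx_scalar -scalemxAl mulVmx // scalemx1.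
  rewrite -mulmxBl -mulmxBr -diag_const_mx -linearB; congr (_ *m diag_mx _ *m _).
  by apply/rowP => i; rewrite !mxE.
rewrite !mulmxA => vE; set w := v *m invmx P in vE *.
have w2 : w *m diag_mx e *m diag_mx e = 0.
  have := congr1 (mulmx^~ (invmx P)) vE; rewrite /= mul0mx -[_ *m P *m invmx P]mulmxA mulmxV // mulmx1.
  by rewrite -[_ *m P *m invmx P]mulmxA mulmxV // mulmx1.
suff -> : w *m diag_mx e = 0 by rewrite mul0mx.
apply/matrixP => i j; have /matrixP/(_ i j) := w2.
rewrite !mul_mx_diag !mxE => /eqP; rewrite !mulf_eq0 -orbA orbb => /orP[/eqP ->|/eqP ->].
  by rewrite mul0r.
by rewrite mulr0.
Qed.

(** Powers of [M - a] on the left of [W] become powers of [T - a] on its right. Cayley-Hamilton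
    kills a high power, and semisimplicity of [T] lowers the exponent to one. *)
Lemma diagonalizable_single_eigenvalue n p (T : 'M[K]_p) (M : 'M[K]_n) (a : K) (W : 'M[K]_(n, p)) :
  diagonalizable T -> W *m T = M *m W -> char_poly M = ('X - a%:P) ^+ n ->
  M *m W = a *: W.
Proof.
move=> dT; case: n => [|n] in M W *; first by move=> _ _; rewrite [W]flatmx0 mulmx0 scaler0.
move=> WT chM.
pose V k := (M - a%:M) ^+ k *m W.
have VS k : V k.+1 = V k *m (T - a%:M).
  rewrite /V exprSr -[_ * _]/(_ *m _) -!mulmxA; congr (_ *m _).
  by rewrite mulmxBr WT mulmxBl mul_mx_scalar mul_scalar_mx.
have Vn : V n.+1 = 0.
  rewrite /V; have := Cayley_Hamilton M; rewrite chM rmorphXn rmorphB /=.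
  by rewrite horner_mx_X horner_mx_C => ->; rewrite mul0mx.
have V1 : V 1 = 0.
  (* Each application of [diagonalizable_ker_sqr] removes one factor [T - a], as long as two are
     left. *)
  have down k : V k.+1 = 0 -> V 1 = 0.
    elim: k => [//|k IH] Vk; apply: IH.
    by move: Vk; rewrite VS VS => /(diagonalizable_ker_sqr dT); rewrite -VS.
  exact: down Vn.
move: V1; rewrite /V expr1 mulmxBl mul_scalar_mx => /eqP.
by rewrite subr_eq0 => /eqP.
Qed.

Lemma mulmx_sum2 k n1 n2 k' (A : 'M[K]_(k, n1)) (T : 'M[K]_(n1, n2)) (B : 'M[K]_(n2, k')) :
  A *m T *m B = \sum_j \sum_i T j i *: (col j A *m row i B).
Proof.
rewrite {1}[T]matrix_sum_delta mulmx_sumr mulmx_suml; apply: eq_bigr => j _.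
rewrite mulmx_sumr mulmx_suml; apply: eq_bigr => i _.
rewrite -scalemxAr -scalemxAl; congr (_ *: _).
by rewrite rowE colE -(mul_delta_mx (0 : 'I_1)) !mulmxA.
Qed.

End Semisimple.

Section TensorsOnW.
Variables (R : realType) (l q nb : nat) (h : 'I_nb -> nat) (d : nf_data R l q nb h).
Local Notation C := R[i].
Local Notation r := (l + l + q)%N.
Local Notation m c := ((h c).*2).
Local Notation dimS := (\sum_(c < nb) m c)%N.
Local Notation N := (r + r + dimS)%N.
Local Notation pt := 'rV[R]_N.
Local Notation rhoc c := ((nf_rhoc d c)%:C).

Definition rho_row (x : pt) : 'rV[C]_r := \row_s rho d s x.
Definition AS_mx (x : pt) : 'M[C]_dimS := \mxdiag_c AS d (yc c x).

Definition diag3 (a b : 'rV[C]_r) (S : 'M[C]_dimS) : 'M[C]_N :=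
  block_mx (block_mx (diag_mx a) 0 0 (diag_mx b)) 0 0 S.

Variable x : pt.
Hypotheses (nfd : normal_form d) (Wx : nf_W d x).

(** The coefficients form a companion matrix [T] of the polynomial with roots [rho_k]. The recursion
    [muS] says that the rows of [muhat_mx] are its left eigenvectors, with eigenvalues [rho_s]. *)
Lemma frame_t_coframe_t : frame_t d x *m diag_mx (rho_row x) *m coframe_t d x =
  \sum_(i < r) \sum_(j < r)
      (mu d i.+1 x * (j == 0%N :> nat)%:R - (i.+1 == j :> nat)%:R)
        *: (Dt R h j *m theta d i x).
Proof.
pose T : 'M[C]_r := \matrix_(j, i) (mu d i.+1 x * (j == 0%N :> nat)%:R - (i.+1 == j :> nat)%:R).
have rT : diag_mx (rho_row x) *m muhat_mx d x = muhat_mx d x *m T.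
  apply/matrixP => s i; rewrite mul_diag_mx !mxE.
  under eq_bigr do rewrite !mxE mulrBr; rewrite sumrB.
  have r0 : (0 < r)%N := leq_ltn_trans (leq0n i) (ltn_ord i).
  rewrite (bigD1 (Ordinal r0)) //= mulr1 muhat0 mul1r [X in _ + X - _]big1 ?addr0; last first.
    by move=> j j0; rewrite [_ == _](_ : _ = false) ?mulr0 //; apply/negbTE; apply: contraNneq j0 => j0; apply/eqP/val_inj.
  rewrite (muS d s) (_ : \sum_j _ = muhat d s i.+1 x); first by rewrite addrC addKr.
  have [ir|ir] := ltnP i.+1 r.
    rewrite (bigD1 (Ordinal ir)) //= eqxx mulr1 [X in _ + X]big1 ?addr0 // => j ji.
    by rewrite (_ : _ == _ = false) ?mulr0 //; apply/negbTE; apply: contraNneq ji => ji; apply/eqP/val_inj.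
  (* At the last index no column [j < r] equals [i.+1], so the sum is empty; this agrees with
     [muhat_top]. *)
  have -> : i.+1 = r by apply/eqP; rewrite eqn_leq ir ltn_ord.
  rewrite muhat_top; apply: big1 => j _.
  by rewrite gtn_eqF ?mulr0.
have -> : frame_t d x *m diag_mx (rho_row x) *m coframe_t d x =
    col_mx (col_mx 0 1%:M) 0 *m T *m theta_mx d x.
  have -> : frame_t d x = col_mx (col_mx 0 1%:M) 0 *m muhat_inv d x.
    by rewrite !mul_col_mx !mul0mx mul1mx.
  rewrite /coframe_t -!mulmxA; congr (_ *m _).
  have MK := mulmx1C (muhat_invK nfd Wx); rewrite /muhat_inv in MK.
  by rewrite (mulmxA (diag_mx (rho_row x))) rT !mulmxA MK mul1mx.
rewrite mulmx_sum2.
rewrite [LHS]exchange_big.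
apply: eq_bigr => i _.
apply: eq_bigr => j _.
by rewrite row_theta_mx Dt_col !col_col_mx col1 !col0 mxE.
Qed.

Lemma frame_chi_coframe_chi (a : 'rV[C]_r) :
  frame_chi R l q h *m diag_mx a *m coframe_chi R l q h =
  \sum_s a 0 s *: (Dchi R h s *m dchi R h s).
Proof.
rewrite diag_mulmx_sum; apply: eq_bigr => s _.
by rewrite row_coframe_chi col_frame_chi.
Qed.

Lemma frame_y_coframe_y (B : forall c, 'M[C]_(m c)) :
  frame_y d x *m (\mxdiag_c B c) *m coframe_y R l q h =
  \sum_c \sum_a \sum_b
      B c b a *: ((Dy R l q b - \sum_i alpha d i b x *: Dt R h i) *m dy R l q a).
Proof.
rewrite sandwich_sum_delta; apply: eq_bigr => c _.
rewrite [LHS]exchange_big; apply: eq_bigr => a _; apply: eq_bigr => b _.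
by rewrite row_coframe_y col_frame_y.
Qed.

Lemma nf_A_sum : nf_A d x = frame_chi R l q h *m diag_mx (rho_row x) *m coframe_chi R l q h
  + frame_t d x *m diag_mx (rho_row x) *m coframe_t d x
  + frame_y d x *m AS_mx x *m coframe_y R l q h.
Proof.
rewrite frame_t_coframe_t frame_chi_coframe_chi frame_y_coframe_y /nf_A.
by under [X in _ = X + _ + _]eq_bigr do rewrite mxE.
Qed.

Lemma nf_A_frame : nf_A d x = frame d x *m diag3 (rho_row x) (rho_row x) (AS_mx x) *m coframe d x.
Proof. by rewrite nf_A_sum block_diag_sandwich. Qed.

Lemma coframe_y_A : coframe_y R l q h *m nf_A d x = AS_mx x *m coframe_y R l q h.
Proof.
have -> : coframe_y R l q h = dsubmx (coframe d x) by rewrite col_mxKd.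
rewrite mul_dsub_mx nf_A_frame !mulmxA coframeK // mul1mx.
by rewrite /diag3 /coframe mul_block_col !col_mxKd !mul0mx add0r.
Qed.

Hypothesis ssd : semisimple d.

(* The forms [dy] intertwine [A] with the block diagonal matrix of the [A_c], so
   that semisimplicity passes from [A] to each [A_c], which has one eigenvalue. *)
Lemma AS_scalar c : AS d (yc c x) = (rhoc c)%:M.
Proof.
have Sy : nf_S d (yc c x) by case: Wx => _ _; apply.
pose W : 'M[C]_(m c, N) := rowsub (tagnat.Rank c) (coframe_y R l q h).
have WA : W *m nf_A d x = AS d (yc c x) *m W.
  apply/row_matrixP => a; rewrite !row_mul row_rowsub -row_mul coframe_y_A.
  rewrite row_mul mulmx_sum_row [RHS]mulmx_sum_row (sum_tagnat1 (c := c)).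
    by apply: eq_bigr => b _; rewrite row_rowsub [X in X *: _]mxE [in RHS]mxE mxdiag_Rank.
  by move=> c' b c'c; rewrite [X in X *: _]mxE mxdiag_Rank_neq ?scale0r // eq_sym.
have chA : char_poly (AS d (yc c x)) = ('X - (rhoc c)%:P) ^+ m c.
  rewrite /AS /cplx -map_char_poly (nf_S_char nfd Sy) rmorphXn rmorphB /= map_polyX.
  by rewrite map_polyC.
have := diagonalizable_single_eigenvalue (ssd Wx) WA chA.
move=> /(congr1 (mulmx^~ (colsub (tagnat.Rank c) (frame_y d x)))) /=.
have WD : W *m colsub (tagnat.Rank c) (frame_y d x) = 1%:M.
  rewrite mul_rowsub_mx mulmx_colsub !mul_row_col mul0mx mul1mx add0r.
  by apply/matrixP => a b; rewrite !mxE (inj_eq (@tagnat.rank_inj _ _)) eq_Tagged.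
by rewrite -mulmxA -scalemxAl WD mulmx1 scalemx1.
Qed.

End TensorsOnW.

(** * The polynomial sqrt(det(t Id - A)) and the eigenvalues of K_t *)

Section SqrtChar.
Variable R : realType.
Local Notation C := R[i].

(** The list of roots inside [sqrt_char] is known only as some splitting of the characteristic
    polynomial. Without duplicates it is a permutation of the values of [a]: positive exponents make
    each [a e] a root, injectivity makes its multiplicity exactly [(n e).*2]. *)
Lemma sqrt_char_prod k (A : 'M[C]_k) (I : finType) (a : I -> C) (n : I -> nat) :
  injective a -> (forall e, 0 < n e)%N ->
  char_poly A = \prod_e ('X - (a e)%:P) ^+ (n e).*2 ->
  sqrt_char A = \prod_e ('X - (a e)%:P) ^+ n e.
Proof.
move=> ai n0 chA; rewrite /sqrt_char; set s := sval _.
have sE : char_poly A = lead_coef (char_poly A) *: \prod_(z <- s) ('X - z%:P).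
  exact: (svalP (closed_field_poly_normal (char_poly A))).
have mone : lead_coef (char_poly A) = 1 := monicP (char_poly_monic A).
rewrite mone scale1r in sE.
have mupE e : mup (a e) (char_poly A) = (n e).*2.
  rewrite chA (bigD1 e) //= mupMl; first by rewrite mup_XsubCX eqxx.
  rewrite rootE horner_prod prodf_seq_neq0; apply/allP => e' _; apply/implyP => e'e.
  by rewrite horner_exp hornerXsubC expf_neq0 // subr_eq0 (inj_eq ai) eq_sym.
have ps : perm_eq (undup s) [seq a e | e <- enum I].
  apply: uniq_perm; rewrite ?undup_uniq ?(map_inj_uniq ai) ?enum_uniq // => z.
  rewrite mem_undup; have -> : (z \in s) = root (char_poly A) z by rewrite sE root_prod_XsubC.
  rewrite chA rootE horner_prod; apply/idP/mapP => [|[e _ ->]].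
    rewrite prodf_seq_eq0 => /hasP[e _ /=]; rewrite horner_exp hornerXsubC expf_eq0 => /andP[_].
    by rewrite subr_eq0 => /eqP ->; exists e; rewrite ?mem_enum.
  rewrite (bigD1 e) //= horner_exp hornerXsubC subrr expr0n double_eq0 gtn_eqF ?n0 //.
  by rewrite mul0r.
rewrite (perm_big _ ps) big_map big_enum /=; apply: eq_bigr => e _.
by rewrite mupE doubleK.
Qed.

Lemma char_poly_similar n (E F L : 'M[C]_n) : E *m F = 1%:M ->
  char_poly (F *m L *m E) = char_poly L.
Proof.
move=> EF; have FE := mulmx1C EF; rewrite /char_poly /char_poly_mx.
have FE' : map_mx polyC F *m map_mx polyC E = 1%:M by rewrite -map_mxM FE map_mx1.
have -> : 'X%:M - map_mx polyC (F *m L *m E) =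
    map_mx polyC F *m ('X%:M - map_mx polyC L) *m map_mx polyC E.
  rewrite mulmxBr mulmxBl !map_mxM mul_mx_scalar -scalemxAl FE'.
  by rewrite scalemx1.
by rewrite !det_mulmx mulrAC -det_mulmx FE' det1 mul1r.
Qed.

Lemma char_poly_diag n (D : 'rV[C]_n) : char_poly (diag_mx D) = \prod_i ('X - (D 0 i)%:P).
Proof.
rewrite char_poly_trig; last exact: diag_mx_is_trig.
by apply: eq_bigr => i _; rewrite mxE eqxx mulr1n.
Qed.

End SqrtChar.

Section Spectrum.
Variables (R : realType) (l q nb : nat) (h : 'I_nb -> nat) (d : nf_data R l q nb h).
Local Notation C := R[i].
Local Notation r := (l + l + q)%N.
Local Notation m c := ((h c).*2).
Local Notation dimS := (\sum_(c < nb) m c)%N.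
Local Notation N := (r + r + dimS)%N.
Local Notation pt := 'rV[R]_N.
Local Notation rhoc c := ((nf_rhoc d c)%:C).

(** The label of the eigenvalue of [A] on the frame vector [I]; the vectors dual to [dchi_s] and
    [eta_s] share [rho_s], whence its multiplicity 2. *)
Definition eindex (I : 'I_N) : 'I_r + 'I_nb :=
  match fintype.split I with
  | inl J => match fintype.split J with inl s => inl s | inr s => inl s end
  | inr j => inr (tagnat.sig1 j)
  end.

(* The eigenvalue of [K_t] on the eigenspace of [A] for [ev d e x]. *)
Definition cofactor_eval (e : 'I_r + 'I_nb) (x : pt) (t : C) : C :=
  (\prod_(e' | e' != e) (t - ev d e' x) ^+ hmult h e') * (t - ev d e x) ^+ (hmult h e - 1).

Definition cofactor_row (x : pt) (t : C) : 'rV[C]_N := \row_I cofactor_eval (eindex I) x t.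
Definition ev_row (x : pt) : 'rV[C]_N := \row_I ev d (eindex I) x.

Lemma prod_index (A : comPzSemiRingType) (F : 'I_r + 'I_nb -> A) :
  \prod_(I < N) F (eindex I) = \prod_e F e ^+ (hmult h e).*2.
Proof.
rewrite big_sumType /= big_split_ord big_split_ord /=.
congr (_ * _).
  rewrite -big_split /=; apply: eq_bigr => s _.
  by rewrite /eindex !(unsplitK (inl _)) (unsplitK (inr _)) expr2.
transitivity (\prod_c \prod_(b < m c) F (eindex (rshift (r + r) (tagnat.Rank c b)))).
  rewrite sig_big_dep /= [LHS](reindex (@tagnat.rank _ (fun c => m c))) /=.
    by apply: eq_bigr => -[c b] _; rewrite tagnat.rankE.
  exact/onW_bij/tagnat.rank_bij.
apply: eq_bigr => c _.
transitivity (\prod_(b < m c) F (inr c)); last by rewrite prodr_const card_ord.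
by apply: eq_bigr => b _; rewrite /eindex (unsplitK (inr _)) tagnat.Rank1K.
Qed.

Section AtPoint.
Variable x : pt.
Hypotheses (nfd : normal_form d) (Wx : nf_W d x).

Lemma ev_inj : injective (fun e => ev d e x).
Proof.
move=> [s|c] [s'|c'] /=.
- by move=> /(nf_rho_inj nfd Wx) ->.
- by move=> /(nf_rho_rhoc nfd Wx).
- by move=> /esym /(nf_rho_rhoc nfd Wx).
- by move=> /complexI /(nf_rhoc_inj nfd) ->.
Qed.

Lemma hmult_gt0 (e : 'I_r + 'I_nb) : (0 < hmult h e)%N.
Proof. by case: e => //= c; apply: nf_h_gt0 nfd c. Qed.

Lemma ev_neq e e' : e != e' -> ev d e x - ev d e' x != 0.
Proof. by move=> ne; rewrite subr_eq0 (inj_eq ev_inj). Qed.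

Hypothesis ssd : semisimple d.

Lemma diag3_ev : diag3 (rho_row d x) (rho_row d x) (AS_mx d x) = diag_mx (ev_row x).
Proof.
have -> : AS_mx d x = diag_mx (\row_j rhoc (tagnat.sig1 j)).
  rewrite /AS_mx; under eq_mxdiag do rewrite AS_scalar // -diag_const_mx.
  rewrite -diag_mxrow; congr diag_mx; apply/rowP => j; rewrite !mxE.
  by [].
rewrite /diag3 -!diag_mx_row; congr diag_mx.
apply/rowP => I; rewrite !mxE /eindex; case: splitP => J _; rewrite ?mxE //.
by case: splitP => s _; rewrite ?mxE.
Qed.

Lemma nf_A_diag : nf_A d x = frame d x *m diag_mx (ev_row x) *m coframe d x.
Proof. by rewrite nf_A_frame // diag3_ev. Qed.

Lemma sqrt_charE : sqrt_char (nf_A d x) = \prod_e ('X - (ev d e x)%:P) ^+ hmult h e.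
Proof.
apply: sqrt_char_prod; [exact: ev_inj|exact: hmult_gt0|].
rewrite nf_A_diag char_poly_similar ?coframeK // char_poly_diag -prod_index.
by apply: eq_bigr => I _; rewrite mxE.
Qed.

(** By [K_mxP] it suffices to give polynomial entries that are correct where [t - A] is invertible.
    The explicit [P] then also yields the value at eigenvalues of [A]. *)
Lemma K_mx_frame (t : C) :
  K_mx (nf_A d x) t = frame d x *m diag_mx (cofactor_row x t) *m coframe d x.
Proof.
pose pp (e : 'I_r + 'I_nb) : {poly C} :=
  (\prod_(e' | e' != e) ('X - (ev d e' x)%:P) ^+ hmult h e') * ('X - (ev d e x)%:P) ^+ (hmult h e - 1).
have ppE e s : (pp e).[s] = cofactor_eval e x s.
  rewrite hornerM horner_prod horner_exp hornerXsubC; congr (_ * _).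
  by apply: eq_bigr => e' _; rewrite horner_exp hornerXsubC.
pose P i j : {poly C} := \sum_I (frame d x i I * coframe d x I j)%:P * pp (eindex I).
have PE s : \matrix_(i, j) (P i j).[s] = frame d x *m diag_mx (cofactor_row x s) *m coframe d x.
  apply/matrixP => i j; rewrite !mxE horner_sum; apply: eq_bigr => I _.
  by rewrite hornerM hornerC ppE mul_mx_diag !mxE mulrAC.
rewrite (K_mxP (P := P)) => [|s ds]; first exact: PE.
rewrite PE.
have sA : s%:M - nf_A d x = frame d x *m diag_mx (\row_I (s - ev d (eindex I) x)) *m coframe d x.
  rewrite nf_A_diag.
  have {1}-> : s%:M = frame d x *m s%:M *m coframe d x.
    by rewrite mul_mx_scalar -scalemxAl (mulmx1C (coframeK nfd Wx)) scalemx1.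
  rewrite -mulmxBl -mulmxBr -diag_const_mx -linearB; congr (_ *m diag_mx _ *m _).
  by apply/rowP => I; rewrite !mxE.
have ne I : s - ev d (eindex I) x != 0.
  move: ds; rewrite sA !det_mulmx det_diag !mulf_eq0 !negb_or => /andP[/andP[_ /prodf_neq0/(_ I isT)]].
  by rewrite mxE.
have -> : invmx (s%:M - nf_A d x) =
    frame d x *m diag_mx (\row_I (s - ev d (eindex I) x)^-1) *m coframe d x.
  apply: invmx_unique; rewrite sA -!mulmxA (mulmxA (coframe d x)) coframeK // mul1mx.
  rewrite (mulmxA (diag_mx _)) mulmx_diag (_ : \row_ _ _ = const_mx 1); last first.
    by apply/rowP => I; rewrite !mxE mulfV.
  by rewrite diag_const_mx mul1mx (mulmx1C (coframeK nfd Wx)).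
rewrite scalemxAl scalemxAr -linearZ; congr (_ *m diag_mx _ *m _).
apply/rowP => I; rewrite !mxE sqrt_charE horner_prod (bigD1 (eindex I)) //=.
rewrite /cofactor_eval horner_exp hornerXsubC [RHS]mulrAC [RHS]mulrC; congr (_ * _).
  by apply: eq_bigr => e' _; rewrite horner_exp hornerXsubC.
(* The inverse cancels exactly one factor [t - ev], available because the half multiplicity is
   positive. *)
by rewrite -[in RHS](subnK (hmult_gt0 (eindex I))) addn1 exprSr mulfK.
Qed.

End AtPoint.
End Spectrum.

(** * Metric and volume form *)

Section Metric.
Variables (R : realType) (l q nb : nat) (h : 'I_nb -> nat) (d : nf_data R l q nb h).
Local Notation C := R[i].
Local Notation r := (l + l + q)%N.
Local Notation m c := ((h c).*2).
Local Notation dimS := (\sum_(c < nb) m c)%N.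
Local Notation N := (r + r + dimS)%N.
Local Notation pt := 'rV[R]_N.
Local Notation rhoc c := ((nf_rhoc d c)%:C).

Lemma scale_sum_exchange (K : pzRingType) (V : lmodType K) (I J : finType) (a : I -> K) (f : I -> J -> V) :
  \sum_i a i *: \sum_j f i j = \sum_j \sum_i a i *: f i j.
Proof. by under eq_bigr do rewrite scaler_sumr; rewrite exchange_big. Qed.

(** Unlike in [ddir_prod], factors may vanish; this is needed for products of eigenvalues and of
    differences [t - rho_k] with arbitrary [t]. *)
Lemma ddir_prod0 k (v : 'cV[C]_k) (I : Type) (s : seq I) (P : pred I) (H : I -> 'rV[R]_k -> C) x :
  (forall i, P i -> cdiff (H i) x) -> (forall i, P i -> ddir v (H i) x = 0) ->
  ddir v (fun y => \prod_(i <- s | P i) H i y) x = 0.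
Proof.
move=> h1 h0; elim: s => [|i s IH].
  by under eq_fun do rewrite big_nil; apply: ddir_cst.
under eq_fun do rewrite big_cons; case Pi: (P i) => //.
by rewrite ddirM ?IH ?h0 ?mul0r ?mulr0 ?addr0 //; [exact: h1|exact: cdiff_prod].
Qed.

Definition Pc c (x : pt) : C := \prod_k (rhoc c - rho d k x).
Definition a_row (x : pt) : 'rV[C]_r := \row_s (eps d s * Delta d s x).
Definition b_row (x : pt) : 'rV[C]_r := \row_s (rho' d s x ^+ 2 / (eps d s * Delta d s x)).
Definition gS_mx (x : pt) : 'M[C]_dimS := \mxdiag_c (Pc c x *: gS d (yc c x)).
Definition gram x := diag3 (a_row x) (b_row x) (gS_mx x).
Definition rho'_row (x : pt) : 'rV[C]_r := \row_s rho' d s x.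
(** The Kähler form in the coframe: it pairs [dchi_s] with [eta_s] with weight [rho'_s], and no
    [Delta_s] occurs. *)
Definition omega_gram (x : pt) : 'M[C]_N :=
  block_mx (block_mx 0 (diag_mx (rho'_row x)) (- diag_mx (rho'_row x)) 0) 0 0
           (\mxdiag_c (Pc c x *: omegaS d (yc c x))).

Lemma rho_cdiff k x : normal_form d -> nf_W d x -> cdiff (rho d k) x.
Proof.
move=> nfd [Uu _ _]; rewrite rho_funE; apply: cdiff_u.
exact: smooth_cdiff0 (rho_u_smooth nfd k) Uu.
Qed.

Lemma rho'_funE k : rho' d k = (fun y : pt => rho'_u d k (u_part y)).
Proof. by apply/funext => y; rewrite rho'E. Qed.

Lemma rho'_cdiff k x : normal_form d -> nf_W d x -> cdiff (rho' d k) x.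
Proof. by move=> nfd [Uu _ _]; rewrite rho'_funE; apply/cdiff_u/rho'_u_cdiff. Qed.

Lemma ddir_rho_chi s k x : normal_form d -> nf_W d x ->
  ddir (Dchi R h s) (rho d k) x = (s == k)%:R * rho' d k x.
Proof.
move=> nfd [Uu _ _]; case: (altP (s =P k)) => [->|sk]; first by rewrite mul1r.
by rewrite mul0r Dchi_col rho_funE ddir_u rho_u_indep.
Qed.

Lemma ddir_rho'_chi s k x : normal_form d -> nf_W d x -> s != k ->
  ddir (Dchi R h s) (rho' d k) x = 0.
Proof. by move=> nfd [Uu _ _] sk; rewrite Dchi_col rho'_funE ddir_u rho'_u_indep. Qed.

Lemma ddir_u0 (F : 'rV[R]_r -> C) v2 v3 (x : pt) :
  ddir (col_mx (col_mx 0 v2) v3) (fun y : pt => F (u_part y)) x = 0.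
Proof. by rewrite ddir_u /ddir big1 // => a _; rewrite mxE mul0r. Qed.

Lemma ddir_s0 (F : 'rV[R]_dimS -> C) v1 v2 (x : pt) :
  ddir (col_mx (col_mx v1 v2) 0) (fun y : pt => F (s_part y)) x = 0.
Proof. by rewrite ddir_s /ddir big1 // => a _; rewrite mxE mul0r. Qed.

Lemma dfun_mul k n (F : 'rV[R]_k -> C) x (A : 'M[C]_(k, n)) i :
  (dfun F x *m A) 0 i = ddir (col i A) F x.
Proof. by rewrite mxE; apply: eq_bigr => a _; rewrite !mxE mulrC. Qed.

Lemma dfun_mul_row k n (F : 'rV[R]_k -> C) x (A : 'M[C]_(k, n)) :
  dfun F x *m A = \row_i ddir (col i A) F x.
Proof. by apply/rowP => i; rewrite dfun_mul mxE. Qed.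

Lemma muhat_cdiff s i x : normal_form d -> nf_W d x -> cdiff (muhat d s i) x.
Proof.
move=> nfd Wx; apply: cdiff_sum => B _; apply: cdiff_prod => k _.
exact: rho_cdiff.
Qed.

(** [muhat d s] omits [rho_s], the only eigenvalue that varies along [chi_s]. *)
Lemma ddir_muhat_chi s i x : normal_form d -> nf_W d x ->
  ddir (Dchi R h s) (muhat d s i) x = 0.
Proof.
move=> nfd Wx; rewrite ddir_sum; last first.
  by move=> B _; apply: cdiff_prod => k _; apply: rho_cdiff.
apply: big1 => B /andP[/fintype.subsetP BA _]; apply: ddir_prod0 => k kB; first exact: rho_cdiff.
rewrite ddir_rho_chi // (_ : s == k = false) ?mul0r //.
by have := BA k kB; rewrite !inE eq_sym => /negbTE.
Qed.

(** In the recursion [muS] the factor [rho_s] carries all the dependence on [chi_s]. *)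
Lemma ddir_mu_chi s i x : normal_form d -> nf_W d x ->
  ddir (Dchi R h s) (mu d i.+1) x = rho' d s x * muhat d s i x.
Proof.
move=> nfd Wx.
have -> : mu d i.+1 = (fun y => muhat d s i.+1 y + rho d s y * muhat d s i y).
  by apply/funext => y; rewrite (muS d s).
have cm := muhat_cdiff s i nfd Wx; have cr := rho_cdiff s nfd Wx.
rewrite ddirD ?ddirM //; [|exact: muhat_cdiff|exact: cdiffM].
by rewrite !ddir_muhat_chi // ddir_rho_chi // eqxx mul1r mulr0 addr0 add0r.
Qed.

Definition mu_u i (u : 'rV[R]_r) : C := Defs.esym [set: 'I_r]%SET (fun k => rho_u d k u) i.

Lemma mu_funE i : mu d i = (fun y : pt => mu_u i (u_part y)).
Proof. by apply/funext => y; apply: eq_elsym => k _; rewrite rhoE. Qed.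

Section AtPoint.
Variable x : pt.
Hypotheses (nfd : normal_form d) (Wx : nf_W d x).

Lemma dfun_frame (F : pt -> C) : dfun F x =
  (\row_s ddir (Dchi R h s) F x) *m coframe_chi R l q h
  + (\row_s ddir (col s (frame_t d x)) F x) *m coframe_t d x
  + (\row_j ddir (col j (frame_y d x)) F x) *m coframe_y R l q h.
Proof.
rewrite -[LHS]mulmx1 -(mulmx1C (coframeK nfd Wx)) /frame /coframe !mul_row_col !mulmxDr.
rewrite (mulmxA _ (frame_chi R l q h)) (mulmxA _ (frame_t d x)) (mulmxA _ (frame_y d x)) !dfun_mul_row.
rewrite (_ : \row_s ddir (Dchi R h s) F x = \row_s ddir (col s (frame_chi R l q h)) F x) //.
by apply/rowP => s; rewrite !mxE col_frame_chi.
Qed.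

Lemma dfun_u (F : 'rV[R]_r -> C) : dfun (fun y : pt => F (u_part y)) x =
  (\row_s ddir (Dchi R h s) (fun y : pt => F (u_part y)) x) *m coframe_chi R l q h.
Proof.
rewrite dfun_frame (_ : \row_ _ _ *m coframe_t d x = 0) ?addr0; last first.
  rewrite (_ : \row_ _ _ = 0) ?mul0mx //; apply/rowP => s.
  by rewrite !mxE !col_col_mx col0 ddir_u0.
rewrite (_ : \row_ _ _ *m coframe_y R l q h = 0) ?addr0 //.
rewrite (_ : \row_ _ _ = 0) ?mul0mx //; apply/rowP => s.
by rewrite !mxE !col_col_mx col0 ddir_u0.
Qed.

Lemma dfun_mu i : dfun (mu d i.+1) x =
  (\row_s (rho' d s x * muhat d s i x)) *m coframe_chi R l q h.
Proof.
rewrite mu_funE dfun_u -mu_funE; congr (_ *m _); apply/rowP => s.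
by rewrite !mxE -ddir_mu_chi.
Qed.

Hypothesis ssd : semisimple d.

(** Since [A_c] is scalar, Vieta's formula [mu_sum] collapses the matrix polynomial to the function
    [Pc]. Leaving [B] free covers the metric and the Kähler form at once. *)
Lemma pullback_poly (B : forall c, 'M[C]_(m c)) :
  \sum_(i < r.+1) ((-1) ^+ i * mu d i x) *:
     \sum_(c < nb) pullback l q ((AS d (yc c x) ^+ (r - i))^T *m B c)
  = (coframe_y R l q h)^T *m (\mxdiag_c (Pc c x *: B c)) *m coframe_y R l q h.
Proof.
have pZ c (w : C) (D : 'M[C]_(m c)) : pullback l q (w *: D) = w *: pullback l q D.
  rewrite /pullback scaler_sumr; apply: eq_bigr => a _; rewrite scaler_sumr.
  by apply: eq_bigr => b _; rewrite mxE scalerA.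
rewrite sandwich_sum_delta.
transitivity (\sum_c pullback l q (Pc c x *: B c)); last first.
  apply: eq_bigr => c _; apply: eq_bigr => a _; apply: eq_bigr => b _.
  by rewrite -tr_row !row_coframe_y.
rewrite scale_sum_exchange; apply: eq_bigr => c _.
rewrite pZ /Pc -mu_sum scaler_suml; apply: eq_bigr => i _.
rewrite AS_scalar // (_ : _ ^+ _ = (rhoc c ^+ (r - i))%:M).
  by rewrite tr_scalar_mx mul_scalar_mx pZ scalerA.
elim: (r - i)%N => [|n IH]; first by rewrite !expr0.
by rewrite !exprS IH -[_ * _]/(_ *m _) -scalar_mxM.
Qed.

Lemma chi_gram (a : 'rV[C]_r) :
  (coframe_chi R l q h)^T *m diag_mx a *m coframe_chi R l q h =
  \sum_s a 0 s *: tensor (dchi R h s) (dchi R h s).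
Proof.
rewrite diag_mulmx_sum; apply: eq_bigr => s _.
by rewrite -tr_row row_coframe_chi.
Qed.

Lemma t_gram (b : 'rV[C]_r) :
  (coframe_t d x)^T *m diag_mx b *m coframe_t d x =
  \sum_(i < r) \sum_(j < r) (\sum_s muhat d s i x * muhat d s j x * b 0 s)
    *: tensor (theta d i x) (theta d j x).
Proof.
have -> : (coframe_t d x)^T *m diag_mx b *m coframe_t d x =
    (theta_mx d x)^T *m ((muhat_mx d x)^T *m diag_mx b *m muhat_mx d x) *m theta_mx d x.
  by rewrite /coframe_t trmx_mul !mulmxA.
rewrite mulmx_sum2; apply: eq_bigr => i _; apply: eq_bigr => j _.
rewrite -tr_row !row_theta_mx; congr (_ *: _).
rewrite diag_mulmx_sum summxE; apply: eq_bigr => s _.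
by rewrite !mxE big_ord1 !mxE mulrC.
Qed.

Lemma nf_gE : nf_g d x = (coframe d x)^T *m gram x *m coframe d x.
Proof.
rewrite /coframe /gram /diag3 !tr_col_mx block_diag_sandwich /nf_g pullback_poly addrAC.
rewrite chi_gram t_gram; under [X in _ = X + _ + _]eq_bigr do rewrite mxE.
rewrite (_ : \sum_(i < r) _ = \sum_(i < r) \sum_(j < r)
  (\sum_s muhat d s i x * muhat d s j x * b_row x 0 s)
    *: tensor (theta d i x) (theta d j x)) //.
apply: eq_bigr => i _; apply: eq_bigr => j _; congr (_ *: _); apply: eq_bigr => s _.
by rewrite [b_row _ _ _]mxE mulrAC mulrA.
Qed.

End AtPoint.
End Metric.

(** * Derivatives of block matrices *)

Section BlockCalculus.
Variables (R : realType) (k : nat).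
Local Notation C := R[i].
Local Notation pt := 'rV[R]_k.

Lemma cdiff_ext (F G : pt -> C) x : F =1 G -> cdiff G x -> cdiff F x.
Proof. by move=> /funext ->. Qed.

Lemma ddir_ext v (F G : pt -> C) x : F =1 G -> ddir v F x = ddir v G x.
Proof. by move=> /funext ->. Qed.

Lemma cdiff_mx_col m1 m2 n (A : pt -> 'M[C]_(m1, n)) (B : pt -> 'M[C]_(m2, n)) x :
  cdiff_mx A x -> cdiff_mx B x -> cdiff_mx (fun y => col_mx (A y) (B y)) x.
Proof.
move=> dA dB i j; rewrite -(splitK i); case: (fintype.split i) => i' /=.
  by under eq_fun do rewrite col_mxEu; apply: dA.
by under eq_fun do rewrite col_mxEd; apply: dB.
Qed.

Lemma cdiff_mx_row m n1 n2 (A : pt -> 'M[C]_(m, n1)) (B : pt -> 'M[C]_(m, n2)) x :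
  cdiff_mx A x -> cdiff_mx B x -> cdiff_mx (fun y => row_mx (A y) (B y)) x.
Proof.
move=> dA dB i j; rewrite -(splitK j); case: (fintype.split j) => j' /=.
  by under eq_fun do rewrite row_mxEl; apply: dA.
by under eq_fun do rewrite row_mxEr; apply: dB.
Qed.

Lemma dmx_col v m1 m2 n (A : pt -> 'M[C]_(m1, n)) (B : pt -> 'M[C]_(m2, n)) x :
  dmx v (fun y => col_mx (A y) (B y)) x = col_mx (dmx v A x) (dmx v B x).
Proof.
apply/matrixP => i j; rewrite -(splitK i); case: (fintype.split i) => i' /=.
  by rewrite col_mxEu !mxE; under eq_fun do rewrite col_mxEu.
by rewrite col_mxEd !mxE; under eq_fun do rewrite col_mxEd.
Qed.

Lemma dmx_row v m n1 n2 (A : pt -> 'M[C]_(m, n1)) (B : pt -> 'M[C]_(m, n2)) x :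
  dmx v (fun y => row_mx (A y) (B y)) x = row_mx (dmx v A x) (dmx v B x).
Proof.
apply/matrixP => i j; rewrite -(splitK j); case: (fintype.split j) => j' /=.
  by rewrite row_mxEl !mxE; under eq_fun do rewrite row_mxEl.
by rewrite row_mxEr !mxE; under eq_fun do rewrite row_mxEr.
Qed.

Lemma cdiff_mx_cst m n (A : 'M[C]_(m, n)) x : cdiff_mx (fun _ : pt => A) x.
Proof. by move=> i j; apply: cdiff_cst. Qed.

Lemma dmx_cst v m n (A : 'M[C]_(m, n)) x : dmx v (fun _ : pt => A) x = 0.
Proof. by apply/matrixP => i j; rewrite !mxE ddir_cst. Qed.

Lemma cdiff_mx_diag n (D : pt -> 'rV[C]_n) x : cdiff_mx D x ->
  cdiff_mx (fun y => diag_mx (D y)) x.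
Proof.
move=> dD i j; under eq_fun do rewrite mxE; case: eqP => _.
  by under eq_fun do rewrite mulr1n; apply: dD.
by under eq_fun do rewrite mulr0n; apply: cdiff_cst.
Qed.

Lemma dmx_diag v n (D : pt -> 'rV[C]_n) x :
  dmx v (fun y => diag_mx (D y)) x = diag_mx (dmx v D x).
Proof.
apply/matrixP => i j; rewrite !mxE; under eq_fun do rewrite mxE; case: eqP => _.
  by rewrite mulr1n; under eq_fun do rewrite mulr1n.
by rewrite mulr0n; under eq_fun do rewrite mulr0n; rewrite ddir_cst.
Qed.

Lemma Rank_ind nb (p : 'I_nb -> nat) (P : 'I_(\sum_c p c) -> Prop) :
  (forall c b, P (tagnat.Rank c b)) -> forall j, P j.
Proof. by move=> h j; rewrite -[j]tagnat.sig2K. Qed.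

Lemma cdiff_mx_mxdiag nb (p : 'I_nb -> nat) (B : forall c, pt -> 'M[C]_(p c)) x :
  (forall c, cdiff_mx (B c) x) -> cdiff_mx (fun y => \mxdiag_c B c y) x.
Proof.
move=> dB i j; elim/Rank_ind: i => c a; elim/Rank_ind: j => c' b.
have [e|ne] := eqVneq c c'; last first.
  by under eq_fun do rewrite mxdiag_Rank_neq //; apply: cdiff_cst.
by subst c'; under eq_fun do rewrite mxdiag_Rank; apply: dB.
Qed.

Lemma dmx_mxdiag v nb (p : 'I_nb -> nat) (B : forall c, pt -> 'M[C]_(p c)) x :
  dmx v (fun y => \mxdiag_c B c y) x = \mxdiag_c dmx v (B c) x.
Proof.
apply/matrixP => i j; elim/Rank_ind: i => c a; elim/Rank_ind: j => c' b.
rewrite mxE; have [e|ne] := eqVneq c c'; last first.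
  by rewrite mxdiag_Rank_neq //; under eq_fun do rewrite mxdiag_Rank_neq //; apply: ddir_cst.
by subst c'; rewrite mxdiag_Rank mxE; under eq_fun do rewrite mxdiag_Rank.
Qed.

Lemma dmx_scale v m n (f : pt -> C) (A : pt -> 'M[C]_(m, n)) x : cdiff f x -> cdiff_mx A x ->
  dmx v (fun y => f y *: A y) x = ddir v f x *: A x + f x *: dmx v A x.
Proof.
move=> df dA; apply/matrixP => i j; rewrite !mxE; under eq_fun do rewrite mxE.
by rewrite ddirM.
Qed.

Lemma cdiff_mx_scale m n (f : pt -> C) (A : pt -> 'M[C]_(m, n)) x : cdiff f x -> cdiff_mx A x ->
  cdiff_mx (fun y => f y *: A y) x.
Proof. by move=> df dA i j; under eq_fun do rewrite mxE; apply: cdiffM. Qed.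

End BlockCalculus.

Section GramCalculus.
Variables (R : realType) (l q nb : nat) (h : 'I_nb -> nat) (d : nf_data R l q nb h).
Local Notation C := R[i].
Local Notation r := (l + l + q)%N.
Local Notation m c := ((h c).*2).
Local Notation dimS := (\sum_(c < nb) m c)%N.
Local Notation N := (r + r + dimS)%N.
Local Notation pt := 'rV[R]_N.
Local Notation rhoc c := ((nf_rhoc d c)%:C).

Lemma mxdiag_mul (K : pzSemiRingType) (A B : forall c : 'I_nb, 'M[K]_(m c)) :
  (\mxdiag_c A c) *m (\mxdiag_c B c) = \mxdiag_c (A c *m B c).
Proof.
rewrite [X in _ *m X]/mxdiag mul_mxdiag_mxblock; apply/eq_mxblock => i j.
by case: eqVneq => [e|]; rewrite ?mulmx0 //; subst j; rewrite !conform_mx_id.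
Qed.

Lemma diag3_mul (a b a' b' : 'rV[C]_r) (S S' : 'M[C]_dimS) :
  diag3 a b S *m diag3 a' b' S' =
  diag3 (\row_s (a 0 s * a' 0 s)) (\row_s (b 0 s * b' 0 s)) (S *m S').
Proof.
rewrite /diag3 mulmx_block [block_mx (diag_mx a) _ _ _ *m block_mx _ _ _ _]mulmx_block.
by rewrite !mulmx_diag !mul0mx !mulmx0 !addr0 !add0r.
Qed.

Lemma diag3_1 : diag3 (const_mx 1) (const_mx 1) 1%:M = 1%:M :> 'M[C]_N.
Proof. by rewrite /diag3 !diag_const_mx -!scalar_mx_block. Qed.

Lemma diag3_tr (a b : 'rV[C]_r) (S : 'M[C]_dimS) : (diag3 a b S)^T = diag3 a b S^T.
Proof. by rewrite /diag3 !tr_block_mx !trmx0 !tr_diag_mx. Qed.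

Lemma mxtrace_diag3 (a b : 'rV[C]_r) (S : 'M[C]_dimS) :
  \tr (diag3 a b S) = \sum_s a 0 s + \sum_s b 0 s + \tr S.
Proof. by rewrite /diag3 !mxtrace_block !mxtrace_diag. Qed.

Definition gram_inv (x : pt) : 'M[C]_N :=
  diag3 (\row_s (a_row d x 0 s)^-1) (\row_s (b_row d x 0 s)^-1)
        (\mxdiag_c ((Pc d c x)^-1 *: invmx (gS d (yc c x)))).

Section AtPoint.
Variable x : pt.
Hypotheses (nfd : normal_form d) (Wx : nf_W d x).

Lemma yc_in c : nf_S d (yc c x).
Proof. by case: Wx => _ _; apply. Qed.

Lemma gS_unit c : gS d (yc c x) \in unitmx.
Proof. exact: kahler_g_nondeg (nf_S_kahler nfd c) _ (yc_in c). Qed.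

Lemma gS_sym c : (gS d (yc c x))^T = gS d (yc c x).
Proof. exact: kahler_g_sym (nf_S_kahler nfd c) _ (yc_in c). Qed.

Lemma Pc_neq0 c : Pc d c x != 0.
Proof. by apply/prodf_neq0 => k _; apply: rhoc_rho_neq. Qed.

Lemma a_neq0 s : a_row d x 0 s != 0.
Proof. by rewrite mxE mulf_neq0 ?eps_neq0 ?Delta_neq0. Qed.

Lemma b_neq0 s : b_row d x 0 s != 0.
Proof. by rewrite mxE mulf_neq0 ?invr_eq0 ?mulf_neq0 ?eps_neq0 ?Delta_neq0 ?expf_neq0 ?rho'_neq0. Qed.

Lemma gramK : gram d x *m gram_inv x = 1%:M.
Proof.
rewrite /gram /gram_inv diag3_mul mxdiag_mul -diag3_1; congr diag3.
- by apply/rowP => s; rewrite [RHS]mxE mxE [X in _ * X]mxE mulfV ?a_neq0.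
- by apply/rowP => s; rewrite [RHS]mxE mxE [X in _ * X]mxE mulfV ?b_neq0.
rewrite -(mxdiagZ (p_ := fun c => m c)); apply: eq_mxdiag => c.
by rewrite -scalemxAl -scalemxAr scalerA mulfV ?Pc_neq0 // scale1r mulmxV ?gS_unit.
Qed.

Lemma gram_tr : (gram d x)^T = gram d x.
Proof.
rewrite /gram diag3_tr /gS_mx tr_mxdiag; congr diag3; apply: eq_mxdiag => c.
by rewrite linearZ /= gS_sym.
Qed.

Lemma gram_unit : gram d x \in unitmx.
Proof. by have [u _] := mulmx1_unit gramK; exact: u. Qed.

Lemma gram_invE : invmx (gram d x) = gram_inv x.
Proof. exact: invmx_unique gramK. Qed.

Hypothesis ssd : semisimple d.

Lemma nf_g_tr : (nf_g d x)^T = nf_g d x.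
Proof. by rewrite nf_gE // !trmx_mul trmxK gram_tr mulmxA. Qed.

Lemma nf_g_inv : invmx (nf_g d x) = frame d x *m gram_inv x *m (frame d x)^T.
Proof.
by rewrite nf_gE //; exact: invmx_congruent (coframeK nfd Wx) gramK.
Qed.

End AtPoint.
End GramCalculus.

(** * Logarithmic derivative of the volume density *)

Section VolumeForm.
Variables (R : realType) (l q nb : nat) (h : 'I_nb -> nat) (d : nf_data R l q nb h).
Local Notation C := R[i].
Local Notation r := (l + l + q)%N.
Local Notation m c := ((h c).*2).
Local Notation dimS := (\sum_(c < nb) m c)%N.
Local Notation N := (r + r + dimS)%N.
Local Notation pt := 'rV[R]_N.
Local Notation rhoc c := ((nf_rhoc d c)%:C).
Hypotheses (nfd : normal_form d).

(** Half the logarithmic derivative of [a b = p^2] is that of [p]. It is applied to the two metric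
    coefficients of index [s], where [p] is [rho'_s]. *)
Lemma half_log_sum (a b p a' b' p' : C) : a != 0 -> b != 0 -> p != 0 ->
  a * b = p ^+ 2 -> p' * p + p * p' = a' * b + a * b' ->
  2^-1 * (a^-1 * a' + b^-1 * b') = p' / p.
Proof.
move=> a0 b0 p0 abp E.
have -> : a^-1 * a' + b^-1 * b' = (a' * b + a * b') / (a * b).
  by field; apply/andP.
by rewrite -E abp; field.
Qed.

Lemma SS_open : open (nf_SS d).
Proof.
rewrite openE => y Sy.
suff : \forall z \near y, forall c, nf_S d (y_part c z) by [].
apply: (@filter_forall _ _ (fun c z => nf_S d (y_part c z)) (nbhs y)) => c.
apply: y_part_continuous; apply: open_nbhs_nbhs; split; first exact: nf_S_open nfd c.
exact: Sy.
Qed.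

Lemma W_open : open (nf_W d).
Proof.
rewrite openE => x [Ux Vx Sx].
have U' : \forall y \near x, nf_U d (u_part y).
  by apply: u_part_continuous; apply: open_nbhs_nbhs; split=> //; exact: nf_U_open nfd.
have V' : \forall y \near x, nf_V d (t_part y).
  by apply: t_part_continuous; apply: open_nbhs_nbhs; split=> //; exact: nf_V_open nfd.
have S' : \forall y \near x, nf_SS d (s_part y).
  by apply: s_part_continuous; apply: open_nbhs_nbhs; split=> //; exact: SS_open.
by apply: filterS3 U' V' S'.
Qed.

Lemma near_W x : nf_W d x -> \forall y \near x, nf_W d y.
Proof. by move=> Wx; apply: open_nbhs_nbhs; split=> //; exact: W_open. Qed.

Lemma gS_cdiff c x : nf_W d x -> cdiff_mx (fun y : pt => gS d (yc c y)) x.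
Proof.
move=> Wx i j; apply: (cdiff_s (F := fun s => gS d (y_part c s) i j)).
apply: (cdiff_y (F := fun z => gS d z i j)).
exact: smooth_cdiff0 (kahler_g_smooth (nf_S_kahler nfd c) i j) (yc_in Wx c).
Qed.

Lemma alpha_cdiff x : nf_W d x -> cdiff_mx (alpha_mx d) x.
Proof.
move=> [_ _ Sx] i j.
apply: (@cdiff_ext _ _ _ (fun y => (nf_alpha d i (s_part y) 0 j)%:C)) => [y|]; first by rewrite mxE.
apply: (cdiff_s (F := fun s => (nf_alpha d i s 0 j)%:C)).
have := smooth_cdiff0 (nf_alpha_smooth nfd i 0 j) Sx.
by congr cdiff; apply/funext => s; rewrite mxE.
Qed.

Lemma muhat_mx_cdiff x : nf_W d x -> cdiff_mx (muhat_mx d) x.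
Proof.
move=> Wx i j; apply: (@cdiff_ext _ _ _ (fun y => muhat d i j y)) => [y|]; first by rewrite mxE.
exact: muhat_cdiff.
Qed.

Lemma Delta_cdiff s x : nf_W d x -> cdiff (Delta d s) x.
Proof. by move=> Wx; apply: cdiff_prod => j _; apply: cdiffB; apply: rho_cdiff. Qed.

Lemma Pc_cdiff c x : nf_W d x -> cdiff (Pc d c) x.
Proof.
by move=> Wx; apply: cdiff_prod => j _; apply: cdiffB (cdiff_cst _ _) _; apply: rho_cdiff.
Qed.

Lemma a_cdiff x : nf_W d x -> cdiff_mx (a_row d) x.
Proof.
move=> Wx i s; apply: (@cdiff_ext _ _ _ (fun y => eps d s * Delta d s y)) => [y|].
  by rewrite mxE.
by apply: cdiffZ; exact: Delta_cdiff.
Qed.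

Lemma b_cdiff x : nf_W d x -> cdiff_mx (b_row d) x.
Proof.
move=> Wx i s; apply: (@cdiff_ext _ _ _ (fun y => rho' d s y ^+ 2 / (eps d s * Delta d s y))) => [y|].
  by rewrite mxE.
apply: cdiff_div.
- by rewrite mulf_neq0 ?eps_neq0 ?(Delta_neq0 nfd Wx).
- by apply: cdiffX; apply: rho'_cdiff.
- by apply: cdiffZ; apply: Delta_cdiff.
Qed.

Lemma gS_mx_cdiff x : nf_W d x -> cdiff_mx (gS_mx d) x.
Proof.
move=> Wx; apply: cdiff_mx_mxdiag => c; apply: cdiff_mx_scale; first exact: Pc_cdiff.
exact: gS_cdiff.
Qed.

Lemma gram_cdiff x : nf_W d x -> cdiff_mx (gram d) x.
Proof.
move=> Wx; have z n1 n2 := @cdiff_mx_cst R N n1 n2 0 x.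
apply: cdiff_mx_col; apply: cdiff_mx_row => //; last exact: gS_mx_cdiff.
apply: cdiff_mx_col; apply: cdiff_mx_row => //; apply: cdiff_mx_diag.
  exact: a_cdiff.
exact: b_cdiff.
Qed.

Lemma theta_mx_cdiff x : nf_W d x -> cdiff_mx (theta_mx d) x.
Proof. by move=> Wx; apply: cdiff_mx_row; [exact: cdiff_mx_cst|exact: alpha_cdiff]. Qed.

Lemma coframe_cdiff x : nf_W d x -> cdiff_mx (coframe d) x.
Proof.
move=> Wx; apply: cdiff_mx_col; last exact: cdiff_mx_cst.
apply: cdiff_mx_col; first exact: cdiff_mx_cst.
by apply: cdiff_mx_mul; [exact: muhat_mx_cdiff|exact: theta_mx_cdiff].
Qed.

Lemma muhat_inv_cdiff x : nf_W d x -> cdiff_mx (muhat_inv d) x.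
Proof.
move=> Wx; apply: cdiff_mx_mul.
  move=> j s; apply: (@cdiff_ext _ _ _ (fun y => (-1) ^+ j * rho d s y ^+ (r - j.+1))) => [y|].
    by rewrite mxE.
  by apply: cdiffZ; apply: cdiffX; exact: rho_cdiff.
apply: cdiff_mx_diag => i s; apply: (@cdiff_ext _ _ _ (fun y => (Delta d s y)^-1)) => [y|].
  by rewrite mxE.
by apply: cdiffV; [exact: Delta_neq0 nfd Wx s|exact: Delta_cdiff].
Qed.

Lemma frame_cdiff x : nf_W d x -> cdiff_mx (frame d) x.
Proof.
move=> Wx; have z n1 n2 A := @cdiff_mx_cst R N n1 n2 A x.
apply: cdiff_mx_row; first apply: cdiff_mx_row => //.
  by apply: cdiff_mx_col => //; apply: cdiff_mx_col => //; exact: muhat_inv_cdiff.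
apply: cdiff_mx_col => //; apply: cdiff_mx_col => // i j.
apply: (@cdiff_ext _ _ _ (fun y => - alpha_mx d y i j)) => [y|]; first by rewrite mxE.
by apply: cdiffN; exact: alpha_cdiff.
Qed.

Hypothesis ssd : semisimple d.

Lemma nf_g_near_tr x : nf_W d x -> \forall y \near x, (nf_g d y)^T = nf_g d y.
Proof. by move=> /near_W; apply: filterS => y Wy; apply: nf_g_tr. Qed.

Lemma nf_g_near x : nf_W d x ->
  \forall y \near x, nf_g d y = (coframe d y)^T *m gram d y *m coframe d y.
Proof. by move=> /near_W; apply: filterS => y Wy; apply: nf_gE. Qed.

(** Derivatives of [alpha] occupy the [y] columns of the coframe, and [frame_t] has no [y] rows, so
    they do not reach the trace. *)
Lemma tr_dmx_coframe v x : nf_W d x ->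
  \tr (frame d x *m dmx v (coframe d) x) = \tr (dmx v (muhat_mx d) x *m muhat_inv d x).
Proof.
move=> Wx; rewrite /coframe !dmx_col !dmx_cst.
rewrite (dmx_mul v (muhat_mx_cdiff Wx) (theta_mx_cdiff Wx)) /frame !mul_row_col !mulmx0 add0r addr0.
rewrite mxtrace_mulC mulmxDl -!mulmxA dmx_row dmx_cst !mul_row_col.
by rewrite !(mul0mx, mulmx0, addr0, add0r, mul1mx).
Qed.

Lemma half_tr_dmx_gram v x : nf_W d x ->
  2^-1 * \tr (invmx (gram d x) *m dmx v (gram d) x) =
  \sum_s ddir v (rho' d s) x / rho' d s x
  + \sum_c ((h c)%:R * (ddir v (Pc d c) x / Pc d c x)
            + 2^-1 * \tr (invmx (gS d (yc c x)) *m dmx v (fun y : pt => gS d (yc c y)) x)).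
Proof.
move=> Wx; rewrite gram_invE //.
have -> : dmx v (gram d) x = diag3 (dmx v (a_row d) x) (dmx v (b_row d) x)
    (\mxdiag_c (ddir v (Pc d c) x *: gS d (yc c x)
                + Pc d c x *: dmx v (fun y : pt => gS d (yc c y)) x)).
  rewrite /gram /diag3 dmx_col !dmx_row !dmx_cst dmx_col !dmx_row !dmx_cst !dmx_diag dmx_mxdiag.
  congr block_mx; apply: eq_mxdiag => c.
  by rewrite dmx_scale //; [exact: Pc_cdiff|exact: gS_cdiff].
rewrite /gram_inv diag3_mul mxtrace_diag3 mxdiag_mul mxtrace_mxdiag mulrDr; congr (_ + _).
  rewrite -big_split mulr_sumr; apply: eq_bigr => s _ /=.
  have ab y : nf_W d y -> a_row d y 0 s * b_row d y 0 s = rho' d s y ^+ 2.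
    by move=> Wy; rewrite !mxE mulrC divfK // mulf_neq0 ?eps_neq0 ?(Delta_neq0 nfd Wy).
  have := ddirM v (a_cdiff Wx 0 s) (b_cdiff Wx 0 s).
  rewrite (@ddir_near _ _ v _ (fun y => rho' d s y * rho' d s y)); last first.
    by apply: filterS (near_W Wx) => y /ab ->.
  have r0 := rho'_neq0 nfd s Wx.
  rewrite (ddirM v (rho'_cdiff s nfd Wx) (rho'_cdiff s nfd Wx)).
  have a0 := a_neq0 nfd Wx s; have b0 := b_neq0 nfd Wx s.
  have eA (A : pt -> 'rV[C]_r) :
      (\row_s0 ((\row_s1 (A x 0 s1)^-1) 0 s0 * dmx v A x 0 s0)) 0 s =
      (A x 0 s)^-1 * ddir v (fun y => A y 0 s) x.
    by rewrite mxE; congr (_ * _); rewrite mxE.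
  rewrite (eA (a_row d)) (eA (b_row d)).
  by move=> E; apply: half_log_sum => //; exact: ab.
rewrite mulr_sumr; apply: eq_bigr => c _.
rewrite mulmxDr -!scalemxAl -!scalemxAr scalerA [X in _ + X]scalerA mulVf ?(Pc_neq0 nfd Wx) // scale1r.
rewrite mulVmx ?(gS_unit nfd Wx) // raddfD /= mxtraceZ mxtrace1 mulrDr; congr (_ + _).
(* The factor [S_c] has dimension [2 h_c], so half the trace of the identity contributes [h c]. *)
rewrite -mul2n natrM; field.
exact: Pc_neq0.
Qed.

(** The three groups of terms are the logarithmic derivatives of [det muhat_mx], of the product of
    the [rho'_s], and of the densities [Pc^(h c) |det g_c|^(1/2)]. *)
Lemma log_volume v x : nf_W d x -> log_volume_diff (nf_g d) v x =
  \tr (dmx v (muhat_mx d) x *m muhat_inv d x)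
  + (\sum_s ddir v (rho' d s) x / rho' d s x
     + \sum_c ((h c)%:R * (ddir v (Pc d c) x / Pc d c x)
            + 2^-1 * \tr (invmx (gS d (yc c x)) *m dmx v (fun y : pt => gS d (yc c y)) x))).
Proof.
move=> Wx; rewrite (log_volume_diff_frame v (nf_g_near Wx) (coframeK nfd Wx)).
- by rewrite (tr_dmx_coframe v Wx) (half_tr_dmx_gram v Wx).
- exact: gram_unit.
- exact: coframe_cdiff.
- exact: gram_cdiff.
Qed.

End VolumeForm.

Section LogVolume.
Variables (R : realType) (l q nb : nat) (h : 'I_nb -> nat) (d : nf_data R l q nb h).
Local Notation C := R[i].
Local Notation r := (l + l + q)%N.
Local Notation m c := ((h c).*2).
Local Notation dimS := (\sum_(c < nb) m c)%N.
Local Notation N := (r + r + dimS)%N.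
Local Notation pt := 'rV[R]_N.
Local Notation rhoc c := ((nf_rhoc d c)%:C).
Hypotheses (nfd : normal_form d).

Lemma near_gt0 (V : topologicalType) (g : V -> R) (x : V) :
  {for x, continuous g} -> 0 < g x -> \forall y \near x, 0 < g y.
Proof. by move=> /cvgr_gt gc gp; apply: gc. Qed.

Lemma near_lt0 (V : topologicalType) (g : V -> R) (x : V) :
  {for x, continuous g} -> g x < 0 -> \forall y \near x, g y < 0.
Proof. by move=> /cvgr_lt gc gp; apply: gc. Qed.

(** Away from zero the sign of [g] is locally constant, so the absolute value is locally [g] or
    [- g]. *)
Lemma sqrt_norm_differentiable (V : normedModType R) (g : V -> R) (x : V) :
  differentiable g x -> g x != 0 -> differentiable (fun y => Num.sqrt `|g y|) x.
Proof.
move=> dg g0; have cg := differentiable_continuous dg.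
have dn : differentiable (fun y => `|g y|) x.
  have [gp|gn] := ltP 0 (g x).
    apply: near_eq_differentiable dg.
    have := near_gt0 cg gp.
    by apply: filterS => y y0; rewrite gtr0_norm.
  have {}gn : g x < 0 by rewrite lt_neqAle g0.
  apply: (near_eq_differentiable _ (differentiableN dg)).
  have := near_lt0 cg gn.
  by apply: filterS => y y0; rewrite ltr0_norm.
have p0 : 0 < `|g x| by rewrite normr_gt0.
have ds : differentiable (@Num.sqrt R) `|g x|.
  by apply/derivable1_diffP; have := is_derive1_sqrt p0; case.
exact: differentiable_comp dn ds.
Qed.

Lemma det_gS c (y : pt) : \det (gS d (yc c y)) = (\det (nf_gS d (yc c y)))%:C.
Proof. by rewrite det_map_mx. Qed.

Lemma det_gS_differentiable c x : nf_W d x ->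
  differentiable (fun y : pt => \det (nf_gS d (yc c y))) x.
Proof.
move=> Wx; have [dd _] := cdiff_det (gS_cdiff nfd (c := c) Wx).
rewrite (_ : (fun _ => _) = (fun y : pt => complex.Re (\det (gS d (yc c y))))) //.
by apply/funext => y; rewrite det_gS.
Qed.

Lemma densS_cdiff c x : nf_W d x -> cdiff (densS d c) x.
Proof.
move=> Wx; split; last exact: differentiable_cst.
apply: (sqrt_norm_differentiable (g := fun y : pt => \det (nf_gS d (yc c y)))).
  exact: det_gS_differentiable.
have := gS_unit nfd Wx c; rewrite unitmxE unitfE det_gS.
by apply: contra_neq => ->.
Qed.

Lemma densS_neq0 c x : nf_W d x -> densS d c x != 0.
Proof.
move=> Wx; have := gS_unit nfd Wx c; rewrite unitmxE unitfE det_map_mx /densS => g0.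
have {}g0 : \det (nf_gS d (yc c x)) != 0 by apply: contra_neq g0 => ->.
by rewrite -(rmorph0 (real_complex R)) (inj_eq (@complexI R)) gt_eqF // sqrtr_gt0 normr_gt0.
Qed.

(** The square of the density is [det g_c] up to a locally constant sign; differentiating the square
    avoids differentiating the root. *)
Lemma ddir_densS v c x : nf_W d x -> ddir v (densS d c) x / densS d c x =
  2^-1 * \tr (invmx (gS d (yc c x)) *m dmx v (fun y : pt => gS d (yc c y)) x).
Proof.
move=> Wx.
have cg := gS_cdiff nfd (c := c) Wx; have ug := gS_unit nfd Wx c.
have D0 := densS_neq0 c Wx; have cD := densS_cdiff c Wx.
pose s : C := (Num.sg (\det (nf_gS d (yc c x))))%:C.
have g0 : \det (nf_gS d (yc c x)) != 0.
  by move: ug; rewrite unitmxE unitfE det_gS; apply: contra_neq => ->.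
have cont : {for x, continuous (fun y : pt => \det (nf_gS d (yc c y)))}.
  exact/differentiable_continuous/det_gS_differentiable.
have sq : \forall y \near x, densS d c y * densS d c y = s * \det (gS d (yc c y)).
  have same : \forall y \near x, Num.sg (\det (nf_gS d (yc c y))) = Num.sg (\det (nf_gS d (yc c x))).
    have [gp|gn] := ltP 0 (\det (nf_gS d (yc c x))).
      have := near_gt0 cont gp.
      by apply: filterS => y y0; rewrite !gtr0_sg.
    have {}gn : \det (nf_gS d (yc c x)) < 0 by rewrite lt_neqAle g0.
    have := near_lt0 cont gn.
    by apply: filterS => y y0; rewrite !ltr0_sg.
  apply: filterS same => y sy.
  by rewrite /densS /s det_gS -!rmorphM -expr2 sqr_sqrtr // -sy -normrEsg.
have := ddirM v cD cD; rewrite (ddir_near _ sq) ddirZ; last exact: cdiff_det.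
rewrite ddir_det // mulrA -(nbhs_singleton sq).
move: (densS d c x) D0 (ddir v (densS d c) x) (\tr _) => D D0 D' T E.
have -> : T = (D * D * T) / (D * D) by field.
by rewrite E; field.
Qed.

Lemma ddir_cstB v (a : C) (F : pt -> C) x : cdiff F x ->
  ddir v (fun y => a - F y) x = - ddir v F x.
Proof. by move=> dF; rewrite ddirB ?ddir_cst ?sub0r //; apply: cdiff_cst. Qed.

Lemma log_volumeE v x : semisimple d -> nf_W d x -> log_volume_diff (nf_g d) v x =
  \tr (dmx v (muhat_mx d) x *m muhat_inv d x)
  + (\sum_s ddir v (rho' d s) x / rho' d s x
     + \sum_c ((h c)%:R * (ddir v (Pc d c) x / Pc d c x) + ddir v (densS d c) x / densS d c x)).
Proof.
move=> ssd Wx; rewrite log_volume //; congr (_ + (_ + _)); apply: eq_bigr => c _.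
by rewrite ddir_densS.
Qed.

Lemma ddir_rho'0 v2 v3 k (x : pt) : ddir (col_mx (col_mx 0 v2) v3) (rho' d k) x = 0.
Proof. by rewrite rho'_funE ddir_u0. Qed.

Lemma ddir_Pc0 v2 v3 c (x : pt) : ddir (col_mx (col_mx 0 v2) v3) (Pc d c) x = 0.
Proof.
rewrite -(ddir_u0 (fun u => \prod_k (rhoc c - rho_u d k u)) v2 v3 x).
by apply: ddir_ext => y; apply: eq_bigr => k _; rewrite rhoE.
Qed.

Lemma ddir_muhat0 v2 v3 k j (x : pt) : ddir (col_mx (col_mx 0 v2) v3) (muhat d k j) x = 0.
Proof.
rewrite -(ddir_u0 (fun u => Defs.esym [set~ k]%SET (fun i => rho_u d i u) j) v2 v3 x).
by apply: ddir_ext => y; apply: eq_elsym => i _; rewrite rhoE.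
Qed.

Lemma ddir_densS0 v1 v2 c (x : pt) : ddir (col_mx (col_mx v1 v2) 0) (densS d c) x = 0.
Proof. exact: (ddir_s0 (fun s => (Num.sqrt `|\det (nf_gS d (y_part c s))|)%:C)). Qed.

Lemma ddir_densS_neq v1 v2 (c c' : 'I_nb) (a : 'I_(m c)) (x : pt) : c != c' ->
  ddir (col_mx (col_mx v1 v2) (delta_mx (tagnat.Rank c a) 0)) (densS d c') x = 0.
Proof.
move=> cc'; rewrite (ddir_s (fun s => (Num.sqrt `|\det (nf_gS d (y_part c' s))|)%:C)) -pd_ddir.
have ne : tagnat.sig1 (@tagnat.Rank nb (fun c => m c) c a) != c' by rewrite tagnat.Rank1K.
exact: (pd_y_neq (fun z : 'rV[R]_(m c') => (Num.sqrt `|\det (nf_gS d z)|)%:C) (s_part x) ne).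
Qed.

Lemma dmx_muhat0 v2 v3 (x : pt) : dmx (col_mx (col_mx 0 v2) v3) (muhat_mx d) x = 0.
Proof.
apply/matrixP => k j; rewrite [RHS]mxE mxE -(ddir_muhat0 v2 v3 k j x).
by apply: ddir_ext => y; rewrite mxE.
Qed.

Lemma log_volume_t (w : 'cV[C]_r) x : semisimple d -> nf_W d x ->
  log_volume_diff (nf_g d) (col_mx (col_mx 0 w) 0) x = 0.
Proof.
move=> ssd Wx; rewrite log_volumeE // dmx_muhat0 mul0mx mxtrace0 add0r big1 ?add0r; last first.
  by move=> s _; rewrite ddir_rho'0 mul0r.
apply: big1 => c _.
by rewrite ddir_Pc0 ddir_densS0 !mul0r mulr0 addr0.
Qed.

(** Such a direction has no U component and moves in the single factor [S_c], so only the density of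
    that factor changes. *)
Lemma log_volume_y c (a : 'I_(m c)) w x : semisimple d -> nf_W d x ->
  log_volume_diff (nf_g d) (col_mx (col_mx 0 w) (delta_mx (tagnat.Rank c a) 0)) x =
  ddir (col_mx (col_mx 0 w) (delta_mx (tagnat.Rank c a) 0)) (densS d c) x / densS d c x.
Proof.
move=> ssd Wx; rewrite log_volumeE // dmx_muhat0 mul0mx mxtrace0 add0r big1 ?add0r; last first.
  by move=> s _; rewrite ddir_rho'0 mul0r.
rewrite (bigD1 c) //= [X in _ + X]big1 ?addr0; last first.
  by move=> c' c'c; rewrite ddir_Pc0 ddir_densS_neq 1?eq_sym // !mul0r mulr0 addr0.
by rewrite ddir_Pc0 mul0r mulr0 add0r.
Qed.

Lemma ddir_Delta_chi s x : nf_W d x -> ddir (Dchi R h s) (Delta d s) x =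
  Delta d s x * \sum_(k | k != s) rho' d s x / (rho d s x - rho d k x).
Proof.
move=> Wx; have cr k := rho_cdiff k nfd Wx.
rewrite ddir_prod; last 2 first.
- by move=> j _; apply: cdiffB.
- by move=> j js; apply: rho_neq => //; rewrite eq_sym.
congr (_ * _); apply: eq_bigr => k ks.
by rewrite ddirB // !ddir_rho_chi // eqxx mul1r eq_sym (negbTE ks) mul0r subr0.
Qed.

Lemma tr_dmuhat_chi s x : nf_W d x ->
  \tr (dmx (Dchi R h s) (muhat_mx d) x *m muhat_inv d x) =
  \sum_(k | k != s) rho' d s x / (rho d s x - rho d k x).
Proof.
move=> Wx; rewrite /muhat_inv mulmxA /mxtrace.
have cr k := rho_cdiff k nfd Wx.
(* Only [muhat_mx] is differentiated here, so the argument [rho_k] of the polynomial from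
   [muhat_sum] stays frozen at [x]. *)
have E k : (dmx (Dchi R h s) (muhat_mx d) x *m power_mx d x) k k =
    Delta d k x * \sum_(i | i != k) (- ((s == i)%:R * rho' d i x)) / (rho d k x - rho d i x).
  transitivity (ddir (Dchi R h s) (fun y => \prod_(i | i != k) (rho d k x - rho d i y)) x).
    rewrite mxE; under eq_bigr do rewrite !mxE.
    transitivity (ddir (Dchi R h s) (fun y => \sum_(j < r) ((-1) ^+ j * rho d k x ^+ (r - j.+1)) * muhat d k j y) x).
      rewrite ddir_sum; last by move=> j _; apply: cdiffZ; apply: muhat_cdiff.
      apply: eq_bigr => j _; rewrite ddirZ; last exact: muhat_cdiff.
      by rewrite mulrC; congr (_ * _); apply: ddir_ext => y; rewrite mxE.
    apply: ddir_ext => y; rewrite -muhat_sum; apply: eq_bigr => j _; by rewrite mulrC.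
  rewrite ddir_prod; last 2 first.
  - by move=> j _; apply: cdiffB => //; apply: cdiff_cst.
  - by move=> j jk; apply: rho_neq => //; rewrite eq_sym.
  congr (_ * _); apply: eq_bigr => i ik.
  by rewrite ddir_cstB // ddir_rho_chi.
rewrite (bigD1 s) //= mul_mx_diag mxE [(\row__ _) _ _]mxE E big1 ?mulr0 ?mul0r ?add0r; last first.
  by move=> i si; rewrite eq_sym (negbTE si) mul0r oppr0 mul0r.
apply: eq_bigr => k ks; rewrite mxE [(\row__ _) _ _]mxE E mulrAC mulfV ?mul1r; last first.
  exact: Delta_neq0.
rewrite (bigD1 s) 1?eq_sym //= eqxx mul1r [X in _ + X]big1 ?addr0; last first.
  by move=> i /andP[_ si]; rewrite eq_sym (negbTE si) mul0r oppr0 mul0r.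
by rewrite mulNr -mulrN -invrN opprB.
Qed.

Lemma ddir_Pc_chi s c x : nf_W d x ->
  ddir (Dchi R h s) (Pc d c) x / Pc d c x = rho' d s x / (rho d s x - rhoc c).
Proof.
move=> Wx; have cr k := rho_cdiff k nfd Wx.
rewrite ddir_prod; last 2 first.
- by move=> j _; apply: cdiffB => //; apply: cdiff_cst.
- by move=> j _; apply: rhoc_rho_neq.
rewrite -/(Pc d c x) mulrAC mulfV ?mul1r; last exact: Pc_neq0.
rewrite (bigD1 s) //= [X in _ + X]big1 ?addr0; last first.
  move=> i si; rewrite ddir_cstB // ddir_rho_chi //.
  by rewrite eq_sym (negbTE si) mul0r oppr0 mul0r.
rewrite ddir_cstB // ddir_rho_chi //.
by rewrite eqxx mul1r mulNr -mulrN -invrN opprB.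
Qed.

Lemma log_volume_chi s x : semisimple d -> nf_W d x ->
  log_volume_diff (nf_g d) (Dchi R h s) x =
  ddir (Dchi R h s) (Delta d s) x / Delta d s x
  + ddir (Dchi R h s) (rho' d s) x / rho' d s x
  + \sum_c (h c)%:R * (rho' d s x / (rho d s x - rhoc c)).
Proof.
move=> ssd Wx; rewrite log_volumeE // tr_dmuhat_chi // ddir_Delta_chi //.
rewrite [_ * _ / Delta d s x]mulrAC mulfV ?mul1r; last exact: Delta_neq0.
rewrite -addrA; congr (_ + (_ + _)).
  rewrite (bigD1 s) //= [X in _ + X]big1 ?addr0 // => k ks.
  by rewrite ddir_rho'_chi ?mul0r // eq_sym.
apply: eq_bigr => c _; rewrite ddir_Pc_chi // Dchi_col ddir_densS0.
by rewrite mul0r addr0.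
Qed.

End LogVolume.

(** * The operators L_t *)

Section HamiltonianField.
Variables (R : realType) (l q nb : nat) (h : 'I_nb -> nat) (d : nf_data R l q nb h).
Local Notation C := R[i].
Local Notation r := (l + l + q)%N.
Local Notation m c := ((h c).*2).
Local Notation dimS := (\sum_(c < nb) m c)%N.
Local Notation N := (r + r + dimS)%N.
Local Notation pt := 'rV[R]_N.
Local Notation rhoc c := ((nf_rhoc d c)%:C).

Lemma mulmx_col_row (K : pzSemiRingType) n1 n n2 (A : 'M[K]_(n1, n)) (B : 'M[K]_(n, n2)) :
  A *m B = \sum_i col i A *m row i B.
Proof.
apply/matrixP => a b; rewrite mxE summxE; apply: eq_bigr => i _.
by rewrite mxE big_ord1 !mxE.
Qed.

Lemma block_omega_sandwich n1 n3 k k' (F1 F2 : 'M[C]_(k, n1)) (F3 : 'M[C]_(k, n3))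
   A1 A2 A3 (E1 E2 : 'M[C]_(n1, k')) (E3 : 'M[C]_(n3, k')) :
  row_mx (row_mx F1 F2) F3 *m block_mx (block_mx 0 A1 A2 0) 0 0 A3 *m col_mx (col_mx E1 E2) E3
  = F2 *m A2 *m E1 + F1 *m A1 *m E2 + F3 *m A3 *m E3.
Proof.
rewrite !mul_row_block !mul_row_col !mulmx0 !addr0 !add0r.
by rewrite mul_row_col.
Qed.

(** The Kähler form exchanges the [chi] and [t] blocks: a differential along [chi] becomes a vector
    along [t]. *)
Lemma block_hamiltonian n1 n3 (A B O1 O2 : 'M[C]_n1) (S T : 'M[C]_n3) (w : 'cV_n1) :
  block_mx (block_mx A 0 0 B) 0 0 S *m block_mx (block_mx 0 O1 O2 0) 0 0 T *m
    block_mx (block_mx A 0 0 B) 0 0 S *m col_mx (col_mx w 0) 0 =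
  col_mx (col_mx 0 (B *m O2 *m A *m w)) 0.
Proof.
rewrite -!mulmxA; do !rewrite mul_block_col ?mulmx0 ?mul0mx ?addr0 ?add0r.
by rewrite !mulmxA.
Qed.

Section AtPoint.
Variable x : pt.
Hypotheses (nfd : normal_form d) (Wx : nf_W d x) (ssd : semisimple d).

Lemma sum_dmu_theta : \sum_(i < r) tensor (dfun (mu d i.+1) x) (theta d i x) =
  (coframe_chi R l q h)^T *m diag_mx (rho'_row d x) *m coframe_t d x.
Proof.
rewrite /coframe_t mulmxA mulmx_col_row; apply: eq_bigr => i _.
rewrite row_theta_mx; congr (_ *m _).
rewrite (dfun_mu nfd Wx) trmx_mul colE -(mulmxA _ (diag_mx _)) -mulmxA -colE; congr (_ *m _).
by apply/colP => s; rewrite mul_diag_mx !mxE.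
Qed.

Lemma nf_omegaE : nf_omega d x = (coframe d x)^T *m omega_gram d x *m coframe d x.
Proof.
rewrite /coframe /omega_gram !tr_col_mx block_omega_sandwich /nf_omega pullback_poly //.
congr (_ + _); rewrite /wedge sumrB sum_dmu_theta addrC; congr (_ + _).
rewrite mulmxN mulNmx; congr (- _).
rewrite (_ : \sum_(i < r) _ = (\sum_(i < r) tensor (dfun (mu d i.+1) x) (theta d i x))^T).
  by rewrite sum_dmu_theta !trmx_mul trmxK tr_diag_mx mulmxA.
rewrite raddf_sum; apply: eq_bigr => i _.
by rewrite /tensor /= trmx_mul trmxK.
Qed.

(** Chosen so that by [muhat_sum] the entries of [muhat_mx *m t_powers t] are the products of
    [t - rho_i] over [i != s]. *)
Definition t_powers (t : C) : 'cV[C]_r := \col_j ((-1) ^+ j * t ^+ (r - j.+1)).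
Definition const_char (t : C) : C := \prod_c (t - rhoc c) ^+ h c.

Lemma sqrt_char_hornerE y (t : C) : nf_W d y ->
  (sqrt_char (nf_A d y)).[t] = const_char t * \prod_k (t - rho d k y).
Proof.
move=> Wy; rewrite (sqrt_charE nfd Wy ssd) horner_prod big_sumType /= mulrC /const_char.
by congr (_ * _); apply: eq_bigr => e _; rewrite horner_exp hornerXsubC.
Qed.

Lemma ddir_sqrt_char_chi s (t : C) :
  ddir (Dchi R h s) (fun y : pt => (sqrt_char (nf_A d y)).[t]) x =
  - rho' d s x * const_char t * (muhat_mx d x *m t_powers t) s 0.
Proof.
have cr k := rho_cdiff k nfd Wx.
rewrite (@ddir_near _ _ _ _ (fun y : pt => (const_char t * \prod_(k | k != s) (t - rho d k y)) * (t - rho d s y))); last first.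
  apply: filterS (near_W nfd Wx) => y Wy.
  by rewrite sqrt_char_hornerE // (bigD1 s) //= mulrA mulrAC.
have cp k : cdiff (fun y => t - rho d k y) x by apply: cdiffB (cdiff_cst _ _) _.
have cP : cdiff (fun y => \prod_(k | k != s) (t - rho d k y)) x by apply: cdiff_prod.
rewrite ddirM //; last exact: cdiffZ.
rewrite ddirZ // ddir_prod0 //; last first.
  by move=> k ks; rewrite ddir_cstB // ddir_rho_chi // eq_sym (negbTE ks) mul0r oppr0.
rewrite mulr0 mul0r add0r ddir_cstB // ddir_rho_chi // eqxx mul1r.
rewrite [X in _ = _ * X]mxE; under [X in _ = _ * X]eq_bigr do rewrite !mxE.
by rewrite muhat_sum; ring.
Qed.

Lemma ddir_sqrt_char0 v2 v3 (t : C) :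
  ddir (col_mx (col_mx 0 v2) v3) (fun y : pt => (sqrt_char (nf_A d y)).[t]) x = 0.
Proof.
rewrite (@ddir_near _ _ _ _ (fun y : pt => const_char t * \prod_k (t - rho_u d k (u_part y)))).
  exact: (ddir_u0 (fun u => const_char t * \prod_k (t - rho_u d k u))).
apply: filterS (near_W nfd Wx) => y Wy.
by rewrite sqrt_char_hornerE //; congr (_ * _); apply: eq_bigr => k _; rewrite rhoE.
Qed.

(** The factors [eps_s], [Delta_s] and [rho'_s] cancel between metric, Kähler form and differential.
    What remains is [muhat_inv] applied to [muhat_mx *m t_powers], so the field has constant
    coefficients. *)
Lemma V_vecE (t : R) :
  V_vec d t x = - const_char t%:C *: col_mx (col_mx 0 (t_powers t%:C)) 0.
Proof.
set F := fun y : pt => (sqrt_char (nf_A d y)).[t%:C].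
pose w : 'cV[C]_r := \col_s ddir (Dchi R h s) F x.
have dF : (frame d x)^T *m (dfun F x)^T = col_mx (col_mx w 0) 0.
  rewrite -trmx_mul /frame !mul_mx_row !tr_row_mx !dfun_mul_row.
  congr col_mx; first congr col_mx.
  - by apply/colP => s; rewrite !mxE col_frame_chi.
  - by apply/colP => s; rewrite !mxE !col_col_mx col0 ddir_sqrt_char0.
  - by apply/colP => s; rewrite !mxE !col_col_mx col0 ddir_sqrt_char0.
have EF := coframeK nfd Wx.
have -> : V_vec d t x = frame d x *m (gram_inv d x *m (omega_gram d x)^T *m gram_inv d x *m
    ((frame d x)^T *m (dfun F x)^T)).
  rewrite /V_vec /nf_J trmx_mul trmx_inv nf_g_tr // nf_g_inv // nf_omegaE // !trmx_mul trmxK.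
  move: (frame d x) (coframe d x) EF (gram_inv d x) (omega_gram d x) (dfun _ x) => P E EP G O D.
  have PE : P^T *m E^T = 1%:M by rewrite -trmx_mul EP trmx1.
  by rewrite !mulmxA -(mulmxA _ P^T E^T) PE mulmx1 -(mulmxA _ E P) EP mulmx1.
rewrite dF /gram_inv /diag3 /omega_gram !tr_block_mx !trmx0.
rewrite block_hamiltonian /frame !mul_row_col !mulmx0 add0r addr0 /frame_t !mul_col_mx !mul0mx.
rewrite !scale_col_mx !scaler0; congr col_mx; congr col_mx.
transitivity (muhat_inv d x *m (- const_char t%:C *: (muhat_mx d x *m t_powers t%:C))); last first.
  by rewrite -scalemxAr mulmxA (mulmx1C (muhat_invK nfd Wx)) mul1mx.
congr (_ *m _); apply/colP => s.
rewrite tr_diag_mx -!mulmxA !mul_diag_mx !mxE ddir_sqrt_char_chi.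
rewrite (_ : \sum_j _ = (muhat_mx d x *m t_powers t%:C) s 0); last by rewrite [RHS]mxE.
have e0 := eps_neq0 d s; have D0 := Delta_neq0 nfd Wx s; have r0 := rho'_neq0 nfd s Wx.
by field; rewrite r0 D0 e0.
Qed.

Lemma dfun_t_powers (F : pt -> C) (t : C) :
  ddir (col_mx (col_mx 0 (t_powers t)) 0) F x =
  \sum_(j < r) (-1) ^+ j * t ^+ (r - j.+1) * pd (it h j) F x.
Proof.
rewrite /ddir delta_block [X in X + _ + _]big1 ?[X in _ + _ + X]big1 ?add0r ?addr0 => [|a _|a _].
- by apply: eq_bigr => j _; rewrite mxE.
- by rewrite mxE mul0r.
by rewrite mxE mul0r.
Qed.

End AtPoint.

(** [V_t] has constant coefficients along [t] and the density does not depend on [t]. Hence it is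
    divergence free, and both halves of the symmetrised operator are [V_t psi]. *)
Lemma L_opE (psi : pt -> C) (t : R) x : normal_form d -> semisimple d ->
  smooth (nf_W d) psi -> nf_W d x ->
  L_op d t psi x = - 'i%C * const_char t%:C *
    \sum_(j < r) (-1) ^+ j * t%:C ^+ (r - j.+1) * pd (it h j) psi x.
Proof.
move=> nfd ssd sp Wx.
have dp := smooth_cdiff0 sp Wx.
set v : 'cV[C]_N := col_mx (col_mx 0 (t_powers t%:C)) 0.
have Vn : \forall y \near x, psi y *: V_vec d t y = v *m (\col_(i < 1) (- const_char t%:C * psi y)).
  apply: filterS (near_W nfd Wx) => y Wy; rewrite V_vecE // scalerA mulrC.
  apply/colP => a; rewrite [LHS]mxE [RHS]mxE big_ord1 [X in _ = _ * X]mxE mulrC.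
  exact: mulrC.
have cv : cdiff_mx (fun y => \col_(i < 1) (- const_char t%:C * psi y)) x.
  move=> i j; apply: (@cdiff_ext _ _ _ (fun y => - const_char t%:C * psi y)) => [y|].
    by rewrite mxE.
  exact: cdiffZ.
rewrite /L_op (divergence_frame (nf_g_near_tr nfd ssd Wx) Vn (cdiff_mx_cst v x) cv); last first.
  by move=> i; apply: big1 => j _; apply: pd_cst.
rewrite big_ord1 (_ : col 0 v = v); last by apply/colP => a; rewrite mxE.
rewrite /v log_volume_t // mul0r addr0 V_vecE //.
rewrite (@ddir_ext _ _ _ _ (fun y => - const_char t%:C * psi y)); last by move=> y; rewrite mxE.
have -> : (dfun psi x *m (- const_char t%:C *: v)) 0 0 = - const_char t%:C * ddir v psi x.
  by rewrite -scalemxAr mxE dfun_mul (_ : col _ v = v) //; apply/colP => a; rewrite mxE.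
rewrite ddirZ // dfun_t_powers.
move: (\sum_j _) => S; by field.
Qed.

End HamiltonianField.

(** * The operators Q_t *)

Section Flux.
Variables (R : realType) (l q nb : nat) (h : 'I_nb -> nat) (d : nf_data R l q nb h).
Local Notation C := R[i].
Local Notation r := (l + l + q)%N.
Local Notation m c := ((h c).*2).
Local Notation dimS := (\sum_(c < nb) m c)%N.
Local Notation N := (r + r + dimS)%N.
Local Notation pt := 'rV[R]_N.
Local Notation rhoc c := ((nf_rhoc d c)%:C).

(** A section of the projection to U: a function unchanged by [u_lift] after [u_part] depends on U
    alone, which [ddir_u_dep] turns into vanishing derivatives along [t] and [y]. *)
Definition u_lift (u : 'rV[R]_r) : pt := row_mx (row_mx u 0) 0.

Lemma u_part_lift u : u_part (u_lift u) = u.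
Proof. by rewrite /u_part !row_mxKl. Qed.

Lemma rho_lift k (y : pt) : rho d k (u_lift (u_part y)) = rho d k y.
Proof. by rewrite !rhoE u_part_lift. Qed.

Lemma rho'_lift k (y : pt) : rho' d k (u_lift (u_part y)) = rho' d k y.
Proof. by rewrite !rho'E u_part_lift. Qed.

Lemma ev_lift e (y : pt) : ev d e (u_lift (u_part y)) = ev d e y.
Proof. by case: e => // k; apply: rho_lift. Qed.

Lemma Delta_lift k (y : pt) : Delta d k (u_lift (u_part y)) = Delta d k y.
Proof. by apply: eq_bigr => j _; rewrite !rho_lift. Qed.

Lemma cofactor_eval_lift e t (y : pt) : cofactor_eval d e (u_lift (u_part y)) t = cofactor_eval d e y t.
Proof.
rewrite /cofactor_eval ev_lift; congr (_ * _).
by apply: eq_bigr => e' _; rewrite ev_lift.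
Qed.

Lemma muhat_invE j s (y : pt) :
  muhat_inv d y j s = (-1) ^+ j * rho d s y ^+ (r - j.+1) / Delta d s y.
Proof. by rewrite /muhat_inv mul_mx_diag !mxE. Qed.

Lemma ddir_u_dep (F : pt -> C) v2 v3 x : (forall y, F (u_lift (u_part y)) = F y) ->
  ddir (col_mx (col_mx 0 v2) v3) F x = 0.
Proof.
move=> FE; rewrite -(ddir_u0 (fun u => F (u_lift u)) v2 v3 x).
by apply: ddir_ext => y; rewrite FE.
Qed.

(** Each entry is constant along the coordinate of its own row: [frame_chi] is constant, while
    [muhat_inv] varies over U and [alpha_mx] over the factors [S_c], but both stand in rows of
    [t]. *)
Lemma pd_frame j i x : pd j (fun y => frame d y j i) x = 0.
Proof.
rewrite pd_ddir -(splitK i); case: (fintype.split i) => [i'|b] /=; first rewrite -(splitK i').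
  case: (fintype.split i') => [s|s] /=.
    rewrite (@ddir_ext _ _ _ _ (fun=> frame_chi R l q h j s)) ?ddir_cst // => y.
    by rewrite /frame !row_mxEl.
  rewrite (@ddir_ext _ _ _ _ (fun y => frame_t d y j s)) => [|y]; last by rewrite /frame row_mxEl row_mxEr.
  rewrite -(splitK j); case: (fintype.split j) => [j'|b] /=; first rewrite -(splitK j').
    case: (fintype.split j') => [k|k] /=.
      rewrite (@ddir_ext _ _ _ _ (fun=> 0)) ?ddir_cst // => y.
      by rewrite /frame_t !col_mxEu mxE.
    rewrite (@ddir_ext _ _ _ _ (fun y => muhat_inv d y k s)) => [|y]; last first.
      by rewrite /frame_t col_mxEu col_mxEd.
    rewrite -/(Dt R h k) Dt_col; apply: ddir_u_dep => y.
    by rewrite !muhat_invE rho_lift Delta_lift.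
  rewrite (@ddir_ext _ _ _ _ (fun=> 0)) ?ddir_cst // => y.
  by rewrite /frame_t !col_mxEd mxE.
rewrite (@ddir_ext _ _ _ _ (fun y => frame_y d y j b)) => [|y]; last by rewrite /frame row_mxEr.
rewrite -(splitK j); case: (fintype.split j) => [j'|b'] /=; first rewrite -(splitK j').
  case: (fintype.split j') => [k|k] /=.
    rewrite (@ddir_ext _ _ _ _ (fun=> 0)) ?ddir_cst // => y.
    by rewrite /frame_y !col_mxEu mxE.
  rewrite (@ddir_ext _ _ _ _ (fun y => - (nf_alpha d k (s_part y) 0 b)%:C)) => [|y]; last first.
    by rewrite /frame_y col_mxEu col_mxEd !mxE.
  rewrite -/(Dt R h k) Dt_col.
  exact: (ddir_s0 (fun s => - (nf_alpha d k s 0 b)%:C)).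
rewrite (@ddir_ext _ _ _ _ (fun=> (1%:M : 'M_dimS) b' b)) ?ddir_cst // => y.
by rewrite /frame_y !col_mxEd.
Qed.

Variable psi : pt -> C.

Definition flux (t : C) (y : pt) : 'cV[C]_N :=
  diag_mx (cofactor_row d y t) *m (gram_inv d y *m (dfun psi y *m frame d y)^T).

Lemma K_up_dfun (t : R) y : normal_form d -> semisimple d -> nf_W d y ->
  K_up d t y *m (dfun psi y)^T = frame d y *m flux t%:C y.
Proof.
move=> nfd ssd Wy; have EF := coframeK nfd Wy.
rewrite /K_up /flux K_mx_frame // nf_g_inv //.
move: (frame d y) (coframe d y) EF (diag_mx _) (gram_inv _ _) (dfun _ _) => P E EP M G D.
by rewrite trmx_mul -!mulmxA (mulmxA E) EP mul1mx.
Qed.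

Lemma eindex_chi (s : 'I_r) : eindex (lshift dimS (lshift r s)) = inl s.
Proof. by rewrite /eindex !(unsplitK (inl _)). Qed.

Lemma eindex_t (s : 'I_r) : eindex (lshift dimS (rshift r s)) = inl s.
Proof. by rewrite /eindex (unsplitK (inl _)) (unsplitK (inr _)). Qed.

Lemma eindex_y c (a : 'I_(m c)) : eindex (rshift (r + r) (tagnat.Rank c a)) = inr c.
Proof. by rewrite /eindex (unsplitK (inr _)) tagnat.Rank1K. Qed.

Lemma flux_blocks t y : flux t y = diag_mx (cofactor_row d y t) *m
  col_mx (col_mx (\col_s ((a_row d y 0 s)^-1 * ddir (Dchi R h s) psi y))
                 (\col_s ((b_row d y 0 s)^-1 * ddir (col s (frame_t d y)) psi y)))
         ((\mxdiag_c ((Pc d c y)^-1 *: invmx (gS d (yc c y)))) *m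
            \col_j ddir (col j (frame_y d y)) psi y).
Proof.
have E n (u : 'rV[C]_n) (F : 'M[C]_(N, n)) : diag_mx u *m (dfun psi y *m F)^T =
    \col_s (u 0 s * ddir (col s F) psi y).
  by apply/colP => s; rewrite mul_diag_mx mxE [X in _ * X]mxE dfun_mul [RHS]mxE.
rewrite /flux /gram_inv /diag3 /frame !mul_mx_row !tr_row_mx !mul_block_col !mul0mx !addr0 !add0r.
rewrite !E (_ : (dfun psi y *m frame_y d y)^T = \col_j ddir (col j (frame_y d y)) psi y); last first.
  by apply/colP => s; rewrite mxE dfun_mul [RHS]mxE.
rewrite (_ : \col_s ((\row_s0 (a_row d y 0 s0)^-1) 0 s * _) =
  \col_s ((a_row d y 0 s)^-1 * ddir (Dchi R h s) psi y)); last first.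
  by apply/colP => s; rewrite mxE [X in X * _]mxE col_frame_chi [RHS]mxE.
rewrite (_ : \col_s ((\row_s0 (b_row d y 0 s0)^-1) 0 s * _) =
  \col_s ((b_row d y 0 s)^-1 * ddir (col s (frame_t d y)) psi y)) //.
by apply/colP => s; rewrite mxE [X in X * _]mxE [RHS]mxE.
Qed.

Lemma flux_chi t y s : flux t y (lshift dimS (lshift r s)) 0 =
  cofactor_eval d (inl s) y t * ((eps d s * Delta d s y)^-1 * ddir (Dchi R h s) psi y).
Proof.
by rewrite flux_blocks mul_diag_mx mxE mxE eindex_chi !col_mxEu mxE [a_row _ _ _ _]mxE.
Qed.

Lemma flux_t t y s : flux t y (lshift dimS (rshift r s)) 0 =
  cofactor_eval d (inl s) y t *
    ((rho' d s y ^+ 2 / (eps d s * Delta d s y))^-1 * ddir (col s (frame_t d y)) psi y).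
Proof.
by rewrite flux_blocks mul_diag_mx mxE mxE eindex_t col_mxEu col_mxEd mxE [b_row _ _ _ _]mxE.
Qed.

Lemma flux_y t y c a : flux t y (rshift (r + r) (tagnat.Rank c a)) 0 =
  cofactor_eval d (inr c) y t / Pc d c y *
    \sum_b ginvS d a b y * ddir (col (tagnat.Rank c b) (frame_y d y)) psi y.
Proof.
rewrite flux_blocks mul_diag_mx mxE mxE eindex_y col_mxEd mxE (sum_tagnat1 (c := c)); last first.
  by move=> c' b cc'; rewrite mxdiag_Rank_neq ?mul0r // eq_sym.
rewrite -mulrA mulr_sumr; congr (_ * _); apply: eq_bigr => b _.
by rewrite mxdiag_Rank !mxE mulrA.
Qed.

Lemma cofactor_eval_cdiff e t x : normal_form d -> nf_W d x -> cdiff (fun y => cofactor_eval d e y t) x.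
Proof.
move=> nfd Wx.
have c e' : cdiff (fun y => t - ev d e' y) x.
  by apply: cdiffB (cdiff_cst _ _) _; case: e' => [k|k]; [exact: rho_cdiff|exact: cdiff_cst].
by apply: cdiffM; [apply: cdiff_prod => e' _|]; apply: cdiffX.
Qed.

Lemma flux_cdiff t x : normal_form d -> smooth (nf_W d) psi -> nf_W d x -> cdiff_mx (flux t) x.
Proof.
move=> nfd sp Wx; apply: cdiff_mx_mul; last apply: cdiff_mx_mul.
- apply: cdiff_mx_diag => i I.
  apply: (@cdiff_ext _ _ _ (fun y => cofactor_eval d (eindex I) y t)) => [y|]; first by rewrite mxE.
  exact: cofactor_eval_cdiff.
- have gn : \forall y \near x, gram d y \in unitmx.
    by apply: filterS (near_W nfd Wx) => y Wy; apply: gram_unit.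
  move=> i j; apply: cdiff_near (cdiff_invmx (gram_cdiff nfd Wx) gn i j).
  by apply: filterS (near_W nfd Wx) => y Wy; rewrite gram_invE.
apply: cdiff_mx_tr; apply: cdiff_mx_mul; last exact: frame_cdiff.
move=> i a; apply: (@cdiff_ext _ _ _ (pd a psi)) => [y|]; first by rewrite mxE.
exact: smooth_cdiff_pd sp Wx.
Qed.

Lemma divergence_flux (t : R) x : normal_form d -> semisimple d -> smooth (nf_W d) psi -> nf_W d x ->
  divergence (nf_g d) (fun y => K_up d t y *m (dfun psi y)^T) x =
  \sum_I (ddir (col I (frame d x)) (fun y => flux t%:C y I 0) x
          + log_volume_diff (nf_g d) (col I (frame d x)) x * flux t%:C x I 0).
Proof.
move=> nfd ssd sp Wx; apply: divergence_frame.
- exact: nf_g_near_tr.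
- by apply: filterS (near_W nfd Wx) => y Wy; apply: K_up_dfun.
- exact: frame_cdiff.
- exact: flux_cdiff.
by move=> I; apply: big1 => j _; apply: pd_frame.
Qed.

End Flux.

Section FluxTerms.
Variables (R : realType) (l q nb : nat) (h : 'I_nb -> nat) (d : nf_data R l q nb h).
Local Notation C := R[i].
Local Notation r := (l + l + q)%N.
Local Notation m c := ((h c).*2).
Local Notation dimS := (\sum_(c < nb) m c)%N.
Local Notation N := (r + r + dimS)%N.
Local Notation pt := 'rV[R]_N.
Local Notation rhoc c := ((nf_rhoc d c)%:C).

Lemma ddirX0 k (v : 'cV[C]_k) (F : 'rV[R]_k -> C) n x : cdiff F x -> ddir v F x = 0 ->
  ddir v (fun y => F y ^+ n) x = 0.
Proof.
move=> dF F0; elim: n => [|n IH].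
  by rewrite -(ddir_cst v 1 x); apply: ddir_ext => y; rewrite expr0.
rewrite (@ddir_ext _ _ _ _ (fun y => F y * F y ^+ n)) => [|y]; last by rewrite exprS.
by rewrite ddirM ?IH ?F0 ?mul0r ?mulr0 ?addr0 //; apply: cdiffX.
Qed.

Definition hchar (s : 'I_r) (x : pt) : C := \prod_c (rho d s x - rhoc c) ^+ h c.

Variable psi : pt -> C.
Hypotheses (nfd : normal_form d) (ssd : semisimple d) (sp : smooth (nf_W d) psi).

Section AtPoint.
Variable x : pt.
Hypothesis Wx : nf_W d x.

Lemma hchar_neq0 s : hchar s x != 0.
Proof. by apply/prodf_neq0 => c _; rewrite expf_neq0 // rho_rhoc_neq. Qed.

Lemma hchar_cdiff s : cdiff (hchar s) x.
Proof.
apply: cdiff_prod => c _; apply: cdiffX; apply: cdiffB; last exact: cdiff_cst.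
exact: rho_cdiff.
Qed.

Lemma ddir_hchar s : ddir (Dchi R h s) (hchar s) x =
  hchar s x * \sum_c (h c)%:R * (rho' d s x / (rho d s x - rhoc c)).
Proof.
have cr c : cdiff (fun y => rho d s y - rhoc c) x by apply: cdiffB (cdiff_cst _ _); exact: rho_cdiff.
have n0 c : rho d s x - rhoc c != 0 by apply: rho_rhoc_neq.
rewrite ddir_prod; last 2 first.
- by move=> c _; apply: cdiffX.
- by move=> c _; rewrite expf_neq0.
congr (_ * _); apply: eq_bigr => c _; rewrite ddirX // ddirB; last 2 first.
- exact: rho_cdiff.
- exact: cdiff_cst.
rewrite ddir_cst subr0 ddir_rho_chi // eqxx mul1r.
by rewrite [X in X / _]mulrAC mulfK // expf_neq0.
Qed.

(** A non-constant eigenvalue has half multiplicity 1, so the last factor of [cofactor_eval] is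
    trivial and [rho_s] does not occur in it. *)
Lemma ddir_cofactor_chi s t : ddir (Dchi R h s) (fun y => cofactor_eval d (inl s) y t) x = 0.
Proof.
rewrite (@ddir_ext _ _ _ _ (fun y => \prod_(e' | e' != inl s) (t - ev d e' y) ^+ hmult h e')); last first.
  by move=> y; rewrite /cofactor_eval /= subnn expr0 mulr1.
have ce e : cdiff (ev d e) x by case: e => k; [exact: rho_cdiff|exact: cdiff_cst].
have cB e : cdiff (fun y => t - ev d e y) x by apply: cdiffB (cdiff_cst _ _) _.
apply: ddir_prod0 => e es; first exact: cdiffX.
apply: ddirX0 => //; rewrite ddir_cstB //; case: e es => [k|c] es /=; last by rewrite ddir_cst oppr0.
by rewrite ddir_rho_chi // (_ : s == k = false) ?mul0r ?oppr0 //; apply/negbTE; apply: contraNneq es => ->.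
Qed.

(** The derivative of [1 / Delta_s] in the flux cancels the term of [Delta_s] in [log_volume_chi].
    The other two density terms are absorbed by differentiating after multiplication with
    [rho'_s hchar_s]. *)
Lemma flux_chi_term t s (I := lshift dimS (lshift r s)) :
  ddir (col I (frame d x)) (fun y => flux d psi t y I 0) x
    + log_volume_diff (nf_g d) (col I (frame d x)) x * flux d psi t x I 0 =
  cofactor_eval d (inl s) x t / (eps d s * Delta d s x * rho' d s x * hchar s x)
  * pchi s (fun y => rho' d s y * hchar s y * pchi s psi y) x.
Proof.
have -> : col I (frame d x) = Dchi R h s.
  rewrite -col_frame_chi; apply/colP => a; rewrite [LHS]mxE [RHS]mxE.
  by rewrite /frame !row_mxEl.
rewrite (@ddir_ext _ _ _ _ (fun y => cofactor_eval d (inl s) y t *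
   ((eps d s * Delta d s y)^-1 * pchi s psi y))) => [|y]; last by rewrite flux_chi.
rewrite flux_chi -[ddir (Dchi R h s) psi x]/(pchi s psi x).
have cp := cofactor_eval_cdiff (inl s) t nfd Wx.
have cE : cdiff (fun y => eps d s * Delta d s y) x by apply: cdiffZ; apply: Delta_cdiff.
have cr' := rho'_cdiff s nfd Wx.
have cpsi : cdiff (pchi s psi) x by exact: smooth_cdiff_ddir sp Wx.
have e0 := eps_neq0 d s; have D0 := Delta_neq0 nfd Wx s; have r0 := rho'_neq0 nfd s Wx.
have h0 := hchar_neq0 s; have cD := Delta_cdiff nfd s Wx; have ch := hchar_cdiff s.
have ED0 : eps d s * Delta d s x != 0 by rewrite mulf_neq0.
rewrite ddirM //; last by apply: cdiffM => //; apply: cdiffV.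
rewrite ddir_cofactor_chi mul0r add0r ddirM //; last exact: cdiffV.
rewrite ddirV // ddirZ // log_volume_chi //.
rewrite -[pchi s (fun y => _ * _ * _) x]/(ddir (Dchi R h s) (fun y => rho' d s y * hchar s y * pchi s psi y) x).
rewrite ddirM //; last exact: cdiffM.
rewrite ddirM // ddir_hchar.
move: (\sum_c _) (ddir _ (pchi _ _) x) (ddir _ (Delta _ _) x) (ddir _ (rho' _ _) x) => S ddpsi dD dr'.
move: (pchi _ _ _) (cofactor_eval _ _ _ _) (eps d s) (Delta d s x) (rho' d s x) (hchar s x) e0 D0 r0 h0 ED0.
move=> P p e D r' H e0 D0 r0 h0 _.
by field; rewrite e0 D0 r0 h0.
Qed.

Variable om : 'I_r -> C.
Hypothesis dt_psi : forall k y, nf_W d y -> pd (it h k) psi y = 'i%C * om k * psi y.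

Lemma ddir_frame_t s y : nf_W d y -> ddir (col s (frame_t d y)) psi y =
  'i%C / Delta d s y * (\sum_(j < r) (-1) ^+ j * rho d s y ^+ (r - j.+1) * om j) * psi y.
Proof.
move=> Wy; rewrite /frame_t !col_col_mx !col0 /ddir delta_block.
rewrite [X in X + _ + _]big1 ?[X in _ + _ + X]big1 ?add0r ?addr0 => [|a _|a _]; last 2 first.
- by rewrite mxE mul0r.
- by rewrite mxE mul0r.
rewrite mulr_sumr mulr_suml; apply: eq_bigr => j _.
rewrite mxE muhat_invE -/(it h j) dt_psi //.
by move: (Delta _ _ _)^-1 (rho _ _ _ ^+ _) => D S; ring.
Qed.

(** The coefficients depend on U only, so the field along [t] acts twice on [psi] alone; the two
    factors [i] give the minus sign and the sum over [om] appears squared. *)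
Lemma flux_t_term t s (I := lshift dimS (rshift r s)) :
  ddir (col I (frame d x)) (fun y => flux d psi t y I 0) x
    + log_volume_diff (nf_g d) (col I (frame d x)) x * flux d psi t x I 0 =
  - (cofactor_eval d (inl s) x t * eps d s / (Delta d s x * rho' d s x ^+ 2)
     * (\sum_(j < r) (-1) ^+ j * rho d s x ^+ (r - j.+1) * om j) ^+ 2) * psi x.
Proof.
have colI : col I (frame d x) = col s (frame_t d x).
  by apply/colP => a; rewrite [LHS]mxE [RHS]mxE /frame row_mxEl row_mxEr.
have colt : col s (frame_t d x) = col_mx (col_mx 0 (col s (muhat_inv d x))) 0.
  by rewrite /frame_t !col_col_mx !col0.
rewrite colI [X in log_volume_diff _ X]colt log_volume_t // mul0r addr0.
pose S y := \sum_(j < r) (-1) ^+ j * rho d s y ^+ (r - j.+1) * om j.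
pose K y := cofactor_eval d (inl s) y t *
  ((rho' d s y ^+ 2 / (eps d s * Delta d s y))^-1 * ('i%C / Delta d s y * S y)).
have Kn : \forall y \near x, flux d psi t y I 0 = K y * psi y.
  by apply: filterS (near_W nfd Wx) => y Wy; rewrite flux_t ddir_frame_t // /K !mulrA.
have cS : cdiff S x.
  apply: cdiff_sum => j _; apply: cdiffM; last exact: cdiff_cst.
  by apply: cdiffZ; apply: cdiffX; apply: rho_cdiff.
have e0 := eps_neq0 d s; have D0 := Delta_neq0 nfd Wx s; have r0 := rho'_neq0 nfd s Wx.
have cD := Delta_cdiff nfd s Wx.
have cK : cdiff K x.
  apply: cdiffM; first exact: cofactor_eval_cdiff.
  apply: cdiffM; last by apply: cdiffM => //; apply: cdiff_div (cdiff_cst _ _) _.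
  apply: cdiffV; first by rewrite mulf_neq0 ?invr_eq0 ?expf_neq0 ?mulf_neq0.
  apply: cdiff_div; [by rewrite mulf_neq0 |by apply: cdiffX; apply: rho'_cdiff|by apply: cdiffZ].
have K0 : ddir (col s (frame_t d x)) K x = 0.
  rewrite colt; apply: ddir_u_dep => y.
  rewrite /K /S cofactor_eval_lift rho'_lift Delta_lift.
  by congr (_ * (_ * (_ * _))); apply: eq_bigr => j _; rewrite rho_lift.
rewrite (ddir_near _ Kn) ddirM //; last exact: smooth_cdiff0 sp Wx.
rewrite K0 mul0r add0r ddir_frame_t // -/(S x) /K.
have i2 : 'i%C * 'i%C = -1 :> C by rewrite -expr2 sqr_i.
move: (S x) (cofactor_eval _ _ _ _) (eps d s) (Delta d s x) (rho' d s x) (psi x) e0 D0 r0.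
move=> T p e D r' P e0 D0 r0.
transitivity ('i%C * 'i%C * (p * e / (D * r' ^+ 2) * T ^+ 2 * P)).
  by field; rewrite D0 r0 e0.
by rewrite i2 mulN1r mulNr.
Qed.

End AtPoint.
End FluxTerms.

(** * The second-order operators on the factors S_c *)

Section HorizontalLaplacian.
Variables (R : realType) (l q nb : nat) (h : 'I_nb -> nat) (d : nf_data R l q nb h).
Local Notation C := R[i].
Local Notation r := (l + l + q)%N.
Local Notation m c := ((h c).*2).
Local Notation dimS := (\sum_(c < nb) m c)%N.
Local Notation N := (r + r + dimS)%N.
Local Notation pt := 'rV[R]_N.
Local Notation rhoc c := ((nf_rhoc d c)%:C).

Lemma ddir_frame_y c (b : 'I_(m c)) F (x y : pt) :
  ddir (col (tagnat.Rank c b) (frame_y d y)) F x =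
  pd (iy l q b) F x - \sum_k alpha d k b y * pd (it h k) F x.
Proof.
rewrite /frame_y !col_col_mx col0 col1 /ddir delta_block.
rewrite [X in X + _ + _]big1 ?add0r => [|a _]; last by rewrite mxE mul0r.
rewrite addrC [X in X + _](bigD1 (tagnat.Rank c b)) //= mxE eqxx mul1r.
rewrite [X in _ + X + _]big1 ?addr0 => [|a ab]; last by rewrite mxE (negbTE ab) mul0r.
by congr (_ + _); rewrite -sumrN; apply: eq_bigr => k _; rewrite !mxE mulNr.
Qed.

Lemma ginvS_cdiff c (a b : 'I_(m c)) x : normal_form d -> nf_W d x -> cdiff (ginvS d a b) x.
Proof.
move=> nfd Wx; apply: (cdiff_invmx (gS_cdiff nfd (c := c) Wx)).
by apply: filterS (near_W nfd Wx) => y Wy; apply: gS_unit.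
Qed.

Lemma alpha_coef_cdiff c (b : 'I_(m c)) k x : normal_form d -> nf_W d x -> cdiff (alpha d k b) x.
Proof.
move=> nfd Wx; apply: (@cdiff_ext _ _ _ (fun y => alpha_mx d y k (tagnat.Rank c b))) => [y|].
  by rewrite mxE.
exact: alpha_cdiff.
Qed.

Lemma pd_t_ginvS c (a b : 'I_(m c)) k (x : pt) : pd (it h k) (ginvS d a b) x = 0.
Proof.
rewrite pd_ddir -/(Dt R h k) Dt_col.
exact: (ddir_s0 (fun s => invmx (gS d (y_part c s)) a b)).
Qed.

Lemma pd_t_alpha c (b : 'I_(m c)) k' k (x : pt) : pd (it h k) (alpha d k' b) x = 0.
Proof.
rewrite pd_ddir -/(Dt R h k) Dt_col.
exact: (ddir_s0 (fun s => (nf_alpha d k' s 0 (tagnat.Rank c b))%:C)).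
Qed.

(** The algebra of composing two operators of the form derivative minus [I] times potential;
    [I * I = -1] produces the sign of the term quadratic in the potential. *)
Lemma horizontal_sum (K : comPzRingType) (I : K) n p (D P0 : K) (A g : 'I_n -> 'I_n -> K)
    (B : 'I_p -> 'I_n -> 'I_n -> K) (al : 'I_p -> 'I_n -> K) (om : 'I_p -> K) (P : 'I_n -> K) :
  I * I = -1 ->
  \sum_a (D * (\sum_b A a b - I * \sum_k \sum_b B k a b)
          - I * \sum_k al k a * om k * \sum_b g a b * (P b - I * \sum_s al s b * om s * P0)) =
  \sum_a \sum_b D * A a b - I * \sum_k \sum_a \sum_b D * B k a b
  - I * \sum_k \sum_a \sum_b g a b * al k a * om k * P b
  - \sum_s \sum_k \sum_a \sum_b g a b * al k a * al s b * om k * om s * P0.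
Proof.
move=> I2.
have E a : I * \sum_k al k a * om k * \sum_b g a b * (P b - I * \sum_s al s b * om s * P0) =
    I * (\sum_k \sum_b g a b * al k a * om k * P b)
    + \sum_s \sum_k \sum_b g a b * al k a * al s b * om k * om s * P0.
  rewrite [X in I * X = _](_ : _ = (\sum_k \sum_b g a b * al k a * om k * P b)
     - I * \sum_s \sum_k \sum_b g a b * al k a * al s b * om k * om s * P0).
    by rewrite mulrBr [X in _ - X]mulrA I2 mulN1r opprK.
  rewrite [X in _ - _ * X]exchange_big [X in _ - X]mulr_sumr -sumrB; apply: eq_bigr => k _ /=.
  rewrite [X in _ - _ * X]exchange_big [X in _ - X]mulr_sumr [LHS]mulr_sumr -sumrB; apply: eq_bigr => b _ /=.
  rewrite mulrBr mulrBr; congr (_ - _); first by ring.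
  by rewrite !mulr_sumr; apply: eq_bigr => s _; ring.
under eq_bigr do rewrite E opprD mulrBr mulrCA !mulr_sumr addrA.
rewrite !sumrB; congr (_ - _ - _ - _).
- rewrite exchange_big mulr_sumr; apply: eq_bigr => k _; rewrite mulr_sumr; apply: eq_bigr => a _ /=.
  by rewrite mulr_sumr.
- rewrite exchange_big mulr_sumr; apply: eq_bigr => k _; rewrite mulr_sumr.
  by apply: eq_bigr => a _.
by rewrite exchange_big; apply: eq_bigr => s _; rewrite exchange_big.
Qed.

Variables (psi : pt -> C) (om : 'I_r -> C).

(** The bracket in equation (3): the expanded magnetic Laplacian of [g_c] whose potential is the sum
    of the [om k] times [alpha_k]. *)
Definition horizontal_laplacian c (x : pt) : C :=
  \sum_(a < m c) \sum_(b < m c) (densS d c x)^-1 *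
     pd (iy l q a) (fun x' => ginvS d a b x' * densS d c x' * pd (iy l q b) psi x') x
  - 'i%C * \sum_k \sum_(a < m c) \sum_(b < m c) (densS d c x)^-1 *
     pd (iy l q a) (fun x' => ginvS d a b x' * densS d c x' * alpha d k b x' * om k * psi x') x
  - 'i%C * \sum_k \sum_(a < m c) \sum_(b < m c)
     ginvS d a b x * alpha d k a x * om k * pd (iy l q b) psi x
  - \sum_p \sum_k \sum_(a < m c) \sum_(b < m c)
     ginvS d a b x * alpha d k a x * alpha d p b x * om k * om p * psi x.

Definition horizontal_grad c (b : 'I_(m c)) (y : pt) : C :=
  pd (iy l q b) psi y - 'i%C * \sum_k alpha d k b y * om k * psi y.

Definition horizontal_flux c (a : 'I_(m c)) (y : pt) : C :=
  \sum_b ginvS d a b y * horizontal_grad b y.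

Hypotheses (nfd : normal_form d) (ssd : semisimple d) (sp : smooth (nf_W d) psi).
Hypothesis dt_psi : forall k y, nf_W d y -> pd (it h k) psi y = 'i%C * om k * psi y.

Lemma horizontal_gradE c (b : 'I_(m c)) y : nf_W d y ->
  ddir (col (tagnat.Rank c b) (frame_y d y)) psi y = horizontal_grad b y.
Proof.
move=> Wy; rewrite ddir_frame_y; congr (_ - _); rewrite mulr_sumr; apply: eq_bigr => k _.
by rewrite dt_psi //; ring.
Qed.

(** Symmetry of second derivatives lets the equation along [t_k], valid near [x], be differentiated
    in any other coordinate. *)
Lemma pd_t_pd_psi k a x : nf_W d x -> pd (it h k) (pd a psi) x = 'i%C * om k * pd a psi x.
Proof.
move=> Wx; rewrite (pdC _ _ (W_open nfd) sp Wx).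
rewrite (@pd_near _ _ a _ (fun y => 'i%C * om k * psi y)); last first.
  by apply: filterS (near_W nfd Wx) => y Wy; apply: dt_psi.
by rewrite pd_ddir ddirZ -?pd_ddir //; exact: smooth_cdiff0 sp Wx.
Qed.

Section AtPoint.
Variable x : pt.
Hypothesis Wx : nf_W d x.

Let cpsi : cdiff psi x. Proof. exact: smooth_cdiff0 sp Wx. Qed.

Lemma alpha_om_cdiff c (b : 'I_(m c)) k : cdiff (fun y => alpha d k b y * om k * psi y) x.
Proof.
apply: cdiffM cpsi; apply: cdiffM; last exact: cdiff_cst.
exact: alpha_coef_cdiff.
Qed.

Lemma horizontal_grad_cdiff c (b : 'I_(m c)) : cdiff (horizontal_grad b) x.
Proof.
apply: cdiffB; first exact: smooth_cdiff_pd sp Wx.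
by apply: cdiffZ; apply: cdiff_sum => k _; apply: alpha_om_cdiff.
Qed.

Lemma horizontal_flux_cdiff c (a : 'I_(m c)) : cdiff (horizontal_flux a) x.
Proof.
by apply: cdiff_sum => b _; apply: cdiffM; [apply: ginvS_cdiff|apply: horizontal_grad_cdiff].
Qed.

Lemma pd_t_horizontal_flux c (a : 'I_(m c)) k :
  pd (it h k) (horizontal_flux a) x = 'i%C * om k * horizontal_flux a x.
Proof.
rewrite pd_ddir ddir_sum; last first.
  by move=> b _; apply: cdiffM; [apply: ginvS_cdiff|apply: horizontal_grad_cdiff].
rewrite /horizontal_flux mulr_sumr; apply: eq_bigr => b _.
rewrite ddirM; [|exact: ginvS_cdiff|exact: horizontal_grad_cdiff].
rewrite -pd_ddir pd_t_ginvS mul0r add0r mulrCA; congr (_ * _).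
rewrite ddirB; last 2 first.
- exact: smooth_cdiff_pd sp Wx.
- by apply: cdiffZ; apply: cdiff_sum => k' _; apply: alpha_om_cdiff.
rewrite -pd_ddir pd_t_pd_psi // ddirZ; last by apply: cdiff_sum => k' _; apply: alpha_om_cdiff.
rewrite ddir_sum; last by move=> k' _; apply: alpha_om_cdiff.
rewrite /horizontal_grad mulrBr; congr (_ - _); rewrite mulrCA; congr (_ * _).
rewrite mulr_sumr; apply: eq_bigr => k' _.
have ca : cdiff (fun y => alpha d k' b y * om k') x.
  by apply: cdiffM; [exact: alpha_coef_cdiff|exact: cdiff_cst].
rewrite ddirM // ddirM; [|exact: alpha_coef_cdiff|exact: cdiff_cst].
by rewrite -!pd_ddir pd_t_alpha pd_cst mul0r mulr0 addr0 mul0r add0r dt_psi // mulrCA.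
Qed.

(** The prefactor [K] depends on U only and commutes with the horizontal lift; the density term is
    absorbed as the derivative of [D] times the flux, and the [t] part of the lift acts on the flux
    as multiplication by [i om_k]. *)
Lemma flux_y_term t c (a : 'I_(m c)) (I := rshift (r + r) (tagnat.Rank c a)) :
  ddir (col I (frame d x)) (fun y => flux d psi t y I 0) x
    + log_volume_diff (nf_g d) (col I (frame d x)) x * flux d psi t x I 0 =
  cofactor_eval d (inr c) x t / Pc d c x *
   ((densS d c x)^-1 *
      (\sum_b pd (iy l q a) (fun x' => ginvS d a b x' * densS d c x' * pd (iy l q b) psi x') x
       - 'i%C * \sum_k \sum_b
          pd (iy l q a) (fun x' => ginvS d a b x' * densS d c x' * alpha d k b x' * om k * psi x') x)
    - 'i%C * \sum_k alpha d k a x * om k * horizontal_flux a x).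
Proof.
have colI : col I (frame d x) = col (tagnat.Rank c a) (frame_y d x).
  by apply/colP => j; rewrite [LHS]mxE [RHS]mxE /frame row_mxEr.
have coly : col (tagnat.Rank c a) (frame_y d x) =
    col_mx (col_mx 0 (- col (tagnat.Rank c a) (alpha_mx d x))) (delta_mx (tagnat.Rank c a) 0).
  rewrite /frame_y !col_col_mx col0 col1; congr (col_mx (col_mx _ _) _).
  by apply/colP => j; rewrite !mxE.
rewrite colI [X in log_volume_diff _ X]coly log_volume_y // -coly.
pose K y := cofactor_eval d (inr c) y t / Pc d c y.
have Kn : \forall y \near x, flux d psi t y I 0 = K y * horizontal_flux a y.
  apply: filterS (near_W nfd Wx) => y Wy; rewrite flux_y; congr (_ * _).
  by apply: eq_bigr => b _; rewrite horizontal_gradE.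
have cK : cdiff K x.
  by apply: cdiff_div; [exact: Pc_neq0|exact: cofactor_eval_cdiff|exact: Pc_cdiff].
have K0 : ddir (col (tagnat.Rank c a) (frame_y d x)) K x = 0.
  rewrite coly; apply: ddir_u_dep => y; rewrite /K cofactor_eval_lift; congr (_ / _).
  by apply: eq_bigr => k _; rewrite rho_lift.
have cG := horizontal_flux_cdiff a.
have D0 := densS_neq0 nfd c Wx; have cD := densS_cdiff nfd c Wx.
rewrite (ddir_near _ Kn) (nbhs_singleton Kn) ddirM // K0 mul0r add0r -/(K x).
set v := col _ _; set G := horizontal_flux a.
have -> : K x * ddir v G x + ddir v (densS d c) x / densS d c x * (K x * G x) =
    K x * ((densS d c x)^-1 * ddir v (fun y => densS d c y * G y) x).
  by rewrite ddirM //; move: (K x) (ddir _ _ _) (ddir _ _ _) => k1 k2 k3; field.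
congr (_ * _); rewrite ddir_frame_y mulrBr.
have -> : \sum_k alpha d k a x * pd (it h k) (fun y => densS d c y * G y) x =
    densS d c x * ('i%C * \sum_k alpha d k a x * om k * G x).
  rewrite !mulr_sumr; apply: eq_bigr => k _.
  rewrite [in LHS]pd_ddir ddirM // -!pd_ddir pd_t_horizontal_flux -/G.
  rewrite (_ : pd _ (densS d c) x = 0); first by ring.
  by rewrite pd_ddir -/(Dt R h k) Dt_col ddir_densS0.
rewrite mulKf //; congr (_ * _ - _).
have cg b := ginvS_cdiff a b nfd Wx.
rewrite (@pd_near _ _ _ _ (fun y => \sum_b ginvS d a b y * densS d c y * pd (iy l q b) psi y
   - 'i%C * \sum_k \sum_b ginvS d a b y * densS d c y * alpha d k b y * om k * psi y)); last first.
  near=> y; rewrite /G /horizontal_flux exchange_big !mulr_sumr -sumrB; apply: eq_bigr => b _.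
  rewrite /horizontal_grad /= mulrBr mulrBr; congr (_ - _); first by ring.
  by rewrite !mulr_sumr; apply: eq_bigr => k _; ring.
have cp b : cdiff (pd (iy l q b) psi) x by exact: smooth_cdiff_pd sp Wx.
have c1 b : cdiff (fun y => ginvS d a b y * densS d c y) x by apply: cdiffM.
have c2 b : cdiff (fun y => ginvS d a b y * densS d c y * pd (iy l q b) psi y) x by apply: cdiffM.
have c3 k b : cdiff (fun y => ginvS d a b y * densS d c y * alpha d k b y * om k * psi y) x.
  apply: cdiffM cpsi; apply: cdiffM (cdiff_cst _ _); apply: cdiffM => //.
  exact: alpha_coef_cdiff.
have c4 k : cdiff (fun y => \sum_b ginvS d a b y * densS d c y * alpha d k b y * om k * psi y) x.
  by apply: cdiff_sum.
rewrite pd_ddir ddirB; last 2 first.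
- by apply: cdiff_sum.
- by apply: cdiffZ; apply: cdiff_sum.
rewrite ddir_sum // ddirZ; last by apply: cdiff_sum.
rewrite ddir_sum //; congr (_ - _ * _); first by apply: eq_bigr => b _; rewrite pd_ddir.
apply: eq_bigr => k _; rewrite ddir_sum //; apply: eq_bigr => b _.
by rewrite pd_ddir.
Unshelve. all: by end_near.
Qed.

Lemma flux_y_sum t c : \sum_(a < m c)
  (ddir (col (rshift (r + r) (tagnat.Rank c a)) (frame d x))
     (fun y => flux d psi t y (rshift (r + r) (tagnat.Rank c a)) 0) x
   + log_volume_diff (nf_g d) (col (rshift (r + r) (tagnat.Rank c a)) (frame d x)) x
     * flux d psi t x (rshift (r + r) (tagnat.Rank c a)) 0) =
  cofactor_eval d (inr c) x t / Pc d c x * horizontal_laplacian c x.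
Proof.
rewrite [LHS](eq_bigr _ (fun a _ => flux_y_term t a)).
rewrite -mulr_sumr; congr (_ * _).
by rewrite /horizontal_flux /horizontal_grad horizontal_sum // -expr2 sqr_i.
Qed.

End AtPoint.
End HorizontalLaplacian.

(** * Assembling Q_t from the separated operators *)

Section QOperator.
Variables (R : realType) (l q nb : nat) (h : 'I_nb -> nat) (d : nf_data R l q nb h).
Local Notation C := R[i].
Local Notation r := (l + l + q)%N.
Local Notation m c := ((h c).*2).
Local Notation dimS := (\sum_(c < nb) m c)%N.
Local Notation N := (r + r + dimS)%N.
Local Notation pt := 'rV[R]_N.
Local Notation rhoc c := ((nf_rhoc d c)%:C).

Variables (f : 'I_r + 'I_nb -> pt -> C) (psi : pt -> C) (om : 'I_r -> C).
Hypotheses (nfd : normal_form d) (ssd : semisimple d) (sp : smooth (nf_W d) psi).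
Hypothesis dt_psi : forall k y, nf_W d y -> pd (it h k) psi y = 'i%C * om k * psi y.

Definition chi_operator (k : 'I_r) (x : pt) : C :=
  - (eps d k * rho' d k x)^-1 *
      pchi k (fun x' => rho' d k x' * hchar d k x' * pchi k psi x') x
  + (\sum_(a < r) \sum_(b < r)
       eps d k * (- rho d k x) ^+ (r.*2 - a.+1 - b.+1)
         / rho' d k x ^+ 2 * hchar d k x * om a * om b) * psi x
  + f (inl k) x * psi x.

Definition y_operator (c : 'I_nb) (x : pt) : C :=
  - (\prod_(c' | c' != c) (rhoc c - rhoc c')) * horizontal_laplacian d psi om c x
  + (\prod_(c' | c' != c) (rhoc c - rhoc c') ^+ (h c' - 1))^-1 * f (inr c) x * psi x.

(** The coefficients of [Q_t psi] with respect to the eigenvalues of [K_t]. For a constant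
    eigenvalue only the first powers of its gaps to the other constants are divided out; the powers
    [h c' - 1] stay with [f] inside [y_operator]. *)
Definition factor_operator e x : C :=
  match e with
  | inl k => (Delta d k x * hchar d k x)^-1 * chi_operator k x
  | inr c => (Pc d c x * \prod_(c' | c' != c) (rhoc c - rhoc c'))^-1 * y_operator c x
  end.

Lemma sign_reflect n j : (j < n)%N -> (-1) ^+ (n - j.+1) = (-1) ^+ (n.-1 + j) :> C.
Proof.
case: n => // n; rewrite ltnS subSS /= => jn.
by rewrite -{2}(subnK jn) -addnA addnn exprD -mul2n exprM sqrrN !expr1n mulr1.
Qed.

(** Powers of [- rho] and alternating powers of [rho] differ by the global sign [(-1)^(r - 1)],
    which the square removes. *)
Lemma omega_square k x :
  \sum_(a < r) \sum_(b < r) eps d k * (- rho d k x) ^+ (r.*2 - a.+1 - b.+1)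
         / rho' d k x ^+ 2 * hchar d k x * om a * om b =
  eps d k / rho' d k x ^+ 2 * hchar d k x *
    (\sum_(j < r) (-1) ^+ j * rho d k x ^+ (r - j.+1) * om j) ^+ 2.
Proof.
have E : (\sum_(j < r) (-1) ^+ j * rho d k x ^+ (r - j.+1) * om j) ^+ 2 =
    (\sum_(j < r) (- rho d k x) ^+ (r - j.+1) * om j) ^+ 2.
  rewrite (_ : \sum_(j < r) (- rho d k x) ^+ (r - j.+1) * om j =
    (-1) ^+ r.-1 * \sum_(j < r) (-1) ^+ j * rho d k x ^+ (r - j.+1) * om j).
    by rewrite exprMn sqrr_sign mul1r.
  rewrite mulr_sumr; apply: eq_bigr => j _; rewrite (exprNn (rho d k x)).
  by rewrite (sign_reflect (ltn_ord j)) exprD !mulrA.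
rewrite E [X in _ = _ * X]expr2 [X in _ = _ * X]mulr_suml [RHS]mulr_sumr; apply: eq_bigr => a _.
rewrite !mulr_sumr; apply: eq_bigr => b _.
rewrite (_ : (r.*2 - a.+1 - b.+1)%N = (r - a.+1 + (r - b.+1))%N); last first.
  by rewrite -addnn -addnBAC ?ltn_ord // -addnBA ?ltn_ord.
by rewrite exprD; ring.
Qed.

Lemma sum_split3 n1 n2 n3 (F : 'I_(n1 + n2 + n3) -> C) : \sum_I F I =
  \sum_s F (lshift n3 (lshift n2 s)) + \sum_s F (lshift n3 (rshift n1 s))
  + \sum_j F (rshift (n1 + n2) j).
Proof. by rewrite !big_split_ord. Qed.

Lemma sum_blocks (F : 'I_N -> C) : \sum_I F I =
  \sum_s F (lshift dimS (lshift r s)) + \sum_s F (lshift dimS (rshift r s))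
  + \sum_c \sum_(a < m c) F (rshift (r + r) (tagnat.Rank c a)).
Proof.
rewrite sum_split3; congr (_ + _).
by rewrite -(sum_tagnat (fun j => F (rshift (r + r) j))).
Qed.

Lemma rhoc_neq c c' : c != c' -> rhoc c - rhoc c' != 0.
Proof.
move=> cc'; rewrite subr_eq0 (inj_eq (@complexI R)).
by apply: contra cc' => /eqP/(nf_rhoc_inj nfd) ->.
Qed.

Lemma cofactor_div e t x :
  \prod_(e' | e' != e) ((t - ev d e' x) ^+ hmult h e' / (ev d e x - ev d e' x) ^+ hmult h e')
    * (t - ev d e x) ^+ (hmult h e - 1) =
  cofactor_eval d e x t / \prod_(e' | e' != e) (ev d e x - ev d e' x) ^+ hmult h e'.
Proof. by rewrite prodf_div mulrAC. Qed.

Lemma gap_prod_chi k x : \prod_(e' | e' != inl k) (rho d k x - ev d e' x) ^+ hmult h e' =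
  Delta d k x * hchar d k x.
Proof. by rewrite big_sumType. Qed.

Lemma gap_prod_const c x : \prod_(e' | e' != inr c) (rhoc c - ev d e' x) ^+ hmult h e' =
  Pc d c x * \prod_(c' | c' != c) (rhoc c - rhoc c') ^+ h c'.
Proof. by rewrite big_sumType. Qed.

(** By [cofactor_div] the potential [U_t] is a combination of the same functions of [t], so each
    [f e] joins the flux terms of its own eigenvalue. *)
Lemma Q_opE (t : R) x : nf_W d x ->
  Q_op d f t psi x = \sum_e cofactor_eval d e x t%:C * factor_operator e x.
Proof.
move=> Wx; rewrite /Q_op divergence_flux // sum_blocks big_sumType /=.
rewrite [X in X + _ + _](eq_bigr _ (fun s _ => flux_chi_term nfd ssd sp Wx t%:C s)).
rewrite [X in _ + X + _](eq_bigr _ (fun s _ => flux_t_term nfd ssd sp Wx dt_psi t%:C s)).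
rewrite [X in _ + _ + X](eq_bigr _ (fun c _ => flux_y_sum nfd ssd sp dt_psi Wx t%:C c)).
rewrite /U_fun big_sumType /= mulrDl !mulr_suml -big_split /= opprD -!sumrN addrACA -!big_split /=.
congr (_ + _); apply: eq_bigr => k _.
  rewrite /chi_operator omega_square.
  have := cofactor_div (inl k) t%:C x; rewrite /= gap_prod_chi => ->.
  have e0 := eps_neq0 d k; have D0 := Delta_neq0 nfd Wx k; have r0 := rho'_neq0 nfd k Wx.
  have h0 := hchar_neq0 nfd Wx k.
  move: (pchi _ _ _) (\sum_(j < r) _) (hchar _ _ _) (rho' _ _ _) (Delta _ _ _) (eps _ _)
    (f _ _) (cofactor_eval _ _ _ _) (psi x) e0 D0 r0 h0 => X S H r' D e F p P e0 D0 r0 h0.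
  by field; rewrite e0 D0 r0 h0.
have := cofactor_div (inr k) t%:C x; rewrite /= gap_prod_const => ->.
rewrite /y_operator.
have P0 := Pc_neq0 nfd Wx k.
have T0 : \prod_(c' | c' != k) (rhoc k - rhoc c') != 0.
  by apply/prodf_neq0 => c' ck; rewrite rhoc_neq // eq_sym.
have S0 : \prod_(c' | c' != k) (rhoc k - rhoc c') ^+ (h c' - 1) != 0.
  by apply/prodf_neq0 => c' ck; rewrite expf_neq0 // rhoc_neq // eq_sym.
have -> : \prod_(c' | c' != k) (rhoc k - rhoc c') ^+ h c' =
    (\prod_(c' | c' != k) (rhoc k - rhoc c')) * \prod_(c' | c' != k) (rhoc k - rhoc c') ^+ (h c' - 1).
  rewrite -big_split; apply: eq_bigr => c' _ /=.
  by rewrite -exprS subn1 prednK // (nf_h_gt0 nfd).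
move: (horizontal_laplacian _ _ _ _ _) (cofactor_eval _ _ _ _) (Pc _ _ _) (f _ _) (psi x) P0.
move: (\prod_(c' | _) _) (\prod_(c' | _) _) T0 S0 => T S T0 S0 L p P F Y P0.
by field; rewrite P0 T0 S0.
Qed.

End QOperator.

(** * Separation of variables *)

Section Interpolation.
Variables (R : realType) (l q nb : nat) (h : 'I_nb -> nat) (d : nf_data R l q nb h).
Local Notation C := R[i].
Local Notation r := (l + l + q)%N.
Local Notation m c := ((h c).*2).
Local Notation dimS := (\sum_(c < nb) m c)%N.
Local Notation N := (r + r + dimS)%N.
Local Notation pt := 'rV[R]_N.
Local Notation rhoc c := ((nf_rhoc d c)%:C).
Local Notation E := ('I_r + 'I_nb)%type.

(** The eigenvalue equations are given for real [t] only; the natural numbers already supply more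
    roots than the degree permits. *)
Lemma poly_real_eq0 (p : {poly C}) : (forall t : R, p.[t%:C] = 0) -> p = 0.
Proof.
move=> p0; apply: (@roots_geq_poly_eq0 _ p [seq n%:R | n <- iota 0 (size p)]).
- apply/allP => _ /mapP[n _ ->]; apply/eqP.
  by rewrite -(rmorph_nat (real_complex R)); apply: p0.
- by rewrite map_inj_in_uniq ?iota_uniq // => a b _ _ /eqP; rewrite eqr_nat => /eqP.
by rewrite size_map size_iota.
Qed.

Definition node_poly (e : E) (x : pt) : {poly C} := \prod_(e' | e' != e) ('X - (ev d e' x)%:P).

Definition const_poly : {poly C} := \prod_c ('X - (rhoc c)%:P) ^+ (h c - 1).

Lemma card_nodes : #|{: E}| = (r + nb)%N.
Proof. by rewrite card_sum !card_ord. Qed.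

Lemma size_node_poly e x : size (node_poly e x) = (r + nb)%N.
Proof.
rewrite /node_poly -big_filter size_prod_XsubC -card_nodes.
rewrite -sum1_size big_filter sum1_card.
have := cardC1 e; rewrite /predC1 /= => ->; rewrite prednK //.
by apply/card_gt0P; exists e.
Qed.

Lemma const_poly_monic : const_poly \is monic.
Proof. by apply: monic_prod => c _; rewrite monic_exp // monicXsubC. Qed.

Lemma size_const_poly : normal_form d -> (size const_poly <= (\sum_c h c).+1 - nb)%N.
Proof.
move=> nfd; apply: (leq_trans (size_prod_leq _ _)); rewrite card_ord leq_sub2r // ltnS leq_sum // => c _.
by rewrite size_exp_XsubC subn1 prednK // (nf_h_gt0 nfd).
Qed.

(** The factor [const_poly] is the same for all [e] and [x]; removing it leaves [r + R] polynomials
    that are, up to scaling, the Lagrange basis at the eigenvalues. *)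
Lemma cofactor_evalE e t x : normal_form d ->
  cofactor_eval d e x t = const_poly.[t] * (node_poly e x).[t].
Proof.
move=> nfd; rewrite !horner_prod; under eq_bigr do rewrite horner_exp hornerXsubC.
under [X in _ * X]eq_bigr do rewrite hornerXsubC.
have -> : \prod_c (t - rhoc c) ^+ (h c - 1) = \prod_e' (t - ev d e' x) ^+ (hmult h e' - 1).
  by rewrite big_sumType /= [X in X * _]big1 ?mul1r // => k _; rewrite expr0.
rewrite (bigD1 e) //= /cofactor_eval mulrC -mulrA -big_split; congr (_ * _).
apply: eq_bigr => e' _ /=; rewrite -exprSr subn1 prednK //.
exact: (hmult_gt0 nfd e').
Qed.

Lemma node_poly_neq e e' x : e' != e -> (node_poly e x).[ev d e' x] = 0.
Proof.
move=> ee'; rewrite horner_prod (bigD1 e') //= hornerXsubC subrr mul0r.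
by [].
Qed.

Section AtPoint.
Variable x : pt.
Hypotheses (nfd : normal_form d) (Wx : nf_W d x).

Lemma node_poly_ev_neq0 e : (node_poly e x).[ev d e x] != 0.
Proof.
rewrite horner_prod; apply/prodf_neq0 => e' ee'.
by rewrite hornerXsubC ev_neq // eq_sym.
Qed.

Lemma node_sum_ev (B : E -> C) e :
  (\sum_e' B e' *: node_poly e' x).[ev d e x] = B e * (node_poly e x).[ev d e x].
Proof.
rewrite horner_sum (bigD1 e) //= hornerZ big1 ?addr0 // => e' ee'.
by rewrite hornerZ node_poly_neq 1?eq_sym // mulr0.
Qed.

Lemma size_node_sum (B : E -> C) : (size (\sum_e B e *: node_poly e x)%R <= r + nb)%N.
Proof.
apply: (leq_trans (size_sum _ _ _)); apply/bigmax_leqP => e _.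
by rewrite (leq_trans (size_scale_leq _ _)) // size_node_poly.
Qed.

Lemma interpolation_eq (p p' : {poly C}) : (size p <= r + nb)%N -> (size p' <= r + nb)%N ->
  (forall e, p.[ev d e x] = p'.[ev d e x]) -> p = p'.
Proof.
move=> sp sp' pp'; apply/eqP; rewrite -subr_eq0; apply/eqP.
apply: (@roots_geq_poly_eq0 _ _ [seq ev d e x | e : E]).
- by apply/allP => _ /mapP[e _ ->]; rewrite /root hornerD hornerN pp' subrr.
- by rewrite map_inj_uniq ?enum_uniq //; apply: ev_inj.
rewrite size_map -cardE card_nodes (leq_trans (size_polyD _ _)) //.
by rewrite size_polyN geq_max sp.
Qed.

End AtPoint.
End Interpolation.

(** * From eigenvalue equations to separated equations and back *)

Section Separation.
Variables (R : realType) (l q nb : nat) (h : 'I_nb -> nat) (d : nf_data R l q nb h).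
Local Notation C := R[i].
Local Notation r := (l + l + q)%N.
Local Notation m c := ((h c).*2).
Local Notation dimS := (\sum_(c < nb) m c)%N.
Local Notation N := (r + r + dimS)%N.
Local Notation pt := 'rV[R]_N.
Local Notation rhoc c := ((nf_rhoc d c)%:C).

Variables (f : 'I_r + 'I_nb -> pt -> C) (psi : pt -> C).
Hypotheses (nfd : normal_form d) (ssd : semisimple d) (sp : smooth (nf_W d) psi).

Local Notation B om e x := (factor_operator d f psi om e x).

(** [L_t psi] is [CC] times a polynomial in [t] whose coefficients are, up to sign and the factor
    [- i], the derivatives of [psi] along the [t_j]; these can be read off because the exponents are
    distinct. *)
Lemma L_eigen_dt x0 (evL : R -> C) : nf_W d x0 -> psi x0 != 0 ->
  (forall t x, nf_W d x -> L_op d t psi x = evL t * psi x) ->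
  forall k x, nf_W d x ->
    pd (it h k) psi x = 'i%C * (- 'i%C * pd (it h k) psi x0 / psi x0) * psi x.
Proof.
move=> W0 p0 eL k x Wx.
pose T y : {poly C} := \sum_(j < r) ((-1) ^+ j * pd (it h j) psi y) *: 'X^(r - j.+1).
have TE y (t : C) : (T y).[t] = \sum_(j < r) (-1) ^+ j * t ^+ (r - j.+1) * pd (it h j) psi y.
  rewrite horner_sum; apply: eq_bigr => j _.
  by rewrite hornerZ hornerXn mulrAC.
have Tcoef y : (T y)`_(r - k.+1) = (-1) ^+ k * pd (it h k) psi y.
  rewrite coef_sum (bigD1 k) //= coefZ coefXn eqxx mulr1 [X in _ + X]big1 ?addr0 // => j jk.
  rewrite coefZ coefXn (_ : (_ == _) = false) ?mulr0 //; apply: contraNF jk => /eqP e.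
  rewrite -(inj_eq val_inj) -eqSS; apply/eqP.
  by rewrite -(subKn (ltn_ord j)) -e subKn.
pose CC : {poly C} := \prod_c ('X - (rhoc c)%:P) ^+ h c.
have CCE t : CC.[t] = const_char d t.
  by rewrite horner_prod; apply: eq_bigr => c _; rewrite horner_exp hornerXsubC.
have CC0 : CC != 0.
  by rewrite monic_neq0 // monic_prod // => c _; rewrite monic_exp // monicXsubC.
have eLp y (t : R) : nf_W d y -> - 'i%C * (CC.[t%:C] * (T y).[t%:C]) = evL t * psi y.
  by move=> Wy; rewrite -eL // (L_opE _ nfd ssd sp) // CCE TE mulrA.
(* Cross-multiplying the equations at [x] and [x0] eliminates [evL], about whose dependence on [t]
   nothing is assumed. *)
have Z : CC * (psi x0 *: T x - psi x *: T x0) = 0.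
  apply: poly_real_eq0 => t; rewrite hornerM hornerD hornerN !hornerZ.
  have mi : - 'i%C != 0 :> C by rewrite oppr_eq0 eq_complex /= oner_eq0 andbF.
  apply: (mulfI mi); rewrite mulr0.
  have := eLp x t Wx; have := eLp x0 t W0.
  move: (CC.[_]) (T x).[_] (T x0).[_] (evL t) => a b c e E0 E1.
  rewrite (_ : - 'i%C * _ = psi x0 * (- 'i%C * (a * b)) - psi x * (- 'i%C * (a * c))); last by ring.
  by rewrite E0 E1; ring.
move/eqP: Z; rewrite mulf_eq0 (negbTE CC0) /= subr_eq0 => /eqP.
move=> /(congr1 (fun p : {poly C} => p`_(r - k.+1))); rewrite !coefZ !Tcoef.
have s0 : (-1) ^+ k != 0 :> C by rewrite signr_eq0.
rewrite mulrCA [RHS]mulrCA => /(mulfI s0) E.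
have i2 : 'i%C * - 'i%C = 1 :> C by rewrite mulrN -expr2 sqr_i opprK.
by rewrite !mulrA i2 mul1r mulrAC [_ * psi x]mulrC -E mulrAC mulfV // mul1r.
Qed.

Lemma dt_L_eigen (om : 'I_r -> C) : (forall k x, nf_W d x -> pd (it h k) psi x = 'i%C * om k * psi x) ->
  exists evL : R -> C, forall t x, nf_W d x -> L_op d t psi x = evL t * psi x.
Proof.
move=> dt_psi.
exists (fun t => - 'i%C * const_char d t%:C *
  \sum_(j < r) (-1) ^+ j * t%:C ^+ (r - j.+1) * ('i%C * om j)) => t x Wx.
rewrite (L_opE _ nfd ssd sp) // -[RHS]mulrA [X in _ = _ * X]mulr_suml; congr (_ * _).
by apply: eq_bigr => j _; rewrite dt_psi // mulrA.
Qed.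

Variable om : 'I_r -> C.
Hypothesis dt_psi : forall k x, nf_W d x -> pd (it h k) psi x = 'i%C * om k * psi x.

Lemma Q_op_poly (t : R) x : nf_W d x -> Q_op d f t psi x =
  (const_poly d).[t%:C] * (\sum_e B om e x *: node_poly d e x).[t%:C].
Proof.
move=> Wx; rewrite (Q_opE f nfd ssd sp dt_psi) // horner_sum mulr_sumr; apply: eq_bigr => e _.
by rewrite cofactor_evalE // hornerZ mulrCA mulrC.
Qed.

Lemma Q_eigen_factors x0 (evQ : R -> C) : nf_W d x0 -> psi x0 != 0 ->
  (forall t x, nf_W d x -> Q_op d f t psi x = evQ t * psi x) ->
  exists2 P : {poly C}, (size P <= r + nb)%N &
    forall e x, nf_W d x -> B om e x * (node_poly d e x).[ev d e x] = P.[ev d e x] * psi x.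
Proof.
(* The eigenvalue is read off at [x0]: [const_poly d * P] takes the value [evQ t] at every real [t],
   so [P] is the candidate for all other points. *)
move=> W0 p0 eQ; pose P := \sum_e ((psi x0)^-1 * B om e x0) *: node_poly d e x0.
exists P; first exact: size_node_sum.
move=> e x Wx; rewrite -(@node_sum_ev _ _ _ _ _ d x (fun e => B om e x) e) mulrC -hornerZ; congr (_ .[_]).
have c0 : const_poly d != 0 by rewrite monic_neq0 // const_poly_monic.
apply/eqP; rewrite -subr_eq0; apply/eqP; apply: (mulfI c0); rewrite mulr0.
apply: poly_real_eq0 => t; rewrite hornerM hornerD hornerN hornerZ mulrBr -Q_op_poly // eQ //.
have PE : P = (psi x0)^-1 *: \sum_e B om e x0 *: node_poly d e x0.
  by rewrite scaler_sumr; apply: eq_bigr => e' _; rewrite scalerA.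
rewrite PE hornerZ; have := Q_op_poly t W0; rewrite eQ // => E.
by rewrite mulrCA [_ * (_^-1 * _)]mulrCA -E mulrA mulrCA mulrA mulrAC; field.
Qed.

Lemma factors_Q_eigen (P : {poly C}) : (size P <= r + nb)%N ->
  (forall e x, nf_W d x -> B om e x * (node_poly d e x).[ev d e x] = P.[ev d e x] * psi x) ->
  exists evQ : R -> C, forall t x, nf_W d x -> Q_op d f t psi x = evQ t * psi x.
Proof.
move=> sP PB; exists (fun t => (const_poly d).[t%:C] * P.[t%:C]) => t x Wx.
rewrite Q_op_poly // -mulrA; congr (_ * _); rewrite mulrC -hornerZ; congr (_ .[_]).
apply: (interpolation_eq nfd Wx); first exact: size_node_sum.
  by rewrite (leq_trans (size_scale_leq _ _)).
by move=> e; rewrite (@node_sum_ev _ _ _ _ _ d x (fun e => B om e x) e) hornerZ PB // mulrC.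
Qed.

Section AtPoint.
Variable x : pt.
Hypothesis Wx : nf_W d x.

(** The weight [hchar] is [const_poly] at [rho_k] times the simple gaps to the constants. It does
    not vanish, so one may divide by it, and the factor [const_poly] moves to the side of the
    eigenvalue. *)
Lemma chi_factor (P : {poly C}) k :
  chi_operator d f psi om k x = (const_poly d * P).[rho d k x] * psi x <->
  B om (inl k) x * (node_poly d (inl k) x).[rho d k x] = P.[rho d k x] * psi x.
Proof.
have NE : (node_poly d (inl k) x).[rho d k x] = Delta d k x * \prod_c (rho d k x - rhoc c).
  rewrite horner_prod big_sumType /=.
  by congr (_ * _); apply: eq_bigr => i _; rewrite hornerXsubC.
have RE : (const_poly d).[rho d k x] = \prod_c (rho d k x - rhoc c) ^+ (h c - 1).
  by rewrite horner_prod; apply: eq_bigr => c _; rewrite horner_exp hornerXsubC.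
have HE : hchar d k x = (const_poly d).[rho d k x] * \prod_c (rho d k x - rhoc c).
  rewrite RE -big_split; apply: eq_bigr => c _ /=.
  by rewrite -exprSr subn1 prednK // (nf_h_gt0 nfd).
have := hchar_neq0 nfd Wx k; rewrite HE mulf_eq0 negb_or => /andP[R0 T0].
have D0 := Delta_neq0 nfd Wx k.
rewrite hornerM /= HE NE.
move: (chi_operator _ _ _ _ _ _) (const_poly d).[_] (\prod_c _) (Delta _ _ _) P.[_]
  R0 T0 D0 => X S T D p S0 T0 D0.
have -> : (D * (S * T))^-1 * X * (D * T) = X / S by field; rewrite T0 S0 D0.
split=> [->|E]; first by field.
by rewrite -mulrA -E mulrC divfK.
Qed.

(** [const_poly] has degree [sum (h c - 1)] and [P] has degree below [r + R], so the product has at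
    most [n] coefficients and truncating the sum at [n] loses nothing. *)
Lemma chi_factor_coef (P : {poly C}) k : (size P <= r + nb)%N ->
  chi_operator d f psi om k x =
    (\sum_(j < cdim l q h) (const_poly d * P)`_j * rho d k x ^+ j) * psi x <->
  B om (inl k) x * (node_poly d (inl k) x).[rho d k x] = P.[rho d k x] * psi x.
Proof.
move=> sP; rewrite -horner_coef_wide; first exact: chi_factor.
have nbS : (nb <= \sum_c h c)%N.
  rewrite -{1}[nb]card_ord -sum1_card leq_sum // => c _.
  exact: nf_h_gt0 nfd c.
apply: (leq_trans (size_polyMleq _ _)).
apply: (@leq_trans ((\sum_c h c).+1 - nb + (r + nb)).-1).
  by rewrite -!subn1 leq_sub2r // leq_add // size_const_poly.
by rewrite subSn // addSn /= addnCA subnK.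
Qed.

(** Here [P] appears without [const_poly], which vanishes at [rho_c] as soon as [h c] exceeds 1;
    this is why equation (3) involves [lamt] where (2) involves [lam]. *)
Lemma y_factor (P : {poly C}) c :
  y_operator d f psi om c x = P.[rhoc c] * psi x <->
  B om (inr c) x * (node_poly d (inr c) x).[rhoc c] = P.[rhoc c] * psi x.
Proof.
have NE : (node_poly d (inr c) x).[rhoc c] = Pc d c x * \prod_(c' | c' != c) (rhoc c - rhoc c').
  rewrite horner_prod big_sumType /=.
  by congr (_ * _); apply: eq_bigr => i _; rewrite hornerXsubC.
rewrite NE /= mulrAC mulVf ?mul1r //.
by rewrite -NE; exact: (node_poly_ev_neq0 nfd Wx (inr c)).
Qed.

End AtPoint.
End Separation.

Theorem theorem8 (R : realType) (l q nb : nat) (h : 'I_nb -> nat)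
    (d : nf_data R l q nb h)
    (f : 'I_(l + l + q) + 'I_nb -> nf_point R l q h -> R[i])
    (psi : nf_point R l q h -> R[i]) :
  (2 <= cdim l q h)%N ->
  normal_form d ->
  semisimple d ->
  (forall e, smooth (nf_W d) (f e)) ->
  (forall e x, nf_W d x -> dfun (f e) x *m nf_A d x = ev d e x *: dfun (f e) x) ->
  smooth (nf_W d) psi ->
  (exists2 x, nf_W d x & psi x <> 0) ->
  simultaneous_eigenfunction d f psi <->
  exists (lamt : 'I_(l + l + q + nb) -> R[i]) (om : 'I_(l + l + q) -> R[i]),
    let rhoc (c : 'I_nb) : R[i] := (nf_rhoc d c)%:C in
    let lam : {poly R[i]} :=
      \prod_c ('X - (rhoc c)%:P) ^+ (h c - 1) * \sum_j lamt j *: 'X^j in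
    [/\ forall k x, nf_W d x -> pd (it h k) psi x = 'i%C * om k * psi x,
        forall k x, nf_W d x ->
          - (eps d k * rho' d k x)^-1 *
              pchi k (fun x' => rho' d k x' * \prod_c (rho d k x' - rhoc c) ^+ h c
                                * pchi k psi x') x
          + (\sum_(a < l + l + q) \sum_(b < l + l + q)
               eps d k * (- rho d k x) ^+ ((l + l + q).*2 - a.+1 - b.+1)
                 / rho' d k x ^+ 2
               * \prod_c (rho d k x - rhoc c) ^+ h c * om a * om b) * psi x
          + f (inl k) x * psi x
          = (\sum_(j < cdim l q h) lam`_j * rho d k x ^+ j) * psi x
      & forall c x, nf_W d x ->
          (\sum_j lamt j * rhoc c ^+ j) * psi x
          = - (\prod_(c' | c' != c) (rhoc c - rhoc c')) *
              (\sum_(a < (h c).*2) \sum_(b < (h c).*2) (densS d c x)^-1 *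
                 pd (iy l q a)
                   (fun x' => ginvS d a b x' * densS d c x' * pd (iy l q b) psi x') x
               - 'i%C * \sum_k \sum_(a < (h c).*2) \sum_(b < (h c).*2) (densS d c x)^-1 *
                 pd (iy l q a)
                   (fun x' => ginvS d a b x' * densS d c x' * alpha d k b x'
                              * om k * psi x') x
               - 'i%C * \sum_k \sum_(a < (h c).*2) \sum_(b < (h c).*2)
                   ginvS d a b x * alpha d k a x * om k * pd (iy l q b) psi x
               - \sum_p \sum_k \sum_(a < (h c).*2) \sum_(b < (h c).*2)
                   ginvS d a b x * alpha d k a x * alpha d p b x
                   * om k * om p * psi x)
            + (\prod_(c' | c' != c) (rhoc c - rhoc c') ^+ (h c' - 1))^-1
              * f (inr c) x * psi x].
Proof.
move=> _ nfd ssd _ _ sp [x0 W0 /eqP p0]; split.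
  move=> [evQ [evL H]].
  have dt := L_eigen_dt nfd ssd sp W0 p0 (fun t x Wx => (H t x Wx).2).
  have [P sP PB] := Q_eigen_factors nfd ssd sp dt W0 p0 (fun t x Wx => (H t x Wx).1).
  (* By its size bound [P] is recovered from its first [r + R] coefficients, which serve as
     [lamt]. *)
  have PE : \sum_(j < l + l + q + nb) P`_j *: 'X^j = P.
    rewrite -poly_def; apply/polyP => j; rewrite coef_poly; case: ltnP => // jn.
    by rewrite nth_default // (leq_trans sP).
  (* The value of [om k] is forced by the equation along [t_k] at [x0]. *)
  exists (fun j => P`_j), (fun k => - 'i%C * pd (it h k) psi x0 / psi x0).
  rewrite PE; split=> // [k|c] x Wx.
    (* The displayed equation is [chi_operator] unfolded, and [lam] has become
       [const_poly d * P]. *)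
    by apply/(chi_factor_coef f psi nfd _ Wx k sP); apply: PB (inl k) x Wx.
  rewrite (_ : \sum_j _ = P.[(nf_rhoc d c)%:C]); last first.
    by rewrite -{2}PE horner_sum; apply: eq_bigr => j _; rewrite hornerZ hornerXn.
  symmetry; apply/(y_factor f psi nfd _ Wx P c); exact: PB (inr c) x Wx.
move=> [lamt [om [dt E2 E3]]].
set P := \sum_j lamt j *: 'X^j in E2.
(* Conversely, the number of constants [lamt] bounds the degree of [P], so that interpolation at the
   [r + R] eigenvalues determines it. *)
have sP : (size P <= l + l + q + nb)%N.
  apply: (leq_trans (size_sum _ _ _)); apply/bigmax_leqP => j _.
  by rewrite (leq_trans (size_scale_leq _ _)) // size_polyXn.
have [evL eL] := dt_L_eigen nfd ssd sp dt.
have [|evQ eQ] := @factors_Q_eigen _ _ _ _ _ d f psi nfd ssd sp om dt P sP.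
  move=> [k|c] x Wx.
    by apply/(chi_factor_coef f psi nfd _ Wx k sP); apply: E2.
  apply/(y_factor f psi nfd _ Wx P c).
  rewrite -[LHS](E3 c x Wx) horner_sum; congr (_ * _); apply: eq_bigr => j _.
  by rewrite hornerZ hornerXn.
by exists evQ, evL => t x Wx; split; [exact: eQ|exact: eL].
Qed.
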